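(* For any $\epsilon>0$ there exists a continuous injective map $\phi:\overline{\mathbb B}^3\rightarrow\mathbb C^3$ which is holomorphic on $\mathbb B^3$ and such that (i) $\|\phi-\mathrm{id}\|_{\overline{\mathbb B}^3}<\epsilon$, and (ii) if $\Omega\subset\mathbb C^3$ is a domain with $\phi(\mathbb B^3)\subset\Omega$ and $\phi(\mathbb B^3)\subset\Omega$ is a Runge pair, then $\phi(\mathbb B^3)=\Omega$.
   Context: $\mathbb B^3$ is the open unit ball of $\mathbb C^3$ (Euclidean norm), $\overline{\mathbb B}^3$ its closure, and $\|\cdot\|_{\overline{\mathbb B}^3}$ is the supremum norm over $\overline{\mathbb B}^3$. A domain is a connected open set. For domains $U\subset\Omega$ in $\mathbb C^n$, $U\subset\Omega$ is a Runge pair ($U$ is Runge in $\Omega$) if every holomorphic function on $U$ can be approximated, uniformly on each compact subset of $U$, by restrictions to $U$ of holomorphic functions on $\Omega$. *)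

(* Defs.v *)
From HB Require Import structures.
From mathcomp Require Import all_boot all_order all_algebra complex.
From mathcomp Require Import all_classical all_reals all_analysis.

Set Implicit Arguments.
Unset Strict Implicit.
Unset Printing Implicit Defensive.

Import Order.TTheory GRing.Theory Num.Theory numFieldNormedType.Exports.

Local Open Scope classical_set_scope.
Local Open Scope ring_scope.

(* C^n is 'rV[R[i]^o]_n with R : realType; R[i] carries its topology and norm
   only through the alias R[i]^o.  The library's own norm on C^n is the max
   norm; it is used only through the topology and differentiability it induces,
   which are those of the Euclidean norm below. *)

Definition euclidean_norm (R : realType) (n : nat) (z : 'rV[R[i]^o]_n) : R :=
  Num.sqrt (\sum_(i < n) ComplexField.Normc.normc (z 0 i) ^+ 2).

Definition unit_ball (R : realType) (n : nat) : set 'rV[R[i]^o]_n :=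
  [set z | euclidean_norm z < 1].
Arguments unit_ball : clear implicits.

(* Extended-real valued, so that an unbounded function has sup norm +oo. *)
Definition sup_norm (R : realType) (n m : nat) (A : set 'rV[R[i]^o]_n)
    (f : 'rV[R[i]^o]_n -> 'rV[R[i]^o]_m) : \bar R :=
  ereal_sup [set (euclidean_norm (f z))%:E | z in A].

(* V and W are normed spaces over the field R[i], so [differentiable] is
   complex (Frechet) differentiability.  Functions are total; for open A only
   the values on A matter. *)
Definition holomorphic_on (R : realType) (V W : normedModType R[i])
    (A : set V) (f : V -> W) : Prop :=
  forall z, A z -> differentiable f z.

Definition is_domain (T : topologicalType) (A : set T) : Prop :=
  open A /\ connected A.

Definition runge_in (R : realType) (n : nat) (U Omega : set 'rV[R[i]^o]_n) :
    Prop :=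
  forall f : 'rV[R[i]^o]_n -> R[i]^o, holomorphic_on U f ->
  forall K : set 'rV[R[i]^o]_n, compact K -> K `<=` U ->
  forall e : R, 0 < e ->
  exists2 g : 'rV[R[i]^o]_n -> R[i]^o, holomorphic_on Omega g &
    forall z, K z -> ComplexField.Normc.normc (f z - g z) < e.

(* Main.v *)
(* The map is an infinite composition phi = T_0 o T_1 o ... of injective holomorphic
   maps of the closed ball into the open ball, with T_k close to the identity. Up to
   a rotation moving e_1 to a point q_k of the sphere and a contraction, T_k is a
   variant of Wermer's map,
     psi (z1, z2, z3) = (z1, z2 (1 - 2 c z3 - m c z2), z3 + m z2)
   with c and m rational functions of z1. It is injective where
   c (z1) (z3 + z3') <> 1, and maps the loop z3 = 0, z2 = 1 / (m c) to the loop
   (z1, 0, 1 / c), which bounds an analytic disc near e_1 while z2 o psi^-1 has a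
   pole on that disc, at the zero of m. By the maximum principle, functions
   holomorphic near the disc do not approximate z2 o psi^-1 on the loop.
   If the T_k converge fast enough to the identity, phi inherits such a loop and disc
   for every k. The q_k being dense in the sphere, a domain Omega in which phi (B) is
   Runge contains no phi (q) with |q| = 1, so phi (B) is open and closed in Omega.
   The inverse of phi is the uniform limit of the inverses of T_0 o ... o T_k, so
   only Cauchy estimates are needed from complex analysis; they come from Goursat's
   theorem on rectangles. *)

Require Import Defs.
From HB Require Import structures.
From mathcomp Require Import all_boot all_order all_algebra complex.
From mathcomp Require Import all_classical all_reals all_analysis.
From mathcomp Require Import spectral sesquilinear ring lra.

Set Implicit Arguments.
Unset Strict Implicit.
Unset Printing Implicit Defensive.

Import Order.TTheory GRing.Theory Num.Theory numFieldNormedType.Exports.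
Import ComplexField.Normc.

Local Open Scope classical_set_scope.
Local Open Scope ring_scope.

(** * Goursat's theorem and Cauchy estimates *)

(** Two features shape the construction. New maps enter on the inside, so each [T k] is seen only
    through the composition fixed before it: its effect is at most the Lipschitz constant of that
    composition times its distance to the identity, and this distance is prescribed once the
    constant is known. Moreover [tau k.+1], the tolerance for all later maps, is chosen after the
    loop and the disc of [T k]. The later maps do not move these: the disc is transported by the
    earlier maps only, and the loop, lying well inside the ball, is contained exactly in the image
    of the limit of the later maps. They only disturb the values of the inverse on the loop, by at
    most [tau k.+1], which is small against the residue of the pole. The contraction in each step
    makes the infinite composition possible, since the model map may push points of the closed ball
    out of it. The price is a boundary layer that [T k] may fail to cover, of thickness [tau k]
    prescribed beforehand. The constants 2 and 3/2 of the analytic part come from integrating over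
    squares instead of circles; the margin 12 in [nice_sequence] absorbs them. *)

Section Integral.
Variable R : realType.
Local Notation mu := (@lebesgue_measure R).
Implicit Types (f g : R -> R) (a b : R).

Definition oint a b f : R := \int[mu]_(x in `[a, b]) f x.

Lemma continuous_itv_integrable a b f :
  (forall x, a <= x <= b -> {for x, continuous f}) ->
  mu.-integrable `[a, b] (EFin \o f).
Proof.
move=> fc; apply: continuous_compact_integrable; first exact: segment_compact.
apply: continuous_in_subspaceT => x; rewrite inE/= in_itv/= => xab.
exact: fc.
Qed.

Lemma oint_split a m b f : a <= m <= b ->
  (forall x, a <= x <= b -> {for x, continuous f}) ->
  oint a b f = oint a m f + oint m b f.
Proof.
move=> /andP[am mb] fc; rewrite /oint.
have /Rintegral_itvB := continuous_itv_integrable fc.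
move=> /(_ m); rewrite !bnd_simp => /(_ am mb).
rewrite Rintegral_itv_obnd_cbnd; last first.
  have fmb : mu.-integrable `[m, b] (EFin \o f).
    apply: continuous_itv_integrable => x /andP[mx xb].
    by apply: fc; rewrite xb (le_trans am).
  by apply: integrableS fmb => //; apply: subset_itvr; rewrite bnd_simp.
by move=> <-; rewrite addrC subrK.
Qed.

Lemma ointD a b f g :
  (forall x, a <= x <= b -> {for x, continuous f}) ->
  (forall x, a <= x <= b -> {for x, continuous g}) ->
  oint a b (fun x => f x + g x) = oint a b f + oint a b g.
Proof.
by move=> fc gc; rewrite /oint RintegralD//; exact: continuous_itv_integrable.
Qed.

Lemma oint_cst a b k : a <= b -> oint a b (fun=> k) = k * (b - a).
Proof.
move=> ab; rewrite /oint Rintegral_cst//= lebesgue_measure_itv/= lte_fin.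
move: ab; rewrite le_eqVlt => /predU1P[->|ab]; first by rewrite ltxx subrr.
by rewrite ab -EFinD.
Qed.

Lemma oint_bound a b f k e : a <= b ->
  (forall x, a <= x <= b -> {for x, continuous f}) ->
  (forall x, a <= x <= b -> `|f x - k| <= e) ->
  `|oint a b f - k * (b - a)| <= e * (b - a).
Proof.
move=> ab fc fk.
have ci k' : mu.-integrable `[a, b] (EFin \o (fun=> k')).
  by apply: continuous_itv_integrable => x _; exact: cvg_cst.
have fi := continuous_itv_integrable fc.
have h1 : oint a b f <= (k + e) * (b - a).
  rewrite -oint_cst//; apply: le_Rintegral => // x.
  rewrite /= in_itv/= => xab; move: (fk _ xab).
  by rewrite ler_norml => /andP[]; lra.
have h2 : (k - e) * (b - a) <= oint a b f.
  rewrite -oint_cst//; apply: le_Rintegral => // x.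
  rewrite /= in_itv/= => xab; move: (fk _ xab).
  by rewrite ler_norml => /andP[]; lra.
rewrite ler_norml; nra.
Qed.
End Integral.

Section Subdivision.
Variable R : realType.

(* Nested quartering: a violation of the bound passes to one of the four
   quarters, and the quarters shrink to a point. *)
Lemma subdivision (E : R -> R -> R -> R -> R) (e a b c d : R) :
  a <= b -> c <= d ->
  (forall a' b' c' d', a <= a' -> a' <= b' -> b' <= b ->
     c <= c' -> c' <= d' -> d' <= d ->
     let x := (a' + b') / 2 in let y := (c' + d') / 2 in
     E a' b' c' d' = E a' x c' y + E x b' c' y + E a' x y d' + E x b' y d') ->
  (forall x y, a <= x <= b -> c <= y <= d -> exists2 r, 0 < r &
     forall a' b' c' d', a <= a' -> b' <= b -> c <= c' -> d' <= d ->
       a' <= x <= b' -> c' <= y <= d' -> b' - a' < r -> d' - c' < r ->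
       `|E a' b' c' d'| <= e * ((b' - a') + (d' - c')) ^+ 2) ->
  `|E a b c d| <= e * ((b - a) + (d - c)) ^+ 2.
Proof.
move=> ab cd Eadd Eloc.
pose bad (q : R * R * R * R) := let: (a', b', c', d') := q in
  [/\ a <= a', a' <= b', b' <= b, c <= c' & c' <= d'] /\
  (d' <= d /\ ~ (`|E a' b' c' d'| <= e * ((b' - a') + (d' - c')) ^+ 2)).
pose sub (q q' : R * R * R * R) := let: (a1, b1, c1, d1) := q in
  let: (a2, b2, c2, d2) := q' in
  [/\ a1 <= a2, b2 <= b1, c1 <= c2 & d2 <= d1] /\
  (b2 - a2 = (b1 - a1) / 2 /\ d2 - c2 = (d1 - c1) / 2).
have step q : bad q -> exists q', bad q' /\ sub q q'.
  move: q => [[[a1 b1] c1] d1] [[h1 h2 h3 h4 h5] [h6 h7]].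
  have Eq := Eadd _ _ _ _ h1 h2 h3 h4 h5 h6; move: Eq => /=.
  set x := (a1 + b1) / 2; set y := (c1 + d1) / 2 => Eq.
  have xE : x - a1 = (b1 - a1) / 2 by rewrite /x; field.
  have xE' : b1 - x = (b1 - a1) / 2 by rewrite /x; field.
  have yE : y - c1 = (d1 - c1) / 2 by rewrite /y; field.
  have yE' : d1 - y = (d1 - c1) / 2 by rewrite /y; field.
  set S := (b1 - a1) + (d1 - c1) in h7.
  have SE : (b1 - a1) / 2 + (d1 - c1) / 2 = S / 2 by rewrite /S; field.
  have [ax xb] : a1 <= x /\ x <= b1 by move: h2; rewrite /x; clear; lra.
  have [cy yd] : c1 <= y /\ y <= d1 by move: h5; rewrite /y; clear; lra.
  case: (pselect (`|E a1 x c1 y| <= e * (S / 2) ^+ 2)) => [k1|k1]; last first.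
    exists (a1, x, c1, y); split; last by rewrite /sub xE yE !lexx.
    rewrite /bad xE yE SE; split; first split => //.
      exact: le_trans xb h3.
    by split => //; exact: le_trans yd h6.
  case: (pselect (`|E x b1 c1 y| <= e * (S / 2) ^+ 2)) => [k2|k2]; last first.
    exists (x, b1, c1, y); split; last by rewrite /sub xE' yE !lexx.
    rewrite /bad xE' yE SE; split; first split => //.
      exact: le_trans h1 ax.
    by split => //; exact: le_trans yd h6.
  case: (pselect (`|E a1 x y d1| <= e * (S / 2) ^+ 2)) => [k3|k3]; last first.
    exists (a1, x, y, d1); split; last by rewrite /sub xE yE' !lexx.
    rewrite /bad xE yE' SE; split; first split => //.
      exact: le_trans xb h3.
      exact: le_trans h4 cy.
    by [].
  case: (pselect (`|E x b1 y d1| <= e * (S / 2) ^+ 2)) => [k4|k4]; last first.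
    exists (x, b1, y, d1); split; last by rewrite /sub xE' yE' !lexx.
    rewrite /bad xE' yE' SE; split; first split => //.
      exact: le_trans h1 ax.
      exact: le_trans h4 cy.
    by [].
  (* The bound scales like the square of the half-perimeter, so four good quarters, each with a
     quarter of the bound, would make the parent good. *)
  exfalso; apply: h7; rewrite Eq.
  have -> : e * S ^+ 2 = 4 * (e * (S / 2) ^+ 2) by field.
  have n1 := ler_normD (E a1 x c1 y + E x b1 c1 y + E a1 x y d1) (E x b1 y d1).
  have n2 := ler_normD (E a1 x c1 y + E x b1 c1 y) (E a1 x y d1).
  have n3 := ler_normD (E a1 x c1 y) (E x b1 c1 y).
  lra.
apply: contrapT => nE.
have bad0 : bad (a, b, c, d) by [].
pose T := {q | bad q}.
have /choice[nx nxP] : forall q : T, exists q' : T, sub (sval q) (sval q').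
  move=> [q bq].
  by have [q' [bq' sq']] := step _ bq; exists (exist _ q' bq').
pose s n := iter n nx (exist bad (a, b, c, d) bad0).
pose sa n := (sval (s n)).1.1.1; pose sb n := (sval (s n)).1.1.2.
pose sc n := (sval (s n)).1.2; pose sd n := (sval (s n)).2.
have sE n : sval (s n) = (sa n, sb n, sc n, sd n).
  by rewrite /sa /sb /sc /sd; case: (sval (s n)) => [[[? ?] ?] ?].
have subn n : [/\ sa n <= sa n.+1, sb n.+1 <= sb n, sc n <= sc n.+1 &
   sd n.+1 <= sd n] /\ (sb n.+1 - sa n.+1 = (sb n - sa n) / 2 /\
   sd n.+1 - sc n.+1 = (sd n - sc n) / 2).
  have : sub (sval (s n)) (sval (s n.+1)) by exact: nxP.
  by rewrite !sE.
have badn n : bad (sa n, sb n, sc n, sd n) by rewrite -sE; exact: (svalP (s n)).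
have mono n m : (n <= m)%N -> [/\ sa n <= sa m, sb m <= sb n, sc n <= sc m &
   sd m <= sd n].
  elim: m => [|m IH]; first by rewrite leqn0 => /eqP ->.
  rewrite leq_eqVlt => /predU1P[->//|]; rewrite ltnS => /IH[i1 i2 i3 i4].
  have [[j1 j2 j3 j4] _] := subn m.
  by split; [exact: le_trans i1 j1|exact: le_trans j2 i2|
    exact: le_trans i3 j3|exact: le_trans j4 i4].
have len n : sb n - sa n = (b - a) / 2 ^+ n /\ sd n - sc n = (d - c) / 2 ^+ n.
  elim: n => [|n [IH1 IH2]]; first by rewrite expr0 !divr1.
  have [_ [-> ->]] := subn n; rewrite IH1 IH2 exprSr.
  by split; rewrite invfM mulrA.
have cross n m : sa n <= sb m /\ sc n <= sd m.
  have [p1 _ p3 _] := mono n (maxn n m) (leq_maxl _ _).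
  have [_ q2 _ q4] := mono m (maxn n m) (leq_maxr _ _).
  have [[_ r2 _ _ r5] _] := badn (maxn n m).
  by split; [exact: le_trans p1 (le_trans r2 q2)|exact: le_trans p3 (le_trans r5 q4)].
(* Left and lower ends stay below all right and upper ends, so these suprema give a point common to
   all the rectangles. *)
pose x := sup (range sa); pose y := sup (range sc).
have hx n : sa n <= x <= sb n.
  apply/andP; split.
    apply: ub_le_sup; last by exists n.
    by exists (sb 0%N) => _ [m _ <-]; have [] := cross m 0%N.
  apply: ge_sup; first by exists (sa 0%N), 0%N.
  by move=> _ [m _ <-]; have [] := cross m n.
have hy n : sc n <= y <= sd n.
  apply/andP; split.
    apply: ub_le_sup; last by exists n.
    by exists (sd 0%N) => _ [m _ <-]; have [] := cross m 0%N.
  apply: ge_sup; first by exists (sc 0%N), 0%N.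
  by move=> _ [m _ <-]; have [] := cross m n.
have [r r0 hr] := Eloc x y (hx 0%N) (hy 0%N).
have [n hn] : exists n, Num.max (b - a) (d - c) / 2 ^+ n < r.
  have p0 : 0 <= Num.max (b - a) (d - c) / r.
    by rewrite divr_ge0 ?(ltW r0)// le_max subr_ge0 ab.
  have := archi_boundP p0; set k := Num.bound _ => hk.
  exists k; rewrite ltr_pdivrMr ?exprn_gt0// mulrC -ltr_pdivrMr//.
  apply: (lt_le_trans hk); rewrite -natrX ler_nat; exact/ltnW/ltn_expl.
have [[k1 k2 k3 k4 k5] [k6 k7]] := badn n; apply: k7.
have p2 : (0:R) < (2 ^+ n)^-1 by rewrite invr_gt0 exprn_gt0.
by apply: hr => //; [have [-> _] := len n|have [_ ->] := len n];
  apply: le_lt_trans hn; rewrite ler_pM2r// le_max lexx ?orbT.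
Qed.
End Subdivision.

Section RealNorm.
Variable R : realType.
Local Notation C := R[i].

(* Norms over the field [R[i]] are [R[i]]-valued; [nv] is the real number behind. *)
Definition nv (V : normedModType C) (v : V) : R := complex.Re `|v|.

Variable V : normedModType C.
Implicit Types v w : V.

Lemma nvE v : `|v| = (nv v)%:C%C.
Proof.
by rewrite /nv; have := normr_ge0 v; case: `|v| => a b; rewrite lecE/= => /andP[/eqP->].
Qed.

Lemma nv_ge0 v : 0 <= nv v.
Proof. by rewrite -lecR -nvE normr_ge0. Qed.

Lemma nvD v w : nv (v + w) <= nv v + nv w.
Proof. by rewrite -lecR rmorphD/= -!nvE ler_normD. Qed.

Lemma nv_tri v w u : nv (v - u) <= nv (v - w) + nv (w - u).
Proof. by rewrite (le_trans _ (nvD _ _))// addrA subrK. Qed.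

Lemma nvZ (a : C) v : nv (a *: v) = normc a * nv v.
Proof. by apply: complexI; rewrite -nvE normrZ nvE rmorphM. Qed.

Lemma nv0 : nv (0 : V) = 0.
Proof. by rewrite /nv normr0. Qed.

Lemma nv_eq0 v : (nv v == 0) = (v == 0).
Proof.
apply/eqP/eqP => [v0|->]; last by rewrite /nv normr0.
by apply/normr0_eq0; rewrite nvE v0.
Qed.

Lemma nbhs_nv (x : V) (A : set V) : nbhs x A <->
  exists2 r : R, 0 < r & forall y, nv (y - x) < r -> A y.
Proof.
split=> [/nbhs_ballP[[r i]] /=|[r r0 rA]].
  rewrite ltcE/= => /andP[/eqP-> r0] rA; exists r => // y yr.
  by apply: rA; rewrite -ball_normE/= -normrN opprB nvE ltcR.
apply/nbhs_ballP; exists r%:C%C; first by rewrite /= ltcR.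
move=> y; rewrite -ball_normE/= -normrN opprB nvE ltcR; exact: rA.
Qed.

End RealNorm.

Section Differentiable.
Variable R : realType.
Local Notation C := R[i].
Variables V W : normedModType C.

Lemma nv_differentiable (f : V -> W) x : differentiable f x ->
  exists2 L : {linear V -> W}, continuous L &
    forall e : R, 0 < e -> exists2 d, 0 < d &
    forall y, nv (y - x) < d -> nv (f y - f x - L (y - x)) <= e * nv (y - x).
Proof.
move=> /diff_locallyP[cL /eqaddoP H]; exists ('d f x) => // e e0.
have e0' : 0 < e%:C%C :> C by rewrite ltcR.
have /nbhs_nv[d d0 dP] := H _ e0'; exists d => // y yd.
have := dP (y - x); rewrite subr0 => /(_ yd).
by rewrite /shift !fctE/= subrK !nvE -rmorphM lecR opprD addrA.
Qed.

Lemma differentiable_nv (f : V -> W) x (L : {linear V -> W}) :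
  continuous L ->
  (forall e : R, 0 < e -> exists2 d, 0 < d &
    forall y, nv (y - x) < d -> nv (f y - f x - L (y - x)) <= e * nv (y - x)) ->
  differentiable f x.
Proof.
move=> cL H.
have HL : f \o shift x = cst (f x) + L +o_ 0 id.
  apply/eqaddoP => -[e i]; rewrite ltcE/= => /andP[/eqP-> e0].
  have [d d0 dP] := H _ e0; apply/nbhs_nv; exists d => // y.
  rewrite subr0 => yd; have := dP (y + x); rewrite addrK => /(_ yd).
  by rewrite /shift !fctE/= !nvE (_ : (e +i* 0)%C = e%:C%C)// -rmorphM lecR opprD addrA.
have Ld := diff_unique cL HL.
apply/diff_locallyP; rewrite Ld; split => //.
Qed.
End Differentiable.

Section Normc.
Variable R : realType.
Local Notation C := R[i].
Implicit Types (z w : C) (x y : R).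

Lemma normc_ge0 z : 0 <= normc z.
Proof. by case: z => a b; rewrite /normc sqrtr_ge0. Qed.

Lemma normcB z w : normc (z - w) = normc (w - z).
Proof. by rewrite -normcN opprB. Qed.

Lemma normcR x : normc x%:C%C = `|x|.
Proof. by rewrite /normc/= expr0n addr0 sqrtr_sqr. Qed.

Lemma normc_Re z : `|complex.Re z| <= normc z.
Proof.
case: z => a b; rewrite /normc/= -sqrtr_sqr ler_sqrt ?lerDl ?sqr_ge0//.
by rewrite addr_ge0 ?sqr_ge0.
Qed.

Lemma normc_Im z : `|complex.Im z| <= normc z.
Proof.
case: z => a b; rewrite /normc/= -sqrtr_sqr ler_sqrt ?lerDr ?sqr_ge0//.
by rewrite addr_ge0 ?sqr_ge0.
Qed.

Lemma normc_le z : normc z <= `|complex.Re z| + `|complex.Im z|.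
Proof.
case: z => a b; rewrite /normc/=.
rewrite -[leRHS]ger0_norm ?addr_ge0// -sqrtr_sqr ler_sqrt ?sqr_ge0//.
rewrite sqrrD !real_normK ?num_real// addrAC.
by rewrite lerDl mulrn_wge0 ?mulr_ge0.
Qed.

Lemma normc_sqr z : normc z ^+ 2 = complex.Re z ^+ 2 + complex.Im z ^+ 2.
Proof. by case: z => a b; rewrite /normc sqr_sqrtr// addr_ge0 ?sqr_ge0. Qed.

Lemma normc_gt0 z : z != 0 -> 0 < normc z.
Proof.
move=> z0; rewrite lt_neqAle normc_ge0 andbT eq_sym.
by apply: contra z0 => /eqP/eq0_normc ->.
Qed.

Lemma Re_sub z w : complex.Re (z - w) = complex.Re z - complex.Re w.
Proof. by case: z w => [a b] [c d]. Qed.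

Lemma Im_sub z w : complex.Im (z - w) = complex.Im z - complex.Im w.
Proof. by case: z w => [a b] [c d]. Qed.

End Normc.

(** * Goursat's theorem on rectangles *)

Section RectangleIntegral.
Variable R : realType.
Local Notation C := R[i].
Implicit Types (k : C -> C) (a b c d : R).

(** Continuity and complex differentiability at a point with real epsilons and deltas, in place of
    the [R[i]]-valued norm, so that the estimates feed directly into real integrals. *)
Definition ccont k (z : C) := forall e : R, 0 < e -> exists2 r : R, 0 < r &
  forall w, normc (w - z) < r -> normc (k w - k z) <= e.

Definition cderiv k (z l : C) := forall e : R, 0 < e -> exists2 r : R, 0 < r &
  forall w, normc (w - z) < r ->
    normc (k w - k z - l * (w - z)) <= e * normc (w - z).

Lemma cderiv_ccont k z l : cderiv k z l -> ccont k z.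
Proof.
move=> H e e0; have [r r0 rP] := H 1 ltr01.
have L0 : 0 < 1 + normc l by rewrite ltr_pwDl ?normc_ge0.
exists (Num.min r (e / (1 + normc l))); first by rewrite lt_min r0 divr_gt0.
move=> w; rewrite lt_min => /andP[/rP wr]; rewrite ltr_pdivlMr// => we.
rewrite -[k w - k z](subrK (l * (w - z))); apply: (le_trans (le_normcD _ _)).
rewrite normcM; apply: le_trans (ltW we); rewrite [leRHS]mulrDr mulr1.
by rewrite mul1r in wr; rewrite lerD// mulrC.
Qed.

Lemma ccont_real k z (g : R -> C) (P : C -> R) x : ccont k z -> g x = z ->
  (forall t, normc (g t - g x) <= `|t - x|) ->
  (forall u v, `|P u - P v| <= normc (u - v)) ->
  {for x, continuous (fun t => P (k (g t)))}.
Proof.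
move=> kc gx gl Pl; apply/cvgrPdist_le => e e0.
have [r r0 rP] := kc e e0.
near=> t; rewrite gx distrC; apply: (le_trans (Pl _ _)); apply: rP; rewrite -gx.
apply: (le_lt_trans (gl t)); near: t; apply/nbhs_ballP; exists r => // t.
by rewrite /ball/= distrC.
Unshelve. all: by end_near. Qed.

(* The real part of the integral of [k] along the counterclockwise boundary of the
   rectangle [a, b] x [c, d]. *)
Definition rint k a b c d : R :=
  oint a b (fun x => complex.Re (k (x +i* c)%C) - complex.Re (k (x +i* d)%C)) -
  oint c d (fun y => complex.Im (k (b +i* y)%C) - complex.Im (k (a +i* y)%C)).

Definition rect a b c d : set C :=
  [set z | a <= complex.Re z <= b /\ c <= complex.Im z <= d].

Lemma ccont_horizontal k x y : ccont k (x +i* y)%C ->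
  {for x, continuous (fun t => complex.Re (k (t +i* y)%C))}.
Proof.
move=> H; apply: (ccont_real (g := fun t => (t +i* y)%C) H) => //.
  move=> t; rewrite (_ : _ - _ = (t - x)%:C%C) ?normcR//.
  by apply/eqP; rewrite eq_complex/= subrr !eqxx.
by move=> u v; rewrite -Re_sub normc_Re.
Qed.

Lemma ccont_vertical k x y : ccont k (x +i* y)%C ->
  {for y, continuous (fun t => complex.Im (k (x +i* t)%C))}.
Proof.
move=> H; apply: (ccont_real (g := fun t => (x +i* t)%C) H) => //.
  move=> t; rewrite (_ : _ - _ = 'i%C * (t - y)%:C%C) ?normcM ?normcR//.
    by rewrite /normc/= expr0n add0r expr1n sqrtr1 mul1r.
  by apply/eqP; rewrite eq_complex/= subrr; apply/andP; split; apply/eqP; ring.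
by move=> u v; rewrite -Im_sub normc_Im.
Qed.

Lemma rint_horizontal k c d x : ccont k (x +i* c)%C -> ccont k (x +i* d)%C ->
  {for x, continuous (fun t => complex.Re (k (t +i* c)%C) -
                              complex.Re (k (t +i* d)%C))}.
Proof. by move=> *; apply: continuousB; exact: ccont_horizontal. Qed.

Lemma rint_vertical k a b y : ccont k (a +i* y)%C -> ccont k (b +i* y)%C ->
  {for y, continuous (fun t => complex.Im (k (b +i* t)%C) -
                              complex.Im (k (a +i* t)%C))}.
Proof. by move=> *; apply: continuousB; exact: ccont_vertical. Qed.

(** Continuity is required only on the edges and on the cut, so that the rule still applies to an
    integrand with a pole inside the rectangle. *)
Lemma rint_splitx k a m b c d : a <= m -> m <= b -> c <= d ->
  (forall z, rect a b c d z ->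
     (complex.Im z = c \/ complex.Im z = d) \/
     [\/ complex.Re z = a, complex.Re z = m | complex.Re z = b] -> ccont k z) ->
  rint k a b c d = rint k a m c d + rint k m b c d.
Proof.
move=> am mb cd kc; have ab := le_trans am mb.
have kh x : a <= x <= b -> ccont k (x +i* c)%C /\ ccont k (x +i* d)%C.
  by move=> xab; split; apply: kc; rewrite /rect/= ?xab ?lexx ?cd; auto.
have kv y : c <= y <= d ->
    [/\ ccont k (a +i* y)%C, ccont k (m +i* y)%C & ccont k (b +i* y)%C].
  move=> ycd; split; apply: kc; rewrite /rect/= ?ycd ?lexx ?ab ?am ?mb//;
  right; ((by apply: Or31) || (by apply: Or32) || (by apply: Or33)).
rewrite /rint (@oint_split _ a m b) ?am ?mb//; last first.
  by move=> x /kh[]; exact: rint_horizontal.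
rewrite (_ : (fun y => complex.Im (k (b +i* y)%C) - complex.Im (k (a +i* y)%C)) =
  (fun y => (complex.Im (k (b +i* y)%C) - complex.Im (k (m +i* y)%C)) +
    (complex.Im (k (m +i* y)%C) - complex.Im (k (a +i* y)%C)))); last first.
  by apply/funext => y; rewrite addrA subrK.
rewrite [X in _ - X = _]ointD; first by ring.
  by move=> y /kv[? ? ?]; exact: rint_vertical.
by move=> y /kv[? ? ?]; exact: rint_vertical.
Qed.

Lemma rint_splity k a b c m d : a <= b -> c <= m -> m <= d ->
  (forall z, rect a b c d z ->
     (complex.Re z = a \/ complex.Re z = b) \/
     [\/ complex.Im z = c, complex.Im z = m | complex.Im z = d] -> ccont k z) ->
  rint k a b c d = rint k a b c m + rint k a b m d.
Proof.
move=> ab cm md kc; have cd := le_trans cm md.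
have kv y : c <= y <= d -> ccont k (a +i* y)%C /\ ccont k (b +i* y)%C.
  by move=> ycd; split; apply: kc; rewrite /rect/= ?ycd ?lexx ?ab; auto.
have kh x : a <= x <= b ->
    [/\ ccont k (x +i* c)%C, ccont k (x +i* m)%C & ccont k (x +i* d)%C].
  move=> xab; split; apply: kc; rewrite /rect/= ?xab ?lexx ?cd ?cm ?md//;
  right; ((by apply: Or31) || (by apply: Or32) || (by apply: Or33)).
rewrite /rint (@oint_split _ c m d) ?cm ?md//; last first.
  by move=> y /kv[]; exact: rint_vertical.
rewrite (_ : (fun x => complex.Re (k (x +i* c)%C) - complex.Re (k (x +i* d)%C)) =
  (fun x => (complex.Re (k (x +i* c)%C) - complex.Re (k (x +i* m)%C)) +
    (complex.Re (k (x +i* m)%C) - complex.Re (k (x +i* d)%C)))); last first.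
  by apply/funext => y; rewrite addrA subrK.
rewrite [X in X - _ = _]ointD; first by ring.
  by move=> x /kh[? ? ?]; exact: rint_horizontal.
by move=> x /kh[? ? ?]; exact: rint_horizontal.
Qed.

(** The affine part [q + l * (z - p)] contributes the constant [Im l * (d - c)] to the difference of
    the lower and upper sides, and [Im l * (b - a)] to that of the right and left sides. Integrated,
    both give [Im l] times the area and cancel in [rint]. *)
Fact rect_Re_affine (u v q l p : C) x c d :
  complex.Re u - complex.Re v - complex.Im l * (d - c) =
  complex.Re (u - q - l * ((x +i* c)%C - p) + - (v - q - l * ((x +i* d)%C - p))).
Proof. by case: u v q l p => [? ?] [? ?] [? ?] [? ?] [? ?] /=; ring. Qed.

Fact rect_Im_affine (u v q l p : C) y a b :
  complex.Im u - complex.Im v - complex.Im l * (b - a) =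
  complex.Im (u - q - l * ((b +i* y)%C - p) + - (v - q - l * ((a +i* y)%C - p))).
Proof. by case: u v q l p => [? ?] [? ?] [? ?] [? ?] [? ?] /=; ring. Qed.

Lemma rint_local k p l e a b c d : 0 < e -> cderiv k p l ->
  exists2 r, 0 < r & forall a' b' c' d', a <= a' -> b' <= b -> c <= c' ->
    d' <= d -> rect a' b' c' d' p -> b' - a' < r -> d' - c' < r ->
    (forall z, rect a b c d z -> ccont k z) ->
    `|rint k a' b' c' d'| <= e * ((b' - a') + (d' - c')) ^+ 2.
Proof.
move=> e0 kp; have [r r0 rP] := kp (e / 2) (divr_gt0 e0 (ltr0n _ 2)).
(* Both side lengths below [r / 2] force [S < r], and [S] bounds the distance from [p] to any point
   of the rectangle. *)
exists (r / 2); first by rewrite divr_gt0.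
move=> a' b' c' d' aa bb cc dd [/andP[p1 p2] /andP[p3 p4]] br dr kc.
have ab : a' <= b' by exact: le_trans p1 p2.
have cd : c' <= d' by exact: le_trans p3 p4.
have kc' z : rect a' b' c' d' z -> ccont k z.
  move=> [/andP[z1 z2] /andP[z3 z4]]; apply: kc; rewrite /rect/=.
  by rewrite (le_trans aa)// (le_trans z2)// (le_trans cc)// (le_trans z4).
pose S := (b' - a') + (d' - c').
have est z : rect a' b' c' d' z ->
    normc (k z - k p - l * (z - p)) <= e / 2 * S.
  move=> [/andP[z1 z2] /andP[z3 z4]].
  have zp : normc (z - p) <= S.
    apply: (le_trans (normc_le _)); rewrite Re_sub Im_sub lerD//;
    by rewrite ler_norml; apply/andP; split; lra.
  apply: (le_trans (rP z _)).
    by apply: (le_lt_trans zp); rewrite /S; lra.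
  by rewrite ler_pM2l// divr_gt0.
(* The contributions of the affine part, with [v * (b' - a') = w * (d' - c')]; only the remainder of
   the first-order expansion survives in [rint]. *)
pose v := complex.Im l * (d' - c'); pose w := complex.Im l * (b' - a').
have hx : `|oint a' b' (fun x => complex.Re (k (x +i* c')%C) -
    complex.Re (k (x +i* d')%C)) - v * (b' - a')| <= e * S * (b' - a').
  apply: oint_bound => // [x xab|x xab];
    first by apply: rint_horizontal; apply: kc'; rewrite /rect/= xab lexx cd.
  have z1 : rect a' b' c' d' (x +i* c')%C by rewrite /rect/= xab lexx cd.
  have z2 : rect a' b' c' d' (x +i* d')%C by rewrite /rect/= xab lexx cd.
  have := lerD (est _ z1) (est _ z2).
  have -> : e / 2 * S + e / 2 * S = e * S by field.
  apply: le_trans; rewrite -[X in _ <= _ + X]normcN.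
  apply: (le_trans _ (le_normcD _ _)); apply: (le_trans _ (normc_Re _)).
  rewrite le_eqVlt; apply/orP; left; apply/eqP; congr (`|_|); exact: rect_Re_affine.
have hy : `|oint c' d' (fun y => complex.Im (k (b' +i* y)%C) -
    complex.Im (k (a' +i* y)%C)) - w * (d' - c')| <= e * S * (d' - c').
  apply: oint_bound => // [y ycd|y ycd];
    first by apply: rint_vertical; apply: kc'; rewrite /rect/= ycd lexx ab.
  have z1 : rect a' b' c' d' (b' +i* y)%C by rewrite /rect/= ycd lexx ab.
  have z2 : rect a' b' c' d' (a' +i* y)%C by rewrite /rect/= ycd lexx ab.
  have := lerD (est _ z1) (est _ z2).
  have -> : e / 2 * S + e / 2 * S = e * S by field.
  apply: le_trans; rewrite -[X in _ <= _ + X]normcN.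
  apply: (le_trans _ (le_normcD _ _)); apply: (le_trans _ (normc_Im _)).
  rewrite le_eqVlt; apply/orP; left; apply/eqP; congr (`|_|); exact: rect_Im_affine.
rewrite /rint -/S.
have -> : e * S ^+ 2 = e * S * (b' - a') + e * S * (d' - c') by rewrite /S; ring.
apply: le_trans (lerD hx hy).
apply: le_trans (ler_normB _ _).
rewrite le_eqVlt; apply/orP; left; apply/eqP; congr (`|_|); rewrite /v /w; ring.
Qed.

Lemma goursat k a b c d : a <= b -> c <= d ->
  (forall z, rect a b c d z -> exists l, cderiv k z l) -> rint k a b c d = 0.
Proof.
move=> ab cd kd.
have kc z : rect a b c d z -> ccont k z by move=> /kd[l /cderiv_ccont].
suff H e : 0 < e -> `|rint k a b c d| <= e * ((b - a) + (d - c)) ^+ 2.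
  apply/eqP; rewrite -normr_eq0 eq_le normr_ge0 andbT.
  apply/ler_addgt0Pr => e e0; rewrite add0r.
  set s := (_ + _) ^+ 2 in H.
  have s1 : 0 < 1 + s by rewrite ltr_pwDl ?sqr_ge0.
  apply: (le_trans (H (e / (1 + s)) (divr_gt0 e0 s1))).
  by rewrite mulrAC ler_pdivrMr// ler_pM2l// lerDr.
move=> e0; apply: subdivision => //.
  move=> a' b' c' d' aa ab' bb cc cd' dd x y.
  have kc' z : rect a' b' c' d' z -> ccont k z.
    move=> [/andP[z1 z2] /andP[z3 z4]]; apply: kc; rewrite /rect/=.
    by rewrite (le_trans aa)// (le_trans z2)// (le_trans cc)// (le_trans z4).
  have [ax xb] : a' <= x /\ x <= b' by move: ab'; rewrite /x; clear; lra.
  have [cy yd] : c' <= y /\ y <= d' by move: cd'; rewrite /y; clear; lra.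
  rewrite (@rint_splity _ a' b' c' y d')//; last by move=> z /kc'.
  rewrite !(@rint_splitx _ a' x b')//; first by rewrite !addrA.
    move=> z [z3 /andP[z1 z2]] _; apply: kc'.
    by rewrite /rect/= z3 z2 (le_trans cy).
  move=> z [z3 /andP[z1 z2]] _; apply: kc'.
  by rewrite /rect/= z3 z1 (le_trans z2).
move=> x y xab ycd.
have [l kl] := kd (x +i* y)%C (conj xab ycd).
have [r r0 rP] := rint_local a b c d e0 kl.
by exists r => // a' b' c' d' *; apply: rP => //; rewrite /rect/=.
Qed.
End RectangleIntegral.

(** * The Cauchy estimate at the centre of a square *)

Section Cauchy.
Variable R : realType.
Local Notation C := R[i].
Implicit Types (z w l : R[i]^o) (h f k : R[i]^o -> R[i]^o).

Lemma Re_add z w : complex.Re (z + w) = complex.Re z + complex.Re w.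
Proof. by case: z w => [a b] [c d]. Qed.

Lemma Im_add z w : complex.Im (z + w) = complex.Im z + complex.Im w.
Proof. by case: z w => [a b] [c d]. Qed.

Lemma normc_conj z : normc (z^*)%C = normc z.
Proof. by case: z => a b; rewrite /normc/= sqrrN. Qed.

Lemma oint_ge (a b k : R) (f : R -> R) : a <= b ->
  (forall x, a <= x <= b -> {for x, continuous f}) ->
  (forall x, a <= x <= b -> k <= f x) -> k * (b - a) <= oint a b f.
Proof.
move=> ab fc fk; rewrite -oint_cst//; apply: le_Rintegral => //.
  by apply: continuous_itv_integrable => x _; exact: cvg_cst.
exact: continuous_itv_integrable.
Qed.

Lemma ointN (a b : R) (f : R -> R) :
  (forall x, a <= x <= b -> {for x, continuous f}) ->
  oint a b (fun x => - f x) = - oint a b f.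
Proof.
move=> fc; rewrite -[RHS]mulN1r /oint -RintegralZl//.
  by apply: eq_Rintegral => x _; rewrite mulN1r.
exact: continuous_itv_integrable.
Qed.

Lemma differentiable_cderiv (f : R[i]^o -> R[i]^o) z : differentiable f z ->
  exists l, cderiv f z l.
Proof.
move=> /nv_differentiable[L _ LP]; exists (L 1) => e e0.
have [r r0 rP] := LP _ e0; exists r => // w wr.
have -> : L 1 * (w - z) = L (w - z).
  by rewrite -[w - z in RHS]mulr1 [RHS](linearZ_LR L) mulrC.
exact: rP.
Qed.

(** The factor 3/2 is a rational upper bound for the square root of 2; it is also the outer radius
    of every annulus used later. *)
Lemma square_le (r : R) z : 0 <= r -> `|complex.Re z| <= r ->
  `|complex.Im z| <= r -> normc z <= 3 / 2 * r.
Proof.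
move=> r0 h1 h2; rewrite -(ler_pXn2r (n := 2))// ?nnegrE ?normc_ge0 ?mulr_ge0//.
rewrite normc_sqr -(real_normK (num_real (complex.Re z))).
rewrite -(real_normK (num_real (complex.Im z))).
have := normr_ge0 (complex.Re z); have := normr_ge0 (complex.Im z).
by nra.
Qed.

Lemma square_annulus (r : R) z : 0 < r -> `|complex.Re z| <= r ->
  `|complex.Im z| <= r -> (`|complex.Re z| = r \/ `|complex.Im z| = r) ->
  r <= normc z <= 3 / 2 * r.
Proof.
move=> r0 h1 h2 h3; apply/andP; split.
  by case: h3 => <-; [exact: normc_Re|exact: normc_Im].
exact: square_le (ltW r0) h1 h2.
Qed.

(** The factor [- 'i] makes the contour integral of [1 / z], which is [2 pi i], real and positive,
    and gives the relevant part of the integrand a constant sign on each side of a centred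
    square. *)
Lemma Re_recip (x r : R) (m : R) :
  complex.Re (- 'i%C * m%:C%C / (x +i* r)%C) = - (m * r / (x ^+ 2 + r ^+ 2)) /\
  complex.Im (- 'i%C * m%:C%C / (x +i* r)%C) = - (m * x / (x ^+ 2 + r ^+ 2)).
Proof. rewrite /=; split; ring. Qed.

(* Integrals of [h z / z] over the boundaries of concentric squares agree. On a
   small square each side contributes about [pi / 2 * normc l], here bounded below
   by [normc l]; this costs the factor 2. *)
Lemma center_bound h l (r M : R) : 0 < r ->
  (forall z, z != 0 -> normc z <= 3 / 2 * r -> differentiable h z) ->
  (forall e : R, 0 < e -> exists2 d : R, 0 < d &
    forall z, z != 0 -> normc z < d -> normc (h z - l) <= e) ->
  (forall z, r <= normc z <= 3 / 2 * r -> normc (h z) <= M) ->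
  normc l <= 2 * M.
Proof.
move=> r0 hd hc hM; set H := normc l.
have [h00|h0] := eqVneq l 0.
  rewrite /H h00 normc0 mulr_ge0//; apply: le_trans (hM r%:C%C _); first exact: normc_ge0.
  by rewrite normcR ger0_norm ?(ltW r0)// lexx/=; lra.
have H0 : 0 < H by exact: normc_gt0.
(* With this factor the residue at 0 is [- 'i * normc l ^+ 2], so the integral is real and [rint], a
   real part, loses nothing. *)
pose mu : C := - 'i%C * l^*%C.
have muN : normc mu = H.
  by rewrite /mu normcM normcN {1}/normc/= expr0n add0r expr1n sqrtr1 mul1r normc_conj.
pose k z : C := mu * h z / z.
have kder z : z != 0 -> normc z <= 3 / 2 * r -> exists l0, cderiv k z l0.
  move=> z0 zr; apply: differentiable_cderiv.
  apply: differentiableM; last by apply: differentiableV => //.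
  by apply: differentiableM; [exact: differentiable_cst|exact: hd].
have M0 : 0 <= M.
  apply: le_trans (hM r%:C%C _); first exact: normc_ge0.
  by rewrite normcR ger0_norm ?(ltW r0)// lexx/=; lra.
have kdr z : rect (- r) r (- r) r z -> z != 0 -> exists l0, cderiv k z l0.
  move=> [z1 z2] z0; apply: kder => //; have := square_le (ltW r0).
  by apply; rewrite ler_norml.
have kcr z : rect (- r) r (- r) r z -> z != 0 -> ccont k z.
  by move=> zr z0; have [l0 /cderiv_ccont] := kdr z zr z0.
have nz z : (complex.Re z != 0) || (complex.Im z != 0) -> z != 0.
  by apply: contraTN => /eqP->; rewrite /= eqxx.
(* The region between the squares is cut into four rectangles avoiding 0, on each of which Goursat's
   theorem applies. *)
have shrink s : 0 < s -> s < r ->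
    rint k (- r) r (- r) r = rint k (- s) s (- s) s.
  move=> s0 sr; have sN : s != 0 by rewrite gt_eqF.
  have rN : r != 0 by rewrite gt_eqF.
  have kdz a b c d : - r <= a -> b <= r -> - r <= c -> d <= r ->
      a <= b -> c <= d -> (0 < a \/ b < 0) \/ (0 < c \/ d < 0) ->
      rint k a b c d = 0.
    move=> ar br cr dr ab cd H'; apply: goursat => // z.
    move=> [/andP[z1 z2] /andP[z3 z4]]; apply: kdr.
      by split; apply/andP; split; [exact: le_trans z1|exact: le_trans br|
        exact: le_trans z3|exact: le_trans dr].
    apply: nz; apply/orP.
    by case: H' => -[H'|H']; [left; rewrite gt_eqF// (lt_le_trans H')|
      left; rewrite lt_eqF// (le_lt_trans _ H')|
      right; rewrite gt_eqF// (lt_le_trans H')|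
      right; rewrite lt_eqF// (le_lt_trans _ H')].
  have [f1 f2 f3 f4 f5] : [/\ - r <= - s, - s <= s, s <= r, - s <= r & - r <= s].
    by clear -s0 sr; split; lra.
  have f6 : - r <= r by exact: le_trans f5 f3.
  have f7 : - s < 0 by rewrite oppr_lt0.
  rewrite (@rint_splitx _ k (- r) (- s) r)//; last first.
    move=> z zr H'; apply: kcr => //; apply: nz; apply/orP.
    by case: H' => [[]|[]] ->; rewrite ?oppr_eq0 ?sN ?rN; auto.
  rewrite (@rint_splitx _ k (- s) s r)//; last first.
    move=> z [/andP[z1 z2] z3] H'; apply: kcr.
      by split => //; rewrite z2 andbT (le_trans f1).
    apply: nz; apply/orP.
    by case: H' => [[]|[]] ->; rewrite ?oppr_eq0 ?sN ?rN; auto.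
  rewrite (@rint_splity _ k (- s) s (- r) (- s) r)//; last first.
    move=> z [/andP[z1 z2] z3] H'; apply: kcr.
      by split => //; rewrite (le_trans f1)//= (le_trans z2).
    apply: nz; apply/orP.
    by case: H' => [[]|[]] ->; rewrite ?oppr_eq0 ?sN ?rN; auto.
  rewrite (@rint_splity _ k (- s) s (- s) s r)//; last first.
    move=> z [/andP[z1 z2] /andP[z3 z4]] H'; apply: kcr.
      by split => //; rewrite ?z4 ?andbT (le_trans f1)//= (le_trans z2).
    apply: nz; apply/orP.
    by case: H' => [[]|[]] ->; rewrite ?oppr_eq0 ?sN ?rN; auto.
  rewrite (kdz (- r) (- s))//; last by left; right.
  rewrite (kdz (- s) s (- r))//; last by right; right.
  rewrite (kdz (- s) s s r)//; last by right; left.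
  rewrite (kdz s r)//; last by left; left.
  by rewrite !add0r !addr0.
(* Four sides of length [2 * r], with an integrand of modulus at most [H * M / r]. *)
have upper : rint k (- r) r (- r) r <= 8 * H * M.
  have kb z : r <= normc z <= 3 / 2 * r -> normc (k z) <= H * M / r.
    move=> zr; rewrite /k 2!normcM normcV muN; have /andP[rz _] := zr.
    apply: ler_pM; rewrite ?mulr_ge0 ?invr_ge0 ?normc_ge0 ?(ltW H0)//.
      by rewrite ler_pM2l// hM.
    by rewrite lef_pV2// posrE// (lt_le_trans r0).
  have kn x y : `|x| <= r -> `|y| <= r -> (`|x| = r \/ `|y| = r) ->
      ccont k (x +i* y)%C /\ normc (k (x +i* y)%C) <= H * M / r.
    move=> xr yr xy; have za := @square_annulus r (x +i* y)%C r0 xr yr xy.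
    split; last exact: kb.
    apply: kcr; first by split; rewrite -ler_norml.
    by apply/eqP => z0; move: za; rewrite z0 normc0; case/andP; lra.
  have rr : - r <= r by lra.
  have nr : `|r| = r by rewrite ger0_norm ?ltW.
  have nr' : `|- r| = r by rewrite normrN.
  rewrite /rint; set I1 := oint _ _ _; set I2 := oint _ _ _.
  have b1 : `|I1 - 0 * (r - - r)| <= 2 * (H * M / r) * (r - - r).
    apply: oint_bound => // x; rewrite -ler_norml => xr.
      by apply: rint_horizontal; apply: (proj1 (kn _ _ _ _ _));
        rewrite ?nr ?nr'; auto.
    rewrite subr0; apply: (le_trans (ler_normB _ _)).
    rewrite mulr_natl mulr2n lerD//; apply: (le_trans (normc_Re _));
    by apply: (proj2 (kn _ _ _ _ _)); rewrite ?nr ?nr'; auto.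
  have b2 : `|I2 - 0 * (r - - r)| <= 2 * (H * M / r) * (r - - r).
    apply: oint_bound => // x; rewrite -ler_norml => xr.
      by apply: rint_vertical; apply: (proj1 (kn _ _ _ _ _));
        rewrite ?nr ?nr'; auto.
    rewrite subr0; apply: (le_trans (ler_normB _ _)).
    rewrite mulr_natl mulr2n lerD//; apply: (le_trans (normc_Im _));
    by apply: (proj2 (kn _ _ _ _ _)); rewrite ?nr ?nr'; auto.
  have E : 2 * (H * M / r) * (r - - r) = 4 * H * M by field; rewrite gt_eqF.
  move: b1 b2; rewrite E !mul0r !subr0 !ler_norml => /andP[_ ?] /andP[? _]; lra.
have lower e : 0 < e -> exists2 s, 0 < s < r &
    4 * H ^+ 2 - 8 * e * H <= rint k (- s) s (- s) s.
  move=> e0; have [d d0 dP] := hc e e0.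
  pose s := Num.min r d / 2; have m0 : 0 < Num.min r d by rewrite lt_min r0.
  have s0 : 0 < s by rewrite divr_gt0.
  have m1 : Num.min r d <= r by rewrite ge_min lexx.
  have m2 : Num.min r d <= d by rewrite ge_min lexx orbT.
  have sr : s < r by move: m0 m1; rewrite /s; clear; set m := Num.min r d; lra.
  have sd : 3 / 2 * s < d by move: m0 m2; rewrite /s; clear; set m := Num.min r d; lra.
  exists s; first by rewrite s0.
  clearbody s.
  (* A lower bound for the signed integrand on one side: [s / (x ^+ 2 + s ^+ 2)] is at least
     [1 / (2 * s)], and replacing [h] by its limit [l] costs at most [e * H / s]. *)
  pose q := (H ^+ 2 - 2 * e * H) / (2 * s).
  have kn x y : `|x| <= s -> `|y| <= s -> (`|x| = s \/ `|y| = s) ->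
      [/\ ccont k (x +i* y)%C,
      `|complex.Re (k (x +i* y)%C) + H ^+ 2 * y / (x ^+ 2 + y ^+ 2)| <= e * H / s &
      `|complex.Im (k (x +i* y)%C) + H ^+ 2 * x / (x ^+ 2 + y ^+ 2)| <= e * H / s].
    move=> xs ys xy; have za := @square_annulus s (x +i* y)%C s0 xs ys xy.
    have z0 : (x +i* y)%C != 0.
      by apply/eqP => z0; move: za; rewrite z0 normc0; case/andP; lra.
    have kE : k (x +i* y)%C = - 'i%C * (H ^+ 2)%:C%C / (x +i* y)%C +
        mu * (h (x +i* y)%C - l) / (x +i* y)%C.
      rewrite mulrBr mulrBl /k (_ : mu * l = - 'i%C * (H ^+ 2)%:C%C).
        by rewrite addrC subrK.
      rewrite /mu -mulrA; congr (_ * _); rewrite /H normc_sqr; clear.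
      by case: l => u v; apply/eqP; rewrite eq_complex/=; apply/andP; split;
        apply/eqP; ring.
    have rem : normc (mu * (h (x +i* y)%C - l) / (x +i* y)%C) <= e * H / s.
      have /andP[sz zs] := za; rewrite 2!normcM normcV muN.
      apply: ler_pM; rewrite ?mulr_ge0 ?invr_ge0 ?normc_ge0 ?(ltW H0)//.
        rewrite mulrC ler_pM2r//; apply: dP => //; exact: le_lt_trans zs sd.
      by rewrite lef_pV2// posrE// (lt_le_trans s0).
    have [q1 q2] := Re_recip x y (H ^+ 2).
    split; first by apply: kcr => //; split; rewrite -ler_norml; lra.
      apply: le_trans rem; apply: le_trans (normc_Re _).
      by rewrite kE Re_add q1 addrAC addNr add0r.
    apply: le_trans rem; apply: le_trans (normc_Im _).
    by rewrite kE Im_add q2 addrAC addNr add0r.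
  have frac x : `|x| <= s -> H ^+ 2 / (2 * s) <= H ^+ 2 * s / (x ^+ 2 + s ^+ 2).
    move=> xs; have x2 : x ^+ 2 <= s ^+ 2.
      by rewrite -real_normK ?num_real// lerXn2r// nnegrE// ltW.
    have p0 : 0 < x ^+ 2 + s ^+ 2 by rewrite ltr_wpDl ?sqr_ge0// exprn_gt0.
    rewrite ler_pdivlMr// mulrAC ler_pdivrMr ?mulr_gt0//.
    rewrite (_ : H ^+ 2 * s * (2 * s) = H ^+ 2 * (2 * s ^+ 2)); last by ring.
    by rewrite ler_pM2l ?exprn_gt0//; move: x2; clear; lra.
  have ns : `|s| = s by rewrite ger0_norm ?ltW.
  have ns' : `|- s| = s by rewrite normrN.
  have ss : - s <= s by lra.
  rewrite /rint; set F := fun _ => _; set G := fun _ => _.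
  have i1 : 2 * q * (s - - s) <= oint (- s) s F.
    apply: oint_ge => // x; rewrite -ler_norml => xs.
      by apply: rint_horizontal; [have [] := kn x (- s)|have [] := kn x s];
        rewrite ?ns ?ns'; auto.
    have [|||_ + _] := kn x (- s); rewrite ?ns ?ns'; auto.
    have [|||_ + _] := kn x s; rewrite ?ns ?ns'; auto.
    rewrite !ler_norml /F sqrrN mulrN mulNr => /andP[_ k1] /andP[k2 _].
    have := frac x xs; rewrite /q; have -> : (H ^+ 2 - 2 * e * H) / (2 * s) =
       H ^+ 2 / (2 * s) - e * H / s by field; rewrite gt_eqF.
    by lra.
  have i2 : 2 * q * (s - - s) <= - oint (- s) s G.
    rewrite -ointN; last first.
      move=> x; rewrite -ler_norml => xs.
      by apply: rint_vertical; [have [] := kn (- s) x|have [] := kn s x];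
        rewrite ?ns ?ns'; auto.
    apply: oint_ge => // x; rewrite -ler_norml => xs.
      apply: continuousN.
      by apply: rint_vertical; [have [] := kn (- s) x|have [] := kn s x];
        rewrite ?ns ?ns'; auto.
    have [|||_ _ +] := kn (- s) x; rewrite ?ns ?ns'; auto.
    have [|||_ _ +] := kn s x; rewrite ?ns ?ns'; auto.
    rewrite !ler_norml /G sqrrN mulrN mulNr => /andP[_ k1] /andP[k2 _].
    have := frac x xs; rewrite /q [x ^+ 2 + _]addrC.
    have -> : (H ^+ 2 - 2 * e * H) / (2 * s) =
       H ^+ 2 / (2 * s) - e * H / s by field; rewrite gt_eqF.
    by lra.
  have E : 2 * q * (s - - s) = 2 * H ^+ 2 - 4 * e * H.
    by rewrite /q; field; rewrite gt_eqF.
  by move: i1 i2; rewrite E; lra.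
apply/ler_addgt0Pr => e e0; have [s /andP[s0 sr]] := lower (e / 2) (divr_gt0 e0 (ltr0n _ 2)).
rewrite -(shrink s s0 sr) => /le_trans /(_ upper).
rewrite (_ : 4 * H ^+ 2 - 8 * (e / 2) * H = 4 * H * (H - e)); last by field.
rewrite (_ : 8 * H * M = 4 * H * (2 * M)); last by ring.
by rewrite ler_pM2l ?mulr_gt0// lerBlDr.
Qed.
End Cauchy.

(** * The mean value inequality and Cauchy estimates for derivatives *)

Section Weierstrass.
Variable R : realType.
Local Notation C := R[i].

Lemma real_cauchy (u : nat -> R) :
  (forall e, 0 < e -> exists N, forall k, (N <= k)%N -> `|u k - u N| <= e) ->
  exists c, forall e, 0 < e -> exists N, forall k, (N <= k)%N -> `|u k - c| <= e.
Proof.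
move=> uc; have : cvg (u @ \oo).
  apply/cauchy_cvgP; apply: cauchy_exP => e /= e0.
  have [N uN] := uc (e / 2) (divr_gt0 e0 (ltr0n _ 2)).
  exists (u N); exists N => // k /= Nk; rewrite /ball/= distrC.
  by apply: le_lt_trans (uN _ Nk) _; rewrite ltr_pdivrMr//; lra.
move=> /cvgrPdist_le uc'; exists (lim (u @ \oo)) => e /uc'[N _ uN].
by exists N => k Nk; rewrite distrC; exact: uN.
Qed.

Lemma complex_cauchy (u : nat -> C) :
  (forall e, 0 < e -> exists N, forall k, (N <= k)%N -> normc (u k - u N) <= e) ->
  exists c, forall e, 0 < e ->
    exists N, forall k, (N <= k)%N -> normc (u k - c) <= e.
Proof.
move=> uc.
have [a ua] : exists a, forall e, 0 < e -> exists N, forall k, (N <= k)%N ->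
    `|complex.Re (u k) - a| <= e.
  apply: real_cauchy => e /uc[N uN]; exists N => k /uN; rewrite -Re_sub.
  exact/le_trans/normc_Re.
have [b ub] : exists b, forall e, 0 < e -> exists N, forall k, (N <= k)%N ->
    `|complex.Im (u k) - b| <= e.
  apply: real_cauchy => e /uc[N uN]; exists N => k /uN; rewrite -Im_sub.
  exact/le_trans/normc_Im.
exists (a +i* b)%C => e e0; have e2 : 0 < e / 2 by rewrite divr_gt0.
have [N1 h1] := ua _ e2; have [N2 h2] := ub _ e2.
exists (maxn N1 N2) => k; rewrite geq_max => /andP[/h1 k1 /h2 k2].
apply: (le_trans (normc_le _)); rewrite Re_sub Im_sub/=.
by rewrite (splitr e) lerD.
Qed.

(** The mean value inequality from a pointwise Lipschitz condition. It is again a subdivision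
    argument: multiplying the increment by the conjugate of the total increment reduces it to a real
    additive function of intervals. *)
Lemma segment_bound (phi : R -> C) (L : R) : 0 <= L ->
  (forall t, 0 <= t <= 1 -> forall e, 0 < e -> exists2 r, 0 < r &
    forall s, `|s - t| < r -> normc (phi s - phi t) <= (L + e) * `|s - t|) ->
  normc (phi 1 - phi 0) <= L.
Proof.
move=> L0 phiL; set D := phi 1 - phi 0; pose mu := (D^*)%C.
have [D0|Dn0] := eqVneq D 0; first by rewrite D0 normc0.
have HD : 0 < normc D by exact: normc_gt0.
apply/ler_addgt0Pr => e e0.
(* The dummy factor [d - c] turns the interval function into a function of rectangles. The bound has
   the required form since [(b - a) * (d - c)] is at most a quarter of the squared half-perimeter,
   with equality on the unit square. *)
pose E (a b c d : R) := complex.Re (mu * (phi b - phi a)) * (d - c).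
have : `|E 0 1 0 1| <= normc D * (L + e) / 4 * ((1 - 0) + (1 - 0)) ^+ 2.
  apply: subdivision => //.
    move=> a b c d _ _ _ _ _ _ x y; rewrite /E.
    have -> : mu * (phi b - phi a) = mu * (phi b - phi x) + mu * (phi x - phi a).
      by ring.
    rewrite Re_add /y; set A := complex.Re _; set B := complex.Re _.
    by clear; field.
  move=> x y x01 _; have [r r0 rP] := phiL x x01 e e0.
  exists r => // a b c d _ _ _ _ /andP[ax xb] /andP[cy yd] ba dc.
  have ab : normc (phi b - phi a) <= (L + e) * (b - a).
    have -> : b - a = `|b - x| + `|a - x|.
      by rewrite ger0_norm ?subr_ge0// ler0_norm ?subr_le0//; ring.
    rewrite mulrDr (_ : phi b - phi a = (phi b - phi x) + - (phi a - phi x)).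
      apply: (le_trans (le_normcD _ _)); rewrite normcN lerD//; apply: rP.
        by rewrite ger0_norm ?subr_ge0//; lra.
      by rewrite ler0_norm ?subr_le0//; lra.
    by rewrite opprB addrA subrK.
  have E1 : `|E a b c d| <= normc D * (L + e) * ((b - a) * (d - c)).
    rewrite /E normrM (ger0_norm (_ : 0 <= d - c)); last by lra.
    rewrite [leRHS]mulrA ler_wpM2r//; first by lra.
    apply: (le_trans (normc_Re _)); rewrite normcM normc_conj -mulrA.
    by rewrite ler_pM2l.
  apply: (le_trans E1); rewrite -[leRHS]mulrA ler_wpM2l//.
    by rewrite mulr_ge0 ?addr_ge0 ?(ltW HD) ?(ltW e0).
  have := sqr_ge0 ((b - a) - (d - c)); move: (b - a) (d - c) => u v; clear.
  by nra.
rewrite /E !subr0 mulr1 (_ : complex.Re (mu * D) = normc D ^+ 2); last first.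
  by rewrite normc_sqr /mu; clear; case: D => a b /=; ring.
rewrite ger0_norm ?sqr_ge0// expr2 -!mulrA ler_pM2l// (_ : (1 + 1) ^+ 2 = 4); last by ring.
by rewrite mulVf// mulr1.
Qed.

Variable V : normedModType C.
Implicit Types (f : V -> R[i]^o) (x y v : V).

(** [L] is a bare function, so that differences and pointwise limits of derivatives can be used
    before their linearity is established. *)
Definition fderiv f x (L : V -> C) := forall e : R, 0 < e ->
  exists2 d, 0 < d & forall y, nv (y - x) < d ->
    normc (f y - f x - L (y - x)) <= e * nv (y - x).

Lemma differentiable_fderiv f x : differentiable f x ->
  exists L : {linear V -> R[i]^o}, fderiv f x L.
Proof. by move=> /nv_differentiable[L _ LP]; exists L. Qed.

(** The difference quotient along the complex line through [x] in direction [v] has limit [L v] at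
    0, so [center_bound] applies to it. The radius [rho] keeps the outer circle of radius
    [3 / 2 * rho] within [3 / 4 * r] of [x]. *)
Lemma deriv_bound f x (L : V -> C) (r M : R) v : 0 < r ->
  (forall y, nv (y - x) < r -> differentiable f y) ->
  (forall y, nv (y - x) < r -> normc (f y - f x) <= M) ->
  (forall a, L (a *: v) = a * L v) -> fderiv f x L ->
  normc (L v) <= 4 * M / r * nv v.
Proof.
move=> r0 fd fM Lv fL.
have M0 : 0 <= M.
  by apply: le_trans (fM x _); rewrite ?normc_ge0// subrr nv0.
have [v0|v0] := eqVneq v 0.
  by have := Lv 0; rewrite scale0r v0 => ->; rewrite mul0r normc0 nv0 mulr0.
have nv_gt0 : 0 < nv v by rewrite lt_neqAle nv_ge0 andbT eq_sym nv_eq0.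
pose h (z : R[i]^o) : R[i]^o := (f (x + z *: v) - f x) / z.
pose rho := r / (2 * nv v).
have rho0 : 0 < rho by rewrite divr_gt0// mulr_gt0.
have inr (z : C) : normc z <= 3 / 2 * rho -> nv (x + z *: v - x) < r.
  move=> zr; rewrite addrAC subrr add0r nvZ.
  have := ler_wpM2r (ltW nv_gt0) zr.
  have -> : 3 / 2 * rho * nv v = 3 / 4 * r by rewrite /rho; field; rewrite gt_eqF.
  by move=> /le_lt_trans; apply; lra.
have : normc (L v) <= 2 * (M / rho).
  apply: (@center_bound _ h (L v) rho) => //.
  - move=> z z0 zr; apply: differentiableM.
      apply: differentiableB; last exact: differentiable_cst.
      apply: (@differentiable_comp _ _ _ _ (fun z : R[i]^o => x + z *: v) f).
        apply: differentiableD; first exact: differentiable_cst.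
        exact: differentiableZl.
      by apply: fd; exact: inr.
    exact: differentiableV.
  - move=> e e0; have [d d0 dP] := fL (e / nv v) (divr_gt0 e0 nv_gt0).
    exists (d / nv v); first by rewrite divr_gt0.
    move=> z z0; rewrite ltr_pdivlMr// => zd.
    have zE : x + z *: v - x = z *: v by rewrite addrAC subrr add0r.
    have := dP (x + z *: v); rewrite zE nvZ => /(_ zd).
    rewrite Lv (_ : e / nv v * (normc z * nv v) = e * normc z); last first.
      by field; rewrite gt_eqF.
    rewrite (_ : f (x + z *: v) - f x - z * L v = (h z - L v) * z).
      by rewrite normcM ler_pM2r// normc_gt0.
    by rewrite mulrBl [L v * z]mulrC /h divfK.
  - move=> z /andP[z1 z2]; rewrite /h normcM normcV ler_pM ?invr_ge0 ?normc_ge0//.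
      by apply: fM; exact: inr.
    by rewrite lef_pV2// posrE// (lt_le_trans rho0).
by rewrite (_ : 2 * (M / rho) = 4 * M / r * nv v)// /rho; field; rewrite !gt_eqF.
Qed.

(** Points of the segment from [x] to [y] keep a ball of radius [r / 2] in the domain, on which [f]
    oscillates by at most [2 * M]; [deriv_bound] then gives [4 * (2 * M) / (r / 2)], which
    [segment_bound] integrates. *)
Lemma lip_bound f x (r M : R) y : 0 < r ->
  (forall y, nv (y - x) < r -> differentiable f y) ->
  (forall y, nv (y - x) < r -> normc (f y) <= M) ->
  nv (y - x) < r / 2 -> normc (f y - f x) <= 16 * M / r * nv (y - x).
Proof.
move=> r0 fd fM yx; pose v := y - x.
have M0 : 0 <= M.
  by apply: le_trans (fM x _); rewrite ?normc_ge0// subrr nv0.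
pose phi (t : R) : C := f (x + t%:C%C *: v).
have -> : f y - f x = phi 1 - phi 0.
  by rewrite /phi rmorph1 rmorph0 scale1r scale0r addr0 /v [x + _]addrC subrK.
apply: segment_bound; first by rewrite !mulr_ge0 ?invr_ge0 ?nv_ge0 ?(ltW r0).
move=> t /andP[t0 t1] e e0; pose p := x + t%:C%C *: v.
have px : nv (p - x) < r / 2.
  rewrite /p addrAC subrr add0r nvZ normcR ger0_norm//.
  by apply: le_lt_trans yx; rewrite ler_piMl ?nv_ge0.
have pr w : nv (w - p) < r / 2 -> nv (w - x) < r.
  by move=> wp; apply: (le_lt_trans (nv_tri _ p _)); rewrite (splitr r) ltrD.
have [L Lp] := differentiable_fderiv (fd p (lt_trans px (ltac:(lra) : r / 2 < r))).
have Lv : normc (L v) <= 16 * M / r * nv v.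
  rewrite (_ : 16 * M / r = 4 * (2 * M) / (r / 2)); last by field; rewrite gt_eqF.
  apply: (@deriv_bound f p) => //.
  - by rewrite divr_gt0.
  - by move=> w /pr; exact: fd.
  - move=> w /pr wx; apply: (le_trans (le_normcD _ _)).
    rewrite normcN mulr_natl mulr2n lerD// fM//.
    by apply: lt_trans px _; lra.
  - by move=> a; rewrite (linearZ_LR L).
pose K := 1 + nv v; have K0 : 0 < K by rewrite ltr_pwDl ?nv_ge0.
have [d d0 dP] := Lp (e / K) (divr_gt0 e0 K0).
exists (d / K); first by rewrite divr_gt0.
move=> s; rewrite ltr_pdivlMr// => st.
have E : x + s%:C%C *: v - p = (s - t)%:C%C *: v.
  by rewrite /p opprD addrACA subrr add0r -scalerBl -rmorphB.
have sd : nv (x + s%:C%C *: v - p) <= `|s - t| * K.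
  by rewrite E nvZ normcR ler_wpM2l// /K lerDr.
have := dP _ (le_lt_trans sd st); rewrite E.
set A := _ - _ - _ => HA.
have -> : phi s - phi t = A + L ((s - t)%:C%C *: v) by rewrite /A subrK.
apply: (le_trans (le_normcD _ _)); rewrite mulrDl addrC lerD//.
  by rewrite (linearZ_LR L) normcM normcR mulrC ler_wpM2r.
apply: (le_trans HA); rewrite -E.
rewrite [leRHS](_ : _ = e / K * (`|s - t| * K)); last by field; rewrite gt_eqF.
by rewrite ler_wpM2l// divr_ge0 ?ltW.
Qed.

End Weierstrass.

(** * Weierstrass's theorem: uniform limits of holomorphic functions *)

Section UniformLimit.
Variable R : realType.
Local Notation C := R[i].
Variable V : normedModType C.
Implicit Types (x y v : V).

Lemma fderivB (f g : V -> R[i]^o) x (Lf Lg : V -> C) :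
  fderiv f x Lf -> fderiv g x Lg ->
  fderiv (fun y => f y - g y) x (fun v => Lf v - Lg v).
Proof.
move=> fL gL e e0; have e2 : 0 < e / 2 by rewrite divr_gt0.
have [d d0 dP] := fL _ e2; have [d' d'0 dP'] := gL _ e2.
exists (Num.min d d'); first by rewrite lt_min d0.
move=> y; rewrite lt_min => /andP[/dP h1 /dP' h2].
rewrite (splitr e) mulrDl; apply: le_trans (lerD h1 h2).
rewrite -[normc (g y - _ - _)]normcN; apply: le_trans (le_normcD _ _).
by rewrite le_eqVlt; apply/orP; left; apply/eqP; congr normc; ring.
Qed.

Lemma normc_limit (u : nat -> C) (c : C) (B : R) (N : nat) :
  (forall e, 0 < e -> exists N, forall k, (N <= k)%N -> normc (u k - c) <= e) ->
  (forall k, (N <= k)%N -> normc (u k) <= B) -> normc c <= B.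
Proof.
move=> uc uB; apply/ler_addgt0Pr => e /uc[N' uN'].
have := uB _ (leq_maxl N N'); have := uN' _ (leq_maxr N N').
set k := maxn N N' => h1 h2.
rewrite -[c](subrK (u k)) addrC; apply: (le_trans (le_normcD _ _)).
by rewrite lerD// normcB.
Qed.

Lemma linear_nv_continuous (L : {linear V -> R[i]^o}) (K : R) : 0 <= K ->
  (forall v, normc (L v) <= K * nv v) -> continuous L.
Proof.
move=> K0 LK x A /nbhs_nv[r r0 rA]; apply/nbhs_nv.
have K1 : 0 < 1 + K by rewrite ltr_pwDl.
exists (r / (1 + K)); first by rewrite divr_gt0.
move=> y; rewrite ltr_pdivlMr// => yr; apply: rA; rewrite -linearB.
apply: le_lt_trans yr; apply: (le_trans (LK _)).
by rewrite mulrC ler_wpM2l ?nv_ge0// lerDr.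
Qed.

Lemma linear_continuous_bounded (L : {linear V -> R[i]^o}) : continuous L ->
  exists2 K : R, 0 <= K & forall v, normc (L v) <= K * nv v.
Proof.
move=> cL; have /nbhs_nv[r r0 rP] : nbhs (0 : V) [set v | normc (L v) < 1].
  apply: (cL 0 [set z | normc (z : R[i]^o) < 1]); apply/nbhs_nv; exists 1 => // z.
  by rewrite linear0 subr0.
exists (2 / r) => [|v]; first by rewrite divr_ge0// ltW.
have [->|v0] := eqVneq v 0; first by rewrite linear0 normc0 nv0 mulr0.
have nv_gt0 : 0 < nv v by rewrite lt_neqAle nv_ge0 andbT eq_sym nv_eq0.
pose t := r / (2 * nv v); have t0 : 0 < t by rewrite divr_gt0// mulr_gt0.
have nt : normc t%:C%C = t by rewrite normcR ger0_norm ?ltW.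
have : nv (t%:C%C *: v - 0) < r -> normc (L (t%:C%C *: v)) < 1 := rP _.
rewrite subr0 nvZ nt (linearZ_LR L) normcM nt.
have -> : t * nv v = r / 2 by rewrite /t; field; rewrite gt_eqF.
rewrite ltr_pdivrMr// => /(_ ltac:(lra)) h.
rewrite -(ler_pM2l t0) (_ : t * (2 / r * nv v) = 1) ?(ltW h)//.
by rewrite /t; field; rewrite !gt_eqF.
Qed.

(** [deriv_bound] on the differences [fs k - fs l] makes the derivatives at [x] a Cauchy sequence in
    operator norm, and [lip_bound] makes [fs k - f] Lipschitz near [x] with a small constant. The
    remainder of [f] is thus compared with that of a single [fs k]. *)
Lemma uniform_limit_differentiable (fs : nat -> V -> R[i]^o) (f : V -> R[i]^o)
    x (r : R) : 0 < r ->
  (forall k y, nv (y - x) < r -> differentiable (fs k) y) ->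
  (forall e, 0 < e -> exists N, forall k y, (N <= k)%N -> nv (y - x) < r ->
     normc (fs k y - f y) <= e) ->
  differentiable f x.
Proof.
move=> r0 fsd fsf.
have xx : nv (x - x) < r by rewrite subrr nv0.
have /choice[L LcP] : forall k, exists L : {linear V -> R[i]^o},
    continuous L /\ fderiv (fs k) x L.
  by move=> k; have [L cL LP] := nv_differentiable (fsd k x xx); exists L.
have Lc k := proj1 (LcP k); have LP k := proj2 (LcP k).
have cau e : 0 < e -> exists N, forall k l y, (N <= k)%N -> (N <= l)%N ->
    nv (y - x) < r -> normc (fs k y - fs l y) <= e.
  move=> e0; have [N NP] := fsf (e / 2) (divr_gt0 e0 (ltr0n _ 2)).
  exists N => k l y Nk Nl yx; rewrite (splitr e).
  rewrite -[fs k y - _](_ : (fs k y - f y) + - (fs l y - f y) = _); last first.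
    by rewrite opprB addrA subrK.
  by apply: (le_trans (le_normcD _ _)); rewrite normcN lerD// NP.
have Lcau e : 0 < e -> exists N, forall k l v, (N <= k)%N -> (N <= l)%N ->
    normc (L k v - L l v) <= e * nv v.
  move=> e0; pose e' := e * r / 8.
  have e'0 : 0 < e' by rewrite divr_gt0// mulr_gt0.
  have [N NP] := cau _ e'0; exists N => k l v Nk Nl.
  have := @deriv_bound _ _ (fun y => fs k y - fs l y) x (fun v => L k v - L l v) r (2 * e') v r0.
  have -> : 4 * (2 * e') / r = e by rewrite /e'; field; rewrite gt_eqF.
  apply.
  - by move=> y yx; apply: differentiableB; exact: fsd.
  - move=> y yx; apply: (le_trans (le_normcD _ _)).
    by rewrite normcN mulr_natl mulr2n lerD// NP.
  - by move=> a; rewrite !(linearZ_LR (L _)) mulrBr.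
  - exact: fderivB.
have /choice[L0 L0P] : forall v, exists c, forall e, 0 < e ->
    exists N, forall k, (N <= k)%N -> normc (L k v - c) <= e.
  move=> v; apply: complex_cauchy => e e0.
  have K0 : 0 < 1 + nv v by rewrite ltr_pwDl ?nv_ge0.
  have [N NP] := Lcau _ (divr_gt0 e0 K0); exists N => k Nk.
  apply: (le_trans (NP _ _ _ Nk (leqnn _))).
  by rewrite mulrAC ler_pdivrMr// ler_wpM2l ?(ltW e0)// lerDr.
have L0lim e : 0 < e -> exists N, forall k v, (N <= k)%N ->
    normc (L k v - L0 v) <= e * nv v.
  move=> /Lcau[N NP]; exists N => k v Nk.
  apply: (@normc_limit (fun l => L k v - L l v) _ _ N); last first.
    by move=> l Nl; exact: NP.
  move=> e' /(L0P v)[N' NP']; exists N' => l /NP'.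
  rewrite -normcN; apply: le_trans.
  by rewrite le_eqVlt; apply/orP; left; apply/eqP; congr normc; ring.
have L0lin : linear (L0 : V -> R[i]^o).
  move=> a u v; apply/eqP; rewrite -subr_eq0; apply/eqP/eq0_normc/eqP.
  rewrite eq_le normc_ge0 andbT; apply/ler_addgt0Pr => e e0; rewrite add0r.
  pose K := nv (a *: u + v) + normc a * nv u + nv v.
  have K0 : 0 < 1 + K by rewrite ltr_pwDl// !addr_ge0 ?mulr_ge0 ?nv_ge0 ?normc_ge0.
  have [N NP] := L0lim _ (divr_gt0 e0 K0); have kk := leqnn N.
  have -> : L0 (a *: u + v) - (a *: L0 u + L0 v) =
     - (L N (a *: u + v) - L0 (a *: u + v)) +
     (a * (L N u - L0 u) + (L N v - L0 v)).
    rewrite (linearD (L N)) (linearZ_LR (L N)).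
    move: (L N u : C) (L N v : C) (L0 u) (L0 v) (L0 _) => p q p' q' t.
    by rewrite /GRing.scale/=; ring.
  have cK : e / (1 + K) * K <= e.
    by rewrite mulrAC ler_pdivrMr// ler_wpM2l ?(ltW e0)// lerDr.
  set c := e / (1 + K) in cK NP; apply: le_trans cK; clearbody c.
  apply: (le_trans (le_normcD _ _)); rewrite /K -addrA [leRHS]mulrDr lerD//.
    by rewrite normcN NP.
  apply: (le_trans (le_normcD _ _)); rewrite [leRHS]mulrDr lerD ?NP//.
  by rewrite normcM mulrCA ler_wpM2l ?normc_ge0// NP.
pose LL : {linear V -> R[i]^o} := HB.pack (L0 : V -> R[i]^o)
  (GRing.isLinear.Build _ _ _ _ (L0 : V -> R[i]^o) L0lin).
have L0f : fderiv f x L0.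
  move=> e e0; have e3 : 0 < e / 3 by rewrite divr_gt0.
  have [N1 N1P] := L0lim _ e3.
  have e'0 : 0 < e * r / 48 by rewrite divr_gt0// mulr_gt0.
  have [N2 N2P] := cau _ e'0.
  pose k := maxn N1 N2.
  have k1 : (N1 <= k)%N := leq_maxl _ _.
  have k2 : (N2 <= k)%N := leq_maxr _ _.
  have [d d0 dP] := LP k _ e3.
  exists (Num.min d (r / 2)); first by rewrite lt_min d0 divr_gt0.
  move=> y; rewrite lt_min => /andP[/dP h1 yr].
  have h2 := N1P k (y - x) k1.
  have yr' : nv (y - x) < r by apply: lt_trans yr _; lra.
  have h3 : normc ((fs k y - f y) - (fs k x - f x)) <= e / 3 * nv (y - x).
    apply: (@normc_limit (fun l => (fs k y - fs l y) - (fs k x - fs l x)) _ _ N2).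
      move=> e' e'1; have [N NP] := fsf (e' / 2) (divr_gt0 e'1 (ltr0n _ 2)).
      exists N => l Nl; rewrite (splitr e').
      apply: le_trans (lerD (NP l x Nl xx) (NP l y Nl yr')).
      rewrite -[normc (fs l y - _)]normcN; apply: le_trans (le_normcD _ _).
      by rewrite le_eqVlt; apply/orP; left; apply/eqP; congr normc; ring.
    move=> l Nl.
    have := @lip_bound _ _ (fun y => fs k y - fs l y) x r (e * r / 48) y r0.
    have -> : 16 * (e * r / 48) / r = e / 3 by field; rewrite gt_eqF.
    apply.
    - by move=> z zr; apply: differentiableB; exact: fsd.
    - by move=> z zr; exact: N2P.
    - exact: yr.
  have -> : e * nv (y - x) = e / 3 * nv (y - x) + e / 3 * nv (y - x) + e / 3 * nv (y - x).
    by field.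
  apply: le_trans (lerD (lerD h1 h2) h3).
  rewrite -[normc (_ - _ - (fs k x - _))]normcN.
  apply: le_trans (lerD (le_normcD _ _) (lexx _)).
  apply: le_trans (le_normcD _ _).
  by rewrite le_eqVlt; apply/orP; left; apply/eqP; congr normc; ring.
apply: (@differentiable_nv _ _ _ f x LL) => //.
have [N NP] := L0lim 1 ltr01.
have [K K0 KP] := linear_continuous_bounded (Lc N).
apply: (@linear_nv_continuous LL (1 + K)); first by rewrite addr_ge0.
move=> v; rewrite /= -[L0 v](subKr (L N v)).
apply: (le_trans (le_normcD _ _)); rewrite normcN addrC mulrDl lerD//.
by rewrite NP.
Qed.
End UniformLimit.

(** * The Euclidean ball *)

Section Euclid.
Variable R : realType.
Local Notation C := R[i].
Local Notation V := 'rV[R[i]^o]_3.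
Local Notation en := (@euclidean_norm R 3).
Implicit Types (x y z w : V).

Definition i0 : 'I_3 := @Ordinal 3 0 isT.
Definition i1 : 'I_3 := @Ordinal 3 1 isT.
Definition i2 : 'I_3 := @Ordinal 3 2 isT.

Lemma sum3 (M : nmodType) (F : 'I_3 -> M) : \sum_(i < 3) F i = F i0 + F i1 + F i2.
Proof.
rewrite !big_ord_recr big_ord0/= add0r.
by congr (F _ + F _ + F _); exact: val_inj.
Qed.

Lemma ord3P (P : 'I_3 -> Prop) : P i0 -> P i1 -> P i2 -> forall i, P i.
Proof.
move=> p0 p1 p2 [[|[|[|//]]] h].
- by rewrite (_ : Ordinal h = i0)//; exact: val_inj.
- by rewrite (_ : Ordinal h = i1)//; exact: val_inj.
- by rewrite (_ : Ordinal h = i2)//; exact: val_inj.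
Qed.

Definition vec3 (a b c : C) : V :=
  \row_(i < 3) nth (0 : C) [:: a; b; c] i.

Lemma vec3E a b c : (vec3 a b c 0 i0 = a) * (vec3 a b c 0 i1 = b) *
  (vec3 a b c 0 i2 = c).
Proof. by rewrite /vec3 !mxE. Qed.

Lemma vec3P z : z = vec3 (z 0 i0) (z 0 i1) (z 0 i2).
Proof. by apply/rowP; apply: ord3P; rewrite vec3E. Qed.

Lemma en_sqr z : en z ^+ 2 =
  normc (z 0 i0) ^+ 2 + normc (z 0 i1) ^+ 2 + normc (z 0 i2) ^+ 2.
Proof.
by rewrite /euclidean_norm sum3 sqr_sqrtr// !addr_ge0 ?sqr_ge0.
Qed.

Lemma en_ge0 z : 0 <= en z.
Proof. exact: sqrtr_ge0. Qed.

Lemma en_le z (a b c r : R) : normc (z 0 i0) <= a -> normc (z 0 i1) <= b ->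
  normc (z 0 i2) <= c -> 0 <= r -> a ^+ 2 + b ^+ 2 + c ^+ 2 <= r ^+ 2 -> en z <= r.
Proof.
move=> za zb zc r0 abc; rewrite -(ler_pXn2r (n := 2))// ?nnegrE ?en_ge0//.
rewrite en_sqr; apply: le_trans abc.
have a0 := le_trans (normc_ge0 _) za; have b0 := le_trans (normc_ge0 _) zb.
have c0 := le_trans (normc_ge0 _) zc.
by rewrite !lerD// lerXn2r// nnegrE ?normc_ge0.
Qed.

Lemma en_le_sum z : en z <= normc (z 0 i0) + normc (z 0 i1) + normc (z 0 i2).
Proof.
apply: en_le => //; first by rewrite !addr_ge0 ?normc_ge0.
have := normc_ge0 (z 0 i0); have := normc_ge0 (z 0 i1); have := normc_ge0 (z 0 i2).
move: (normc _) (normc _) (normc _) => a b c; clear; nra.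
Qed.

Lemma coord_le_en z i : normc (z 0 i) <= en z.
Proof.
rewrite -(ler_pXn2r (n := 2))// ?nnegrE ?en_ge0 ?normc_ge0// en_sqr.
move: i; apply: ord3P; rewrite -?addrA.
- by rewrite lerDl addr_ge0 ?sqr_ge0.
- by rewrite addrCA lerDl addr_ge0 ?sqr_ge0.
- by rewrite addrA lerDr addr_ge0 ?sqr_ge0.
Qed.

Lemma cauchy_schwarz3 (a b c a' b' c' e f : R) : 0 <= e -> 0 <= f ->
  e ^+ 2 = a ^+ 2 + b ^+ 2 + c ^+ 2 -> f ^+ 2 = a' ^+ 2 + b' ^+ 2 + c' ^+ 2 ->
  a * a' + b * b' + c * c' <= e * f.
Proof.
move=> e0 f0 ez ew; apply: (le_trans (ler_norm _)).
rewrite -(ler_pXn2r (n := 2))// ?nnegrE ?mulr_ge0// real_normK ?num_real//.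
rewrite exprMn ez ew -subr_ge0.
have -> : (a ^+ 2 + b ^+ 2 + c ^+ 2) * (a' ^+ 2 + b' ^+ 2 + c' ^+ 2) -
  (a * a' + b * b' + c * c') ^+ 2 = (a * b' - b * a') ^+ 2 +
  (a * c' - c * a') ^+ 2 + (b * c' - c * b') ^+ 2 by ring.
by rewrite !addr_ge0 ?sqr_ge0.
Qed.

Lemma enD z w : en (z + w) <= en z + en w.
Proof.
have zw i : normc ((z + w) 0 i) <= normc (z 0 i) + normc (w 0 i).
  by rewrite mxE le_normcD.
apply: (en_le (zw _) (zw _) (zw _)); first by rewrite addr_ge0 ?en_ge0.
have := cauchy_schwarz3 (en_ge0 z) (en_ge0 w) (en_sqr z) (en_sqr w).
have -> : (en z + en w) ^+ 2 = en z ^+ 2 + en w ^+ 2 + 2 * (en z * en w) by ring.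
by rewrite !en_sqr; lra.
Qed.

Lemma enN z : en (- z) = en z.
Proof.
rewrite /euclidean_norm; congr Num.sqrt; apply: eq_bigr => i _.
by rewrite mxE normcN.
Qed.

Lemma enB z w : en (z - w) = en (w - z).
Proof. by rewrite -enN opprB. Qed.

Lemma en_tri w z x : en (z - x) <= en (z - w) + en (w - x).
Proof. by rewrite (le_trans _ (enD _ _))// addrA subrK. Qed.

Lemma enZ (a : C) z : en (a *: z) = normc a * en z.
Proof.
have H : (normc a * en z) ^+ 2 = en (a *: z) ^+ 2.
  by rewrite exprMn !en_sqr !mxE /GRing.scale/= !normcM; ring.
by apply/eqP; rewrite -(eqrXn2 (n := 2))// ?en_ge0 ?mulr_ge0 ?normc_ge0 ?en_ge0// H.
Qed.

Lemma en_e1 : en (vec3 1 0 0) = 1.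
Proof.
apply/eqP; rewrite -(eqrXn2 (n := 2))// ?en_ge0// en_sqr !vec3E normc1 normc0.
by rewrite expr0n !addr0.
Qed.

Lemma en0 : en 0 = 0.
Proof. by rewrite -(scale0r (0 : V)) enZ normc0 mul0r. Qed.

Lemma en_eq0 z : en z = 0 -> z = 0.
Proof.
move=> z0; apply/rowP => i; rewrite mxE; apply: eq0_normc.
by apply/eqP; rewrite eq_le normc_ge0 andbT -z0 coord_le_en.
Qed.

Lemma coord_le_nv z i : normc (z 0 i) <= nv z.
Proof.
rewrite -lecR -nvE; change (`|z 0 i| <= mx_norm z).
rewrite mx_normE -[leLHS]nngE num_le.
exact: (le_bigmax _ (fun ij => `|z ij.1 ij.2|%:nng) (0, i)).
Qed.

(** The factor 2 is a rational upper bound for the square root of 3. *)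
Lemma en_le_nv z : en z <= 2 * nv z.
Proof.
have z0 := nv_ge0 z.
apply: (@en_le z _ _ _ _ (coord_le_nv z i0) (coord_le_nv z i1) (coord_le_nv z i2)).
  by rewrite mulr_ge0.
by move: (nv z) z0 => a a0; nra.
Qed.

Lemma nv_le_en z : nv z <= en z.
Proof.
have [z0|z0] := eqVneq (mx_norm z) 0.
  by rewrite /nv (_ : `|z| = 0)// en_ge0.
have [[i j] /= zij] := mx_norm_neq0 z0.
rewrite -lecR -nvE; change (mx_norm z <= (en z)%:C%C); rewrite zij.
by rewrite (_ : i = 0) ?ord1// (_ : `|_| = (normc (z 0 j))%:C%C)// lecR coord_le_en.
Qed.

Lemma nbhs_en z (A : set V) : nbhs z A <->
  exists2 r : R, 0 < r & forall w, en (w - z) < r -> A w.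
Proof.
split=> [/nbhs_nv[r r0 rA]|[r r0 rA]].
  by exists r => // w wr; apply: rA; exact: le_lt_trans (nv_le_en _) wr.
apply/nbhs_nv; exists (r / 2); first by rewrite divr_gt0.
move=> w wr; apply: rA; apply: (le_lt_trans (en_le_nv _)).
by rewrite mulrC -ltr_pdivlMr.
Qed.

Definition cball : set V := [set z | en z <= 1].

Lemma closure_ball : closure (unit_ball R 3) `<=` cball.
Proof.
move=> z zB; apply/ler_addgt0Pr => e e0.
have /zB[w [wB wz]] : nbhs z [set w | en (w - z) < e] by apply/nbhs_en; exists e.
rewrite -[z](subrK w) addrC; apply: (le_trans (enD _ _)).
by rewrite lerD ?(ltW wB)// enB ltW.
Qed.

Lemma differentiable_row (W : normedModType C) (f : W -> V) (p : W) :
  (forall i, differentiable (fun u : W => f u 0 i : R[i]^o) p) ->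
  differentiable f p.
Proof.
move=> fi; rewrite (_ : f = \sum_(i < 3) (fun u : W => f u 0 i *: delta_mx 0 i)).
  by apply: differentiable_sum => i; exact: differentiableZl.
by apply/funext => w; rewrite fct_sumE {1}[f w]row_sum_delta.
Qed.

Lemma differentiable_rowP (f : V -> V) z i :
  differentiable f z -> differentiable (fun w => f w 0 i : R[i]^o) z.
Proof.
move=> fd; apply: (@differentiable_comp _ _ _ _ f (fun w : V => w 0 i : R[i]^o)).
  exact: fd.
exact: differentiable_coord.
Qed.

Lemma near_differentiable (W W' : normedModType C) (f g : W -> W') (p : W) :
  (\forall y \near p, f y = g y) -> differentiable g p -> differentiable f p.
Proof.
move=> /nbhs_nv[r r0 fg] gd; have [L cL LP] := nv_differentiable gd.
apply: (differentiable_nv cL) => e /LP[d d0 dP].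
exists (Num.min r d); first by rewrite lt_min r0.
move=> y; rewrite lt_min => /andP[/fg-> /dP].
by rewrite fg// subrr nv0.
Qed.

Lemma within_continuous (A : set V) (f : V -> V) :
  (forall z, A z -> forall e : R, 0 < e -> exists2 r, 0 < r &
    forall w, A w -> en (w - z) < r -> en (f w - f z) < e) ->
  {within A, continuous f}.
Proof.
move=> H; apply/subspace_continuousP => z Az B /nbhs_en[e e0 eB].
have [r r0 rP] := H z Az e e0; apply/nbhs_en; exists r => // w wr Aw.
by apply: eB; exact: rP.
Qed.
End Euclid.

Section Compactness.
Variable R : realType.
Local Notation C := R[i].
Local Notation V := 'rV[R[i]^o]_3.

Lemma nbhs_normc (z : R[i]^o) (A : set R[i]^o) : nbhs z A <->
  exists2 r : R, 0 < r & forall w, normc (w - z) < r -> A w.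
Proof. exact: nbhs_nv. Qed.

Lemma compact_square (r : R) :
  compact [set z : R[i]^o | `|complex.Re z| <= r /\ `|complex.Im z| <= r].
Proof.
pose g (p : R * R) : R[i]^o := (p.1 +i* p.2)%C.
have -> : [set z : R[i]^o | `|complex.Re z| <= r /\ `|complex.Im z| <= r] =
    g @` (`[- r, r] `*` `[- r, r]).
  apply/seteqP; split=> [[a b]/= [ar br]|z [[a b] [/= +]]].
    by exists (a, b) => //; split; rewrite /= in_itv/= -ler_norml.
  by rewrite !in_itv/= -!ler_norml => ar br <-.
apply: continuous_compact; last by apply: compact_setX; exact: segment_compact.
apply: continuous_subspaceT => -[a b] A /nbhs_normc[e e0 eA].
exists (ball a (e / 2), ball b (e / 2)).
  by split; apply: nbhsx_ballx; rewrite divr_gt0.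
move=> [a' b'] [/= ha hb]; apply: eA; apply: (le_lt_trans (normc_le _)).
rewrite Re_sub Im_sub/= (splitr e) distrC [`|b' - b|]distrC.
exact: ltrD.
Qed.

Lemma compact_annulus (a b : R) :
  compact [set z : R[i]^o | a <= normc z <= b].
Proof.
refine (@subclosed_compact _ _ _ _ (@compact_square b) _).
  rewrite closedE => z /= zA; apply: contrapT => nz; apply: zA.
  have nc : `|normc z - normc z| < 1 by rewrite subrr normr0.
  have [az|az] := leP a (normc z); last first.
    apply/nbhs_normc; exists (a - normc z); first by rewrite subr_gt0.
    move=> w wz /andP[aw _]; move: wz; apply/negP; rewrite -leNgt lerBlDr.
    by apply: (le_trans aw); rewrite -[w in leLHS](subrK z) le_normcD.
  have [zb|bz] := leP (normc z) b; first by case: nz; rewrite az zb.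
  apply/nbhs_normc; exists (normc z - b); first by rewrite subr_gt0.
  move=> w wz /andP[_ wb]; move: wz; apply/negP; rewrite -leNgt lerBlDr.
  rewrite normcB; apply: le_trans (lerD (lexx _) wb).
  by rewrite -[z in leLHS](subrK w) le_normcD.
move=> z /= /andP[_ zb].
by split; [apply: le_trans (normc_Re _) zb|apply: le_trans (normc_Im _) zb].
Qed.

Lemma compact_cball : compact (cball (R := R)).
Proof.
refine (@subclosed_compact _ _ _ _ (@rV_compact _ _ (fun=> _) (fun=> @compact_square 1)) _).
  rewrite closedE => z /= zA; apply: contrapT => /negP; rewrite -ltNge => z1.
  apply: zA; apply/nbhs_en; exists (euclidean_norm z - 1); first by rewrite subr_gt0.
  move=> w wz /= w1; move: wz; apply/negP; rewrite -leNgt lerBlDr enB.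
  apply: le_trans (lerD (lexx _) w1).
  by rewrite -[z in leLHS](subrK w) enD.
move=> z /= z1 i; split; first apply: (le_trans (normc_Re _)).
  by apply: le_trans z1; exact: coord_le_en.
by apply: (le_trans (normc_Im _)); apply: le_trans z1; exact: coord_le_en.
Qed.
End Compactness.

(** * Local inverses and the model map *)

Section Implicit.
Variable R : realType.
Local Notation C := R[i].

Lemma normc_sub_ge (z w : C) : normc z - normc w <= normc (z + w).
Proof.
rewrite lerBlDr -[normc w]normcN; apply: le_trans (le_normcD _ _).
by rewrite addrK.
Qed.

(** The root is written as [- 2 d / (b + s)] with [s] a square root of the discriminant: this form
    survives [a = 0] and selects the small root, the one that tends to 0 with [d]. *)
Lemma quadratic_root (a b d : C) : b != 0 ->
  exists h, a * h ^+ 2 + b * h + d = 0 /\ normc h * normc b <= 2 * normc d.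
Proof.
move=> b0; pose s0 := sqrtc (b ^+ 2 - 4 * a * d).
have s0E : s0 ^+ 2 = b ^+ 2 - 4 * a * d by exact: sqr_sqrtc.
(* Since [(b + s0) + (b - s0) = 2 b], one of the two signs gives a denominator of modulus at least
   [normc b]. *)
have [s sE bs] : exists2 s, s ^+ 2 = b ^+ 2 - 4 * a * d & normc b <= normc (b + s).
  have [h|h] := leP (normc b) (normc (b + s0)); first by exists s0.
  exists (- s0); first by rewrite sqrrN.
  have : normc (b + b) <= normc (b + s0) + normc (b + - s0).
    by rewrite (le_trans _ (le_normcD _ _))// addrACA subrr addr0.
  have -> : normc (b + b) = normc b + normc b.
    rewrite -[b in LHS]mul1r -mulrDl normcM (_ : 1 + 1 = (1 + 1 : R)%:C%C).
      by rewrite normcR ger0_norm// mulrDl mul1r.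
    by rewrite rmorphD rmorph1.
  by lra.
have bs0 : b + s != 0.
  by apply/eqP => e; move: bs; rewrite e normc0 leNgt normc_gt0.
exists (- (2 * d) / (b + s)); split.
  have -> : a * (- (2 * d) / (b + s)) ^+ 2 + b * (- (2 * d) / (b + s)) + d =
     d / (b + s) ^+ 2 * (s ^+ 2 - (b ^+ 2 - 4 * a * d)) by field.
  by rewrite sE subrr mulr0.
rewrite normcM normcV normcN normcM (_ : 2 = (2 : R)%:C%C); last by rewrite rmorph_nat.
rewrite normcR ger0_norm// mulrAC ler_pdivrMr ?normc_gt0//.
by rewrite ler_wpM2l// mulr_ge0 ?normc_ge0.
Qed.

Variable W : normedModType C.
Implicit Types (x y : W) (f g : W -> R[i]^o).

Lemma differentiable_eps f x : differentiable f x -> forall e : R, 0 < e ->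
  exists2 r, 0 < r & forall y, nv (y - x) < r -> normc (f y - f x) < e.
Proof.
move=> /differentiable_continuous fc e e0.
have /nbhs_nv[r r0 rP] : nbhs x [set y | normc (f y - f x) < e].
  by apply: (fc [set z | normc (z - f x : R[i]^o) < e]); apply/nbhs_nv; exists e.
by exists r.
Qed.

(** Where the numerator vanishes, mere continuity of the denominator suffices. This breaks the
    circle in [implicit_root], whose denominator contains the root under study. *)
Lemma differentiable_vanishing_quotient (n g : W -> R[i]^o) x :
  differentiable n x -> n x = 0 -> g x != 0 ->
  (forall e : R, 0 < e -> exists2 r, 0 < r &
     forall y, nv (y - x) < r -> normc (g y - g x) < e) ->
  differentiable (fun y => n y / g y : R[i]^o) x.
Proof.
move=> nd n0 g0 gc; have [L cL LP] := nv_differentiable nd.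
have [K K0 KP] := linear_continuous_bounded cL.
set c := normc (g x); have c0 : 0 < c by exact: normc_gt0.
pose M : {linear W -> R[i]^o} := (g x)^-1 \*: L.
have ME v : M v = L v / g x by rewrite /M /= /GRing.scale/= mulrC.
apply: (@differentiable_nv _ _ _ _ _ M).
  apply: (@linear_nv_continuous _ _ _ (K / c)); first by rewrite divr_ge0// ltW.
  move=> v; rewrite ME normcM normcV [leRHS]mulrAC -/c.
  by rewrite ler_pM2r ?invr_gt0.
move=> e e0.
have [d1 d10 d1P] := LP (e * c / 4) ltac:(by rewrite divr_gt0// mulr_gt0).
(* The first bound keeps [normc (g y)] above [c / 2]; the second makes the error from replacing
   [1 / g y] by [1 / g x] at most [e / 2], relative to [nv (y - x)]. *)
pose e2 := Num.min (c / 2) (e * c ^+ 2 / (4 * (1 + K))).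
have K1 : 0 < 1 + K by rewrite ltr_pwDl.
have e20 : 0 < e2 by rewrite lt_min !divr_gt0 ?mulr_gt0 ?exprn_gt0.
have [d2 d20 d2P] := gc e2 e20.
exists (Num.min d1 d2); first by rewrite lt_min d10.
move=> y; rewrite lt_min => /andP[/d1P h1 /d2P h2].
rewrite n0 mul0r !subr0 in h1 *; change (normc (n y / g y - M (y - x)) <= e * nv (y - x)).
have h1' : normc (n y - L (y - x)) <= e * c / 4 * nv (y - x) := h1.
have [h3 h4] : normc (g y - g x) <= c / 2 /\
    normc (g y - g x) <= e * c ^+ 2 / (4 * (1 + K)).
  by move: h2; rewrite lt_min => /andP[/ltW ? /ltW].
have gy : c / 2 <= normc (g y).
  rewrite (_ : g y = g x + (g y - g x)); last by rewrite addrC subrK.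
  by apply: le_trans (normc_sub_ge _ _); rewrite -/c; lra.
have gy0 : 0 < normc (g y) by apply: lt_le_trans gy; rewrite divr_gt0.
have gyN : g y != 0 by apply/eqP => E; move: gy0; rewrite E normc0 ltxx.
rewrite ME; have -> : n y / g y - L (y - x) / g x =
    (n y - L (y - x)) / g y + - (L (y - x) * (g y - g x) / (g y * g x)).
  by field; rewrite ?gyN ?gx0 ?g0.
have iy : (normc (g y))^-1 <= 2 / c.
  by rewrite (_ : 2 / c = (c / 2)^-1) ?lef_pV2 ?posrE ?divr_gt0// invfM invrK mulrC.
have v0 := nv_ge0 (y - x).
apply: (le_trans (le_normcD _ _)); rewrite normcN !normcM !normcV normcM -/c.
have -> : e * nv (y - x) = e * c / 4 * nv (y - x) * (2 / c) + e / 2 * nv (y - x).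
  by field; rewrite gt_eqF.
rewrite lerD//.
  by apply: (ler_pM _ _ h1' iy); rewrite ?invr_ge0 normc_ge0.
apply: (@le_trans _ _ (K * nv (y - x) * (e * c ^+ 2 / (4 * (1 + K))) * (2 / c / c))).
  rewrite invfM ler_pM ?mulr_ge0 ?invr_ge0 ?normc_ge0 ?(ltW c0)//.
    by rewrite ler_pM ?normc_ge0.
  by rewrite ler_pM2r ?invr_gt0.
rewrite [leLHS](_ : _ = (e / 2 * nv (y - x)) * (K / (1 + K))); last first.
  by field; rewrite !gt_eqF.
rewrite ler_piMr//; first by rewrite mulr_ge0// divr_ge0// ltW.
by rewrite ler_pdivrMr// mul1r lerDr.
Qed.

(** An implicit function theorem for quadratic equations. The roots are chosen pointwise; the bound
    from [quadratic_root] gives continuity at [x], and the equation in the form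
    [h = - d / (b + a * h)] then gives differentiability at [x]. *)
Lemma implicit_root (a b d : W -> R[i]^o) x : differentiable a x ->
  differentiable b x -> differentiable d x -> d x = 0 -> b x != 0 ->
  exists h : W -> R[i]^o, [/\ h x = 0, differentiable h x &
    \forall y \near x, a y * h y ^+ 2 + b y * h y + d y = 0].
Proof.
move=> da db dd dx bx.
have /choice[h hP] : forall y, exists h : R[i]^o, b y != 0 ->
    a y * h ^+ 2 + b y * h + d y = 0 /\ normc h * normc (b y) <= 2 * normc (d y).
  move=> y; have [by0|by0] := eqVneq (b y) 0; first by exists 0.
  by have [h0 hP] := quadratic_root (a y) (d y) by0; exists h0.
have [hx hx'] := hP x bx; set c := normc (b x).
have c0 : 0 < c by exact: normc_gt0.
have h0 : h x = 0.
  apply: eq0_normc; apply/eqP; rewrite eq_le normc_ge0 andbT.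
  by move: hx'; rewrite dx normc0 mulr0 pmulr_lle0.
have [r r0 rP] := differentiable_eps db (divr_gt0 c0 (ltr0n _ 2)).
have bn y : nv (y - x) < r -> c / 2 <= normc (b y).
  move=> /rP yr; rewrite (_ : b y = b x + (b y - b x)); last by rewrite addrC subrK.
  by apply: le_trans (normc_sub_ge _ _); rewrite -/c; lra.
have bn0 y : nv (y - x) < r -> b y != 0.
  move=> /bn yr; apply/eqP => E; move: yr; rewrite E normc0 leNgt.
  by rewrite divr_gt0.
have hc e : 0 < e -> exists2 q, 0 < q & forall y, nv (y - x) < q ->
    nv (y - x) < r /\ normc (h y) < e.
  move=> e0; have [q q0 qP] := differentiable_eps dd
    (ltac:(by rewrite divr_gt0// mulr_gt0) : 0 < e * c / 4).
  exists (Num.min q r); first by rewrite lt_min q0.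
  move=> y; rewrite lt_min => /andP[/qP + yr]; rewrite dx subr0 => dy; split => //.
  have [_ hy] := hP y (bn0 y yr).
  have : normc (h y) * (c / 2) <= 2 * normc (d y).
    by apply: le_trans hy; rewrite ler_wpM2l ?normc_ge0// bn.
  move=> hy'; rewrite -(ltr_pM2r c0); move: hy' dy; clear; nra.
exists h; split => //; last first.
  by apply/nbhs_nv; exists r => // y /bn0/hP[].
pose g y : R[i]^o := b y + a y * h y.
have gx : g x = b x by rewrite /g h0 mulr0 addr0.
have gc e : 0 < e -> exists2 q, 0 < q & forall y, nv (y - x) < q ->
    normc (g y - g x) < e.
  move=> e0; pose A := 1 + normc (a x).
  have A0 : 0 < A by rewrite ltr_pwDl ?normc_ge0.
  have [q1 q10 q1P] := differentiable_eps db (divr_gt0 e0 (ltr0n _ 2)).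
  have [q2 q20 q2P] := differentiable_eps da ltr01.
  have [q3 q30 q3P] := hc (e / 2 / A) ltac:(by rewrite !divr_gt0).
  exists (Num.min q1 (Num.min q2 q3)); first by rewrite !lt_min q10 q20.
  move=> y; rewrite !lt_min => /andP[/q1P h1 /andP[/q2P h2 /q3P[_ h3]]].
  rewrite gx /g addrAC; apply: (le_lt_trans (le_normcD _ _)).
  rewrite (splitr e) ltrD// normcM.
  apply: (@le_lt_trans _ _ (A * normc (h y))).
    rewrite ler_wpM2r ?normc_ge0// /A -[a y](subrK (a x)).
    by apply: (le_trans (le_normcD _ _)); rewrite lerD// ltW.
  by rewrite mulrC -ltr_pdivlMr.
have gx0 : g x != 0 by rewrite gx.
apply: (@near_differentiable _ _ _ _ (fun y => - d y / g y)); last first.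
  apply: differentiable_vanishing_quotient => //; first exact: differentiableN.
  by rewrite dx oppr0.
have [q q0 qP] := gc _ (normc_gt0 gx0).
apply/nbhs_nv; exists (Num.min q r); first by rewrite lt_min q0.
move=> y; rewrite lt_min => /andP[/qP h1 /bn0/hP[h2 _]].
have gy : g y != 0.
  by apply/eqP => E; move: h1; rewrite E sub0r normcN ltxx.
apply: (mulIf gy); rewrite divfK// /g; apply/eqP; rewrite -subr_eq0 opprK -h2.
by apply/eqP; ring.
Qed.
End Implicit.

Section LocalInverse.
Variable R : realType.
Local Notation C := R[i].
Local Notation V := 'rV[R[i]^o]_3.
Local Notation en := (@euclidean_norm R 3).

(** A local right inverse, differentiable at the single point [T z]. This is what pointwise root
    selection provides; it is stable under composition and makes images of neighbourhoods
    neighbourhoods. *)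
Definition locally_invertible (T : V -> V) (z : V) := exists S : V -> V,
  [/\ S (T z) = z, differentiable S (T z) & \forall w \near T z, T (S w) = w].

Lemma locally_invertible_comp (T1 T2 : V -> V) z :
  locally_invertible T1 (T2 z) -> locally_invertible T2 z ->
  locally_invertible (T1 \o T2) z.
Proof.
move=> [S1 [s1 d1 n1]] [S2 [s2 d2 n2]]; exists (S2 \o S1); split => /=.
- by rewrite s1 s2.
- by apply: (@differentiable_comp _ _ _ _ S1 S2 (T1 (T2 z)) d1); rewrite s1.
- have c1 := differentiable_continuous d1.
  have : \forall w \near T1 (T2 z), T2 (S2 (S1 w)) = S1 w.
    by apply: (c1 [set w | T2 (S2 w) = w]); rewrite s1.
  by apply: filterS2 n1 => w /= e1 e2; rewrite e2 e1.
Qed.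

Lemma locally_invertible_open (T : V -> V) z (O : set V) :
  locally_invertible T z -> nbhs z O -> nbhs (T z) (T @` O).
Proof.
move=> [S [s d n]] zO.
have : \forall w \near T z, O (S w).
  by apply: (differentiable_continuous d); rewrite s.
by apply: filterS2 n => w e1 e2; exists (S w).
Qed.

(** Boundedness and the Lipschitz property go together so that products, and inverses away from
    zero, stay in the class. *)
Definition lipb (f : V -> C) := exists M, 0 <= M /\ forall z w,
  en z <= 1 -> en w <= 1 -> normc (f z) <= M /\ normc (f z - f w) <= M * en (z - w).

Lemma lipb_cst (a : C) : lipb (fun=> a).
Proof.
exists (normc a); split; first exact: normc_ge0.
by move=> z w _ _; rewrite lexx subrr normc0 mulr_ge0 ?normc_ge0 ?en_ge0.
Qed.

Lemma lipb_coord i : lipb (fun z => z 0 i).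
Proof.
exists 1; split => // z w z1 w1; split; first exact: le_trans (coord_le_en _ _) z1.
by have := coord_le_en (z - w) i; rewrite mul1r !mxE.
Qed.

Lemma lipbD f g : lipb f -> lipb g -> lipb (fun z => f z + g z).
Proof.
move=> [M [M0 fM]] [N [N0 gN]]; exists (M + N); split; first exact: addr_ge0.
move=> z w z1 w1; have [f1 f2] := fM z w z1 w1; have [g1 g2] := gN z w z1 w1.
split; first by apply: (le_trans (le_normcD _ _)); exact: lerD.
rewrite opprD addrACA mulrDl; apply: (le_trans (le_normcD _ _)); exact: lerD.
Qed.

Lemma lipbN f : lipb f -> lipb (fun z => - f z).
Proof.
move=> [M [M0 fM]]; exists M; split => // z w z1 w1; have [f1 f2] := fM z w z1 w1.
by rewrite normcN -opprD normcN.
Qed.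

Lemma lipbM f g : lipb f -> lipb g -> lipb (fun z => f z * g z).
Proof.
move=> [M [M0 fM]] [N [N0 gN]]; exists (M * N + M * N).
split; first by rewrite addr_ge0 ?mulr_ge0.
move=> z w z1 w1; have [f1 f2] := fM z w z1 w1; have [g1 g2] := gN z w z1 w1.
have [_ _] := fM w z w1 z1; have [g3 _] := gN w z w1 z1.
split.
  rewrite normcM (@le_trans _ _ (M * N))//; first by rewrite ler_pM ?normc_ge0.
  by rewrite lerDl mulr_ge0.
have -> : f z * g z - f w * g w = f z * (g z - g w) + (f z - f w) * g w by ring.
apply: (le_trans (le_normcD _ _)); rewrite !normcM mulrDl lerD//.
  by rewrite -mulrA ler_pM ?normc_ge0.
by rewrite mulrAC ler_pM ?normc_ge0.
Qed.

Lemma lipbV f (d : R) : 0 < d -> (forall z, en z <= 1 -> d <= normc (f z)) ->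
  lipb f -> lipb (fun z => (f z)^-1).
Proof.
move=> d0 fd [M [M0 fM]]; exists (d^-1 + M / d / d).
have dV : 0 <= d^-1 by rewrite invr_ge0 ltW.
split; first by rewrite addr_ge0 ?mulr_ge0.
move=> z w z1 w1; have [f1 f2] := fM z w z1 w1.
have z0 : f z != 0 by apply/eqP => E; have := fd z z1; rewrite E normc0 leNgt d0.
have w0 : f w != 0 by apply/eqP => E; have := fd w w1; rewrite E normc0 leNgt d0.
have iz : (normc (f z))^-1 <= d^-1 by rewrite lef_pV2 ?posrE ?normc_gt0// fd.
have iw : (normc (f w))^-1 <= d^-1 by rewrite lef_pV2 ?posrE ?normc_gt0// fd.
split.
  by rewrite normcV (le_trans iz)// lerDl !mulr_ge0.
have -> : (f z)^-1 - (f w)^-1 = - (f z - f w) / f z / f w by field; rewrite z0 w0.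
rewrite !normcM !normcV normcN.
apply: (@le_trans _ _ (M * en (z - w) / d / d)).
  by rewrite !ler_pM ?mulr_ge0 ?invr_ge0 ?normc_ge0.
rewrite mulrDl [M / d / d * _]mulrAC [M / d * _]mulrAC lerDr.
by rewrite mulr_ge0 ?en_ge0.
Qed.

Lemma lipb_vec (T : V -> V) : (forall i, lipb (fun z => T z 0 i)) ->
  exists2 L, 0 <= L & forall z w, en z <= 1 -> en w <= 1 ->
    en (T z - T w) <= L * en (z - w).
Proof.
move=> TL; have [M0 [p0 h0]] := TL i0; have [M1 [p1 h1]] := TL i1.
have [M2 [p2 h2]] := TL i2.
exists (M0 + M1 + M2); first by rewrite !addr_ge0.
move=> z w z1 w1; apply: (le_trans (en_le_sum _)); rewrite !mulrDl !mxE.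
by rewrite !lerD//; [apply: (h0 _ _ _ _).2|apply: (h1 _ _ _ _).2|
  apply: (h2 _ _ _ _).2].
Qed.

End LocalInverse.

(** * The variant of Wermer's map *)

Section Model.
Variables (R : realType) (A s : R).
Hypotheses (A1 : 1 <= A) (s0 : 0 < s).
Local Notation C := R[i].
Local Notation V := 'rV[R[i]^o]_3.
Local Notation en := (@euclidean_norm R 3).
Implicit Types (z w t : V) (x : C).

(* With [s] small, [model_c] is large near [x = 1], but on the closed ball
   [normc (model_c z1) * normc z3 <= 1 / 3]; [model_m] vanishes at
   [x = 1 - 2 * s ^+ 2]. *)
Definition model_d x : C := (s ^+ 2 + 1)%:C%C - x.
Definition model_c x : C := s%:C%C / (3 * model_d x).
Definition model_m x : C := A%:C%C * s%:C%C ^+ 2 * (model_d x - 3 * s%:C%C ^+ 2) / model_d x ^+ 2.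

(** With [v = z3], with [v' = z3 + m * z2] the new third coordinate, and with
    [P v = v - c * v ^+ 2], the new second coordinate times [m] is [P v' - P v]. Hence the
    injectivity condition: [P] takes the same value at two distinct points only if [c] times their
    sum is 1. *)
Definition model z : V :=
  let c := model_c (z 0 i0) in let m := model_m (z 0 i0) in
  vec3 (z 0 i0) (z 0 i1 * (1 - 2 * c * z 0 i2 - m * c * z 0 i1))
    (z 0 i2 + m * z 0 i1).

Let A0 : 0 <= A. Proof. exact: le_trans A1. Qed.

Lemma normc_nat n : normc (n%:R : C) = n%:R.
Proof. by rewrite -(rmorph_nat (real_complex R)) normcR ger0_norm. Qed.

(** With [x] the real part of [z1], the denominator has modulus at least [s ^+ 2 + (1 - x)], while
    on the ball the squared moduli of [z2] and [z3] sum to at most [2 * (1 - x)]. The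
    arithmetic-geometric inequality compares the two. *)
Lemma dn_bounds z : en z <= 1 -> let q := normc (model_d (z 0 i0)) in
  [/\ s ^+ 2 <= q, s * normc (z 0 i1) <= q, s * normc (z 0 i2) <= q &
      normc (z 0 i1) * normc (z 0 i2) <= q].
Proof.
move=> z1 q; have : en z ^+ 2 <= 1 by rewrite expr_le1 ?en_ge0.
rewrite en_sqr normc_sqr; have q2 := normc_sqr (model_d (z 0 i0)).
have q0 : 0 <= q by exact: normc_ge0.
rewrite -/q /model_d Re_sub Im_sub/= sub0r sqrrN in q2.
have := normc_ge0 (z 0 i1); have := normc_ge0 (z 0 i2).
move: q2 q0; move: q (normc (z 0 i1)) (normc (z 0 i2)) => q b c.
move: (complex.Re (z 0 i0)) (complex.Im (z 0 i0)) => x y q2 q0 c0 b0 h.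
have x1 : x <= 1 by nra.
have x0 : 0 <= s ^+ 2 + (1 - x) by rewrite addr_ge0 ?sqr_ge0// subr_ge0.
have qx : s ^+ 2 + (1 - x) <= q.
  rewrite -(ler_pXn2r (n := 2))// q2.
  by rewrite addrA lerDl sqr_ge0.
have bc : b ^+ 2 + c ^+ 2 <= 2 * (1 - x) by nra.
have sq2 : s ^+ 2 * (b ^+ 2 + c ^+ 2) <= q ^+ 2.
  have h1 : s ^+ 2 * (b ^+ 2 + c ^+ 2) <= s ^+ 2 * (2 * (1 - x)).
    by rewrite ler_wpM2l ?sqr_ge0.
  have h2 : (s ^+ 2 + (1 - x)) ^+ 2 <= q ^+ 2.
    by rewrite lerXn2r.
  apply: (le_trans h1); apply: le_trans h2; rewrite -subr_ge0.
  have -> : (s ^+ 2 + (1 - x)) ^+ 2 - s ^+ 2 * (2 * (1 - x)) =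
    (s ^+ 2) ^+ 2 + (1 - x) ^+ 2 by ring.
  by rewrite addr_ge0 ?sqr_ge0.
have s2 := sqr_ge0 s.
split.
- by apply: le_trans qx; rewrite lerDl subr_ge0.
- rewrite -(ler_pXn2r (n := 2))// ?nnegrE ?mulr_ge0 ?(ltW s0)// exprMn.
  by apply: le_trans sq2; rewrite mulrDr lerDl mulr_ge0 ?sqr_ge0.
- rewrite -(ler_pXn2r (n := 2))// ?nnegrE ?mulr_ge0 ?(ltW s0)// exprMn.
  by apply: le_trans sq2; rewrite mulrDr lerDr mulr_ge0 ?sqr_ge0.
- have : 0 <= (b - c) ^+ 2 by exact: sqr_ge0.
  by nra.
Qed.

Lemma dn_gt0 z : en z <= 1 -> 0 < normc (model_d (z 0 i0)).
Proof. by move=> /dn_bounds[h _ _ _]; apply: lt_le_trans h; rewrite exprn_gt0. Qed.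

Lemma dn_neq0 z : en z <= 1 -> model_d (z 0 i0) != 0.
Proof. by move=> /dn_gt0 h; apply/eqP => E; rewrite E normc0 ltxx in h. Qed.

Lemma normc_cc x : normc (model_c x) = s / (3 * normc (model_d x)).
Proof. by rewrite /model_c normcM normcV normcM normcR normc_nat ger0_norm ?ltW. Qed.

Lemma normc_mm x : s ^+ 2 <= normc (model_d x) ->
  normc (model_m x) <= 4 * A * s ^+ 2 / normc (model_d x).
Proof.
move=> sq; have q0 : 0 < normc (model_d x) by apply: lt_le_trans sq; rewrite exprn_gt0.
have h : normc (model_d x - 3 * s%:C%C ^+ 2) <= 4 * normc (model_d x).
  apply: (le_trans (le_normcD _ _)); rewrite normcN normcM normc_nat.
  by rewrite -rmorphXn normcR ger0_norm ?sqr_ge0//; lra.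
rewrite /model_m normcM normcV normcM normcM -rmorphXn !normcR.
rewrite (ger0_norm A0) ger0_norm ?sqr_ge0// (expr2 (model_d x)) normcM.
rewrite ler_pdivrMr ?mulr_gt0//.
have -> : 4 * A * s ^+ 2 / normc (model_d x) * (normc (model_d x) * normc (model_d x)) =
  A * s ^+ 2 * (4 * normc (model_d x)) by field; rewrite gt_eqF.
rewrite rmorphXn; apply: ler_wpM2l => //; rewrite mulr_ge0 ?sqr_ge0//.
Qed.

Lemma cc_bounds z : en z <= 1 -> let c := normc (model_c (z 0 i0)) in
  [/\ c * normc (z 0 i1) <= 1 / 3, c * normc (z 0 i2) <= 1 / 3,
      c * normc (z 0 i1) * normc (z 0 i2) <= s / 3 &
      normc (model_m (z 0 i0)) * normc (z 0 i1) <= 4 * A * s].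
Proof.
move=> z1 c; have [h1 h2 h3 h4] := dn_bounds z1; have q0 := dn_gt0 z1.
have q30 : 0 < 3 * normc (model_d (z 0 i0)) by rewrite mulr_gt0.
rewrite /c normc_cc; split.
- by rewrite mulrAC ler_pdivrMr//; lra.
- by rewrite mulrAC ler_pdivrMr//; lra.
- rewrite -mulrA mulrAC ler_pdivrMr//.
  rewrite (_ : s / 3 * (3 * _) = s * normc (model_d (z 0 i0))); last by field.
  by rewrite ler_pM2l.
- apply: le_trans (ler_wpM2r (normc_ge0 _) (normc_mm h1)) _.
  rewrite mulrAC ler_pdivrMr// expr2.
  have -> : 4 * A * (s * s) * normc (z 0 i1) = 4 * A * s * (s * normc (z 0 i1)).
    by ring.
  by apply: ler_wpM2l => //; do ?apply: mulr_ge0 => //; exact: ltW.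
Qed.

Lemma model_close z : en z <= 1 -> en (model z - z) <= 6 * A * s.
Proof.
move=> z1; have [h1 h2 h3 h4] := cc_bounds z1.
apply: (le_trans (en_le_sum _)); rewrite !mxE /= -!/(model_c _) subrr normc0 add0r.
move: h1 h2 h3 h4; rewrite /=.
move: (model_c (z 0 i0)) (model_m (z 0 i0)) (z 0 i1) (z 0 i2) => c m u v h1 h2 h3 h4.
have -> : u * (1 - 2 * c * v - m * c * u) - u = - (2 * (c * u * v) + m * u * (c * u)).
  by ring.
have -> : v + m * u - v = m * u by ring.
have k1 : normc (2 * (c * u * v)) <= 2 * (s / 3).
  by rewrite normcM normc_nat !normcM ler_pM2l.
have k2 : normc (m * u * (c * u)) <= 4 * A * s * (1 / 3).
  by rewrite normcM (normcM m) (normcM c) ler_pM ?mulr_ge0 ?normc_ge0.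
have k3 : normc (m * u) <= 4 * A * s by rewrite normcM.
rewrite normcN; apply: le_trans (lerD (le_normcD _ _) k3) _.
have : 1 * s <= A * s by rewrite ler_pM2r.
by lra.
Qed.

(** Each of the two products has modulus at most 1/3, so their sum cannot be 1; this is the purpose
    of the 3 in [model_c]. *)
Lemma cc_small z w : en z <= 1 -> en w <= 1 -> z 0 i0 = w 0 i0 ->
  1 - model_c (z 0 i0) * z 0 i2 - model_c (z 0 i0) * w 0 i2 != 0.
Proof.
move=> z1 w1 zw; have [_ h1 _ _] := cc_bounds z1; have [_ h2 _ _] := cc_bounds w1.
apply/eqP => E; have : normc (model_c (z 0 i0) * z 0 i2 + model_c (z 0 i0) * w 0 i2) = 1.
  rewrite (_ : _ + _ = 1 - (1 - model_c (z 0 i0) * z 0 i2 - model_c (z 0 i0) * w 0 i2)).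
    by rewrite E subr0 normc1.
  by ring.
have := le_normcD (model_c (z 0 i0) * z 0 i2) (model_c (z 0 i0) * w 0 i2).
rewrite -zw in h2; move: h1 h2; move: (model_c _) => c h1 h2; rewrite !normcM; lra.
Qed.

(* The second coordinates of two points with equal first and third coordinates
   differ by [(u - u') * (1 - c * v - c * v')]. *)
Lemma model_inj z w : en z <= 1 -> en w <= 1 -> model z = model w -> z = w.
Proof.
move=> z1 w1 E.
have E0 : z 0 i0 = w 0 i0 by have := congr1 (fun u : V => u 0 i0) E; rewrite !vec3E.
have E1 := congr1 (fun u : V => u 0 i1) E.
have E2 := congr1 (fun u : V => u 0 i2) E.
rewrite /model !vec3E -E0 in E1 E2.
have N := cc_small z1 w1 E0.
move: E1 E2 N; set c := model_c _; set m := model_m _.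
rewrite [z]vec3P [w]vec3P -E0 !vec3E.
move: (z 0 i1) (z 0 i2) (w 0 i1) (w 0 i2) => u v u' v' E1 E2 N.
have vE : v' = v + m * u - m * u' by rewrite E2 addrK.
have : (u - u') * (1 - c * v - c * v') = 0.
  rewrite (_ : _ * _ = u * (1 - 2 * c * v - m * c * u) -
     u' * (1 - 2 * c * v' - m * c * u')); last by rewrite vE; ring.
  by rewrite E1 subrr.
move=> /eqP; rewrite mulf_eq0 (negPf N) orbF subr_eq0 => /eqP uu.
by rewrite vE uu addrK.
Qed.
End Model.

Section ModelProperties.
Variables (R : realType) (A s : R).
Hypotheses (A1 : 1 <= A) (s0 : 0 < s).
Local Notation C := R[i].
Local Notation V := 'rV[R[i]^o]_3.
Local Notation en := (@euclidean_norm R 3).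
Local Notation dn := (model_d s).
Local Notation cc := (model_c s).
Local Notation mm := (model_m A s).
Local Notation psi := (model A s).
Implicit Types (z w t : V).

Section DifferentiableRules.
Variable W : normedModType C.
Implicit Types (f g : W -> R[i]^o) (p : W).

Lemma differentiable_addr f g p : differentiable f p -> differentiable g p ->
  differentiable (fun x => f x + g x : R[i]^o) p.
Proof. exact: differentiableD. Qed.

Lemma differentiable_oppr f p : differentiable f p ->
  differentiable (fun x => - f x : R[i]^o) p.
Proof. exact: differentiableN. Qed.

Lemma differentiable_mulr f g p : differentiable f p -> differentiable g p ->
  differentiable (fun x => f x * g x : R[i]^o) p.
Proof. exact: differentiableM. Qed.

Lemma differentiable_invr f p : f p != 0 -> differentiable f p ->
  differentiable (fun x => (f x)^-1 : R[i]^o) p.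
Proof. by move=> *; exact: differentiableV. Qed.

Lemma differentiable_const (a : R[i]^o) p : differentiable (fun=> a) p.
Proof. exact: differentiable_cst. Qed.
Lemma differentiable_vec3 f g (h : W -> R[i]^o) p : differentiable f p ->
  differentiable g p -> differentiable h p ->
  differentiable (fun u : W => vec3 (f u) (g u) (h u)) p.
Proof.
move=> df dg dh; apply: differentiable_row; apply: ord3P.
- by under eq_fun do rewrite vec3E.
- by under eq_fun do rewrite vec3E.
- by under eq_fun do rewrite vec3E.
Qed.

End DifferentiableRules.

Ltac diff_rules := repeat first
  [ assumption
  | exact: differentiable_const
  | exact: differentiable_coord
  | apply: differentiable_addr
  | apply: differentiable_oppr
  | apply: differentiable_mulr ].

Lemma differentiable_dn z : differentiable (fun w : V => dn (w 0 i0) : R[i]^o) z.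
Proof. by rewrite /model_d; diff_rules. Qed.

Lemma differentiable_cc z : dn (z 0 i0) != 0 ->
  differentiable (fun w : V => cc (w 0 i0) : R[i]^o) z.
Proof.
move=> z0; have dz := differentiable_dn z.
rewrite /model_c; diff_rules; apply: differentiable_invr; last by diff_rules.
by rewrite mulf_neq0.
Qed.

Lemma differentiable_mm z : dn (z 0 i0) != 0 ->
  differentiable (fun w : V => mm (w 0 i0) : R[i]^o) z.
Proof.
move=> z0; have dz := differentiable_dn z.
rewrite /model_m expr2; diff_rules; apply: differentiable_invr; last by diff_rules.
by rewrite mulf_neq0.
Qed.

Lemma model_differentiable z : en z <= 1 -> differentiable psi z.
Proof.
move=> z1; have z0 := dn_neq0 s0 z1.
have dc := differentiable_cc z0; have dm := differentiable_mm z0.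
by rewrite /model/=; apply: differentiable_vec3; diff_rules.
Qed.

(** Solving the third coordinate for [z3] and substituting turns the second one into a quadratic
    equation for [u = z2]. *)
Lemma model_section t u : let c := cc (t 0 i0) in let m := mm (t 0 i0) in
  m * c * u ^+ 2 + (1 - 2 * c * t 0 i2) * u - t 0 i1 = 0 ->
  psi (vec3 (t 0 i0) u (t 0 i2 - m * u)) = t.
Proof.
move=> c m E; rewrite /model !vec3E -/c -/m [RHS]vec3P; congr vec3.
  apply/eqP; rewrite -subr_eq0 -E; apply/eqP; ring.
by rewrite subrK.
Qed.

Lemma model_locally_invertible z : en z <= 1 -> locally_invertible psi z.
Proof.
move=> z1; have z0 := dn_neq0 s0 z1.
set c := cc (z 0 i0); set m := mm (z 0 i0); set u := z 0 i1; set v := z 0 i2.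
have [zE0 zE1 zE2] : [/\ psi z 0 i0 = z 0 i0,
    psi z 0 i1 = u * (1 - 2 * c * v - m * c * u) & psi z 0 i2 = v + m * u].
  by rewrite /model !vec3E.
have t0 : dn (psi z 0 i0) != 0 by rewrite zE0.
have dc := differentiable_cc t0; have dm := differentiable_mm t0.
pose a t : R[i]^o := mm (t 0 i0) * cc (t 0 i0).
pose b t : R[i]^o := 1 - 2 * cc (t 0 i0) * t 0 i2 + 2 * mm (t 0 i0) * cc (t 0 i0) * u.
pose d t : R[i]^o := mm (t 0 i0) * cc (t 0 i0) * (u * u) +
  (1 - 2 * cc (t 0 i0) * t 0 i2) * u - t 0 i1.
have [|||||h [h0 dh hP]] := @implicit_root _ _ a b d (psi z).
- by rewrite /a; diff_rules.
- by rewrite /b; diff_rules.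
- by rewrite /d; diff_rules.
- by rewrite /d zE0 zE1 zE2 -/c -/m; ring.
- rewrite /b zE0 zE2 -/c -/m.
  have := cc_small A1 s0 z1 z1 erefl; rewrite -/c -/v.
  by congr (_ != 0); ring.
exists (fun t => vec3 (t 0 i0) (u + h t) (t 0 i2 - mm (t 0 i0) * (u + h t))).
split.
- by rewrite zE0 zE2 h0 addr0 -/m addrK [RHS]vec3P.
- by apply: differentiable_vec3; diff_rules.
- apply: filterS hP => t tP; apply: model_section; rewrite -[RHS]tP /a /b /d.
  by ring.
Qed.

Lemma quadratic_near (m c u v : C) (e : R) : e <= 1 / 8 -> normc u <= 1 ->
  normc v <= 1 -> normc c <= e -> normc m <= e ->
  exists2 h, m * c * (u + h) ^+ 2 + (1 - 2 * c * v) * (u + h) - u = 0 &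
    normc h <= 12 * e.
Proof.
move=> e8 u1 v1 ce me; have e0 : 0 <= e by apply: le_trans ce; exact: normc_ge0.
pose b := 1 + (2 * (m * c * u) - 2 * (c * v)).
pose d := m * c * (u * u) - 2 * (c * v * u).
have mc : normc (m * c) <= e * e by rewrite normcM ler_pM ?normc_ge0.
have ee : e * e <= e / 8 by rewrite ler_wpM2l// -[leRHS]mul1r.
have cv : normc (c * v) <= e by rewrite -[leRHS]mulr1 normcM ler_pM ?normc_ge0.
have mcu : normc (m * c * u) <= e * e.
  by rewrite normcM -[leRHS]mulr1 ler_pM ?normc_ge0.
have n2 (a : C) : normc (2 * a) = 2 * normc a by rewrite normcM normc_nat.
have b1 : normc (2 * (m * c * u) - 2 * (c * v)) <= 2 * (e * e) + 2 * e.
  by apply: (le_trans (le_normcD _ _)); rewrite normcN !n2 lerD// ler_pM2l.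
have b2 : 1 / 2 <= normc b.
  by apply: le_trans (normc_sub_ge _ _); rewrite normc1; lra.
have d1 : normc d <= e * e + 2 * e.
  apply: (le_trans (le_normcD _ _)); rewrite normcN n2 lerD//.
    by rewrite mulrA normcM -[leRHS]mulr1 ler_pM ?normc_ge0.
  by rewrite ler_pM2l// normcM -[leRHS]mulr1 ler_pM ?normc_ge0.
have bN : b != 0 by apply/eqP => E; move: b2; rewrite E normc0; lra.
have [h [hE hb]] := quadratic_root (m * c) d bN.
exists h; first by rewrite -hE /d /b; ring.
have : normc h * (1 / 2) <= 2 * normc d.
  by apply: le_trans hb; rewrite ler_wpM2l ?normc_ge0.
by lra.
Qed.

(** Away from [e_1] both [c] and [m] are small, and the quadratic equation of [model_section] has a
    root near [t 0 i1]. *)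
Lemma model_covers t (e : R) : e <= 1 / 8 -> en t <= 1 ->
  normc (cc (t 0 i0)) <= e -> normc (mm (t 0 i0)) <= e ->
  exists2 z, psi z = t & en (z - t) <= 15 * e.
Proof.
move=> e8 t1 ce me; have e0 : 0 <= e by apply: le_trans ce; exact: normc_ge0.
have u1 : normc (t 0 i1) <= 1 by apply: le_trans t1; exact: coord_le_en.
have v1 : normc (t 0 i2) <= 1 by apply: le_trans t1; exact: coord_le_en.
have [h hE h1] := quadratic_near e8 u1 v1 ce me.
exists (vec3 (t 0 i0) (t 0 i1 + h) (t 0 i2 - mm (t 0 i0) * (t 0 i1 + h))).
  exact: model_section.
apply: (le_trans (en_le_sum _)).
rewrite [(_ - t) 0 i0]mxE [(_ - t) 0 i1]mxE [(_ - t) 0 i2]mxE !vec3E.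
rewrite ![(- t) 0 _]mxE subrr normc0 add0r.
move: me u1 h1; move: (mm _) (t 0 i1) (t 0 i2) => m u v me u1 h1.
rewrite (_ : u + h - u = h); last by ring.
rewrite (_ : v - m * (u + h) - v = - (m * (u + h))); last by ring.
rewrite normcN normcM.
have : normc m * normc (u + h) <= e * (1 + 12 * e).
  by rewrite ler_pM ?normc_ge0// (le_trans (le_normcD _ _))// lerD.
have : e * (1 + 12 * e) = e + 12 * (e * e) by ring.
have : e * e <= e / 8 by rewrite ler_wpM2l// -[leRHS]mul1r.
by lra.
Qed.

Lemma model_lipschitz : exists2 L, 0 <= L & forall z w, en z <= 1 -> en w <= 1 ->
  en (psi z - psi w) <= L * en (z - w).
Proof.
have ld : lipb (fun z : V => dn (z 0 i0)).
  by apply: lipbD; [exact: lipb_cst|apply: lipbN; exact: lipb_coord].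
have s2 : 0 < s ^+ 2 by rewrite exprn_gt0.
have lc : lipb (fun z : V => cc (z 0 i0)).
  apply: lipbM; first exact: lipb_cst.
  apply: (lipbV s2); last by apply: lipbM => //; exact: lipb_cst.
  move=> z z1; rewrite normcM normc_nat; have [h _ _ _] := dn_bounds s0 z1.
  by have := normc_ge0 (dn (z 0 i0)); lra.
have lm : lipb (fun z : V => mm (z 0 i0)).
  apply: lipbM.
    apply: lipbM; first exact: lipb_cst.
    by apply: lipbD => //; exact: lipb_cst.
  apply: (lipbV (mulr_gt0 s2 s2)); last by rewrite /=; apply: lipbM.
  move=> z z1; rewrite expr2 normcM; have [h _ _ _] := dn_bounds s0 z1.
  by rewrite ler_pM// ltW.
have l1 : lipb (fun=> 1 : C) := lipb_cst _; have l2 : lipb (fun=> 2 : C) := lipb_cst _.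
apply: lipb_vec; apply: ord3P.
- by under eq_fun do rewrite vec3E; exact: lipb_coord.
- under eq_fun do rewrite vec3E.
  apply: lipbM; first exact: lipb_coord.
  apply: lipbD; first apply: lipbD => //.
    apply: lipbN; apply: lipbM; last exact: lipb_coord.
    by apply: lipbM => //; exact: lipb_cst.
  apply: lipbN; apply: lipbM; last exact: lipb_coord.
  exact: lipbM.
- under eq_fun do rewrite vec3E.
  by apply: lipbD; [exact: lipb_coord|apply: lipbM => //; exact: lipb_coord].
Qed.
End ModelProperties.

(** * One step of the construction *)

Section Rotation.
Local Open Scope sesquilinear_scope.
Variable R : realType.
Local Notation C := R[i].
Local Notation V := 'rV[R[i]^o]_3.
Local Notation en := (@euclidean_norm R 3).
Implicit Types (z w : V) (U : 'M[R[i]]_3).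

Definition rot U z : V := (z : 'rV[R[i]]_3) *m U.

Lemma en_sqr_mul z :
  ((en z) ^+ 2)%:C%C = ((z : 'rV[R[i]]_3) *m (z : 'rV[R[i]]_3)^t*) 0 0.
Proof.
rewrite en_sqr mxE sum3 !rmorphD/=.
have n2 (x : R[i]) : (normc x ^+ 2)%:C%C = x * (x^*)%C by rewrite rmorphXn/= -sqr_normc.
by rewrite !n2 !mxE.
Qed.

Lemma en_rot U z : U \is unitarymx -> en (rot U z) = en z.
Proof.
move=> /unitarymxP UU; apply/eqP; rewrite -(eqrXn2 (n := 2))// ?en_ge0//.
apply/eqP; apply: complexI; rewrite !en_sqr_mul /rot trmx_mul map_mxM/=.
by rewrite mulmxA -[(_ *m U) *m _]mulmxA UU mulmx1.
Qed.

Lemma rotK U U' z : U *m U' = 1%:M -> rot U' (rot U z) = z.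
Proof. by move=> UU; rewrite /rot -mulmxA UU mulmx1. Qed.

Lemma rotB U z w : rot U (z - w) = rot U z - rot U w.
Proof. exact: mulmxBl. Qed.

(** Gram-Schmidt applied to the matrix with all rows equal to [z] gives a unitary matrix whose first
    row is [z] up to a factor of modulus 1, which is then corrected. *)
Lemma unitary_of_unit_vector z : en z = 1 ->
  exists2 U, U \is unitarymx & rot U (vec3 1 0 0) = z.
Proof.
move=> z1; pose A : 'M[R[i]]_3 := \matrix_(i, j) z 0 j.
pose S := schmidt A; have SU : S \is unitarymx by exact: schmidt_unitarymx.
have rA : row i0 A = z :> 'rV[R[i]]_3 by apply/rowP => j; rewrite !mxE.
have [a aE] : exists a, z = a *: (row i0 S : V).
  have := row_schmidt_sub A i0; rewrite (big_pred1 i0); last first.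
    by move=> k /=; rewrite leqn0.
  by rewrite genmxE rA => /sub_rVP[a aE]; exists a.
have rS : rot S (vec3 1 0 0) = row i0 S :> V.
  apply/rowP => j; rewrite !mxE sum3 !vec3E.
  by rewrite mul1r !mul0r !addr0.
have aS : normc a = 1.
  by move: z1; rewrite aE enZ -rS en_rot// en_e1 mulr1.
exists (a *: S).
  apply/unitarymxP; rewrite linearZ/= map_mxZ/= -scalemxAl -scalemxAr.
  rewrite (unitarymxP SU) scalerA (_ : a * _ = 1) ?scale1r//.
  change (a * (a^*)%C = 1); rewrite -sqr_normc.
  by change ((normc a)%:C%C ^+ 2 = 1); rewrite aS expr1n.
rewrite /rot -scalemxAr; change (a *: rot S (vec3 1 0 0) = z).
by rewrite rS -aE.
Qed.

Lemma differentiable_rot U z : differentiable (rot U) z.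
Proof.
apply: differentiable_row => i; rewrite /rot.
under eq_fun do rewrite mxE sum3.
have dm j : differentiable (fun w : V => (w : 'rV[R[i]]_3) 0 j * U j i : R[i]^o) z.
  apply: differentiable_mulr; first exact: differentiable_coord.
  exact: differentiable_const.
by apply: differentiable_addr; first apply: differentiable_addr.
Qed.

Lemma differentiable_scale (a : C) z : differentiable (fun w : V => a *: w) z.
Proof.
apply: differentiable_row => i; under eq_fun do rewrite mxE.
by apply: differentiable_mulr; [exact: differentiable_const|exact: differentiable_coord].
Qed.

Lemma rot_locally_invertible U U' z : U *m U' = 1%:M -> U' *m U = 1%:M ->
  locally_invertible (rot U) z.
Proof.
move=> h h'; exists (rot U'); split; first exact: rotK.
  exact: differentiable_rot.
by apply/nbhs_en; exists 1 => // w _; exact: rotK.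
Qed.

Lemma scale_locally_invertible (a : C) z : a != 0 ->
  locally_invertible (fun w : V => a *: w) z.
Proof.
move=> a0; exists (fun w => a^-1 *: w); split.
- by rewrite scalerA mulVf// scale1r.
- exact: differentiable_scale.
- by apply/nbhs_en; exists 1 => // w _; rewrite scalerA mulfV// scale1r.
Qed.
End Rotation.

Section Witness.
Variables (R : realType) (A s : R).
Hypotheses (Abig : 6 * (9 / 2) ^+ 3 <= A) (s0 : 0 < s) (s1 : s <= 1 / 10).
Local Notation C := R[i].
Local Notation V := 'rV[R[i]^o]_3.
Local Notation en := (@euclidean_norm R 3).
Local Notation S := (s%:C%C : C).
Implicit Types (z w : V) (x : C).

Lemma witness_A1 : 1 <= A.
Proof. by apply: le_trans Abig; rewrite !exprS expr0; lra. Qed.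
Let A1 := witness_A1.
Let A0 : 0 < A. Proof. exact: lt_le_trans A1. Qed.

(* The loop is the curve [z3 = 0], [model_m z1 * model_c z1 * z2 = 1] over circles
   around the zero of [model_m], with [z1 = 1 - s ^+ 2 * (2 + x)]. *)
Definition loop x : V :=
  vec3 (1 - S ^+ 2 * (2 + x)) (3 * S * (3 + x) ^+ 3 / (A%:C%C * x)) 0.
(** The third coordinate is [1 / model_c z1]. In contrast to [loop], nothing is singular at
    [x = 0]. *)
Definition disc x : V := vec3 (1 - S ^+ 2 * (2 + x)) 0 (3 * S * (3 + x)).

Lemma Sneq0 : S != 0.
Proof. by rewrite (_ : 0 = 0%:C%C)// (inj_eq (@complexI R)) gt_eqF. Qed.

Lemma Aneq0 : A%:C%C != 0 :> C.
Proof. by rewrite (_ : 0 = 0%:C%C)// (inj_eq (@complexI R)) gt_eqF. Qed.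

Lemma normc_shift x : normc x <= 3 / 2 -> 3 / 2 <= normc (3 + x) <= 9 / 2.
Proof.
move=> x3; apply/andP; split.
  by apply: le_trans (normc_sub_ge _ _); rewrite normc_nat; lra.
by apply: (le_trans (le_normcD _ _)); rewrite normc_nat; lra.
Qed.

Lemma shift_neq0 x : normc x <= 3 / 2 -> 3 + x != 0.
Proof.
move=> /normc_shift/andP[h _]; apply/eqP => E; move: h; rewrite E normc0; lra.
Qed.

Lemma model_loop x : x != 0 -> normc x <= 3 / 2 -> model A s (loop x) = disc x.
Proof.
move=> x0 x3; have y0 := shift_neq0 x3; have S0 := Sneq0; have AN := Aneq0.
have dnE : model_d s (1 - S ^+ 2 * (2 + x)) = S ^+ 2 * (3 + x).
  by rewrite /model_d rmorphD rmorph1 rmorphXn/=; ring.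
rewrite /model /loop !vec3E /model_c /model_m dnE /disc; congr vec3; field.
  by rewrite S0 y0 AN x0.
by rewrite S0 y0 AN x0.
Qed.

Lemma disc_close x : normc x <= 3 / 2 -> en (disc x - vec3 1 0 0) <= 17 * s.
Proof.
move=> x3; have /andP[_ h] := normc_shift x3.
have nS : normc S = s by rewrite normcR ger0_norm ?ltW.
apply: (le_trans (en_le_sum _)).
rewrite ![(disc x - _) 0 _]mxE ![(- vec3 _ _ _) 0 _]mxE !vec3E !subr0 normc0 addr0.
rewrite (_ : 1 - S ^+ 2 * (2 + x) - 1 = - (S ^+ 2 * (2 + x))); last by ring.
rewrite normcN normcM expr2 normcM nS normcM normcM nS normc_nat.
have h2 : normc (2 + x) <= 7 / 2.
  by apply: (le_trans (le_normcD _ _)); rewrite normc_nat; lra.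
have : s * s * normc (2 + x) <= s * (1 / 10) * (7 / 2).
  by rewrite ler_pM ?mulr_ge0 ?normc_ge0 ?(ltW s0)// ler_pM2l.
have : 3 * s * normc (3 + x) <= 3 * s * (9 / 2).
  by rewrite ler_wpM2l// mulr_ge0 ?(ltW s0).
move: (normc (3 + x)) (normc (2 + x)) => b c h3 h4.
have : 3 * s * (9 / 2) = 27 / 2 * s by field.
have : s * (1 / 10) * (7 / 2) = 7 / 20 * s by field.
by move: s0 h3 h4; clear => *; lra.
Qed.

(** As [2 + x] has real part at least 1/2, the first coordinate loses about [s ^+ 2] in squared
    modulus; this outweighs the square of the second coordinate and the terms of order [s ^+ 4]. *)
Lemma loop_inside x : 1 <= normc x <= 3 / 2 -> en (loop x) <= 1 - s ^+ 2 / 4.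
Proof.
move=> /andP[x1 x3]; have /andP[h h'] := normc_shift x3.
have nS : normc S = s by rewrite normcR ger0_norm ?ltW.
have nA : normc (A%:C%C : C) = A by rewrite normcR ger0_norm ?ltW.
have s2 : s ^+ 2 <= 1 / 100.
  have -> : 1 / 100 = (1 / 10) ^+ 2 :> R by field.
  by rewrite lerXn2r// nnegrE ltW.
have s20 : 0 < s ^+ 2 by rewrite exprn_gt0.
have k0 : 0 <= 1 - s ^+ 2 / 4 by lra.
rewrite -(ler_pXn2r (n := 2))// ?nnegrE ?en_ge0// en_sqr !vec3E normc0 expr0n addr0.
(* This is where the lower bound on [A] comes from, [normc (3 + x)] being at most 9/2. *)
have b1 : normc (3 * S * (3 + x) ^+ 3 / (A%:C%C * x)) <= s / 2.
  rewrite normcM normcV (normcM A%:C%C) (normcM (3 * S)) (normcM 3) nA normc_nat nS.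
  have -> : normc ((3 + x) ^+ 3) = normc (3 + x) ^+ 3.
    by rewrite !exprS !expr0 !normcM normc1.
  rewrite ler_pdivrMr ?mulr_gt0 ?(lt_le_trans _ x1)//.
  apply: (@le_trans _ _ (3 * s * (9 / 2) ^+ 3)).
    by rewrite ler_wpM2l ?mulr_ge0 ?(ltW s0)// lerXn2r// nnegrE ?normc_ge0.
  apply: (@le_trans _ _ (s / 2 * (A * 1))); last first.
    by rewrite ler_wpM2l ?divr_ge0 ?(ltW s0)// ler_wpM2l ?(ltW A0).
  rewrite mulr1 (_ : 3 * s * (9 / 2) ^+ 3 = s / 2 * (6 * (9 / 2) ^+ 3)); last by field.
  by rewrite ler_wpM2l// divr_ge0// ltW.
have b2 : normc (3 * S * (3 + x) ^+ 3 / (A%:C%C * x)) ^+ 2 <= s ^+ 2 / 4.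
  rewrite (_ : s ^+ 2 / 4 = (s / 2) ^+ 2); last by field.
  by rewrite lerXn2r// nnegrE ?normc_ge0// divr_ge0// ltW.
have b3 : normc (1 - S ^+ 2 * (2 + x)) ^+ 2 <= 1 - s ^+ 2 + 49 / 4 * (s ^+ 2 * s ^+ 2).
  have h2 : normc (2 + x) ^+ 2 <= 49 / 4.
    have h2 : normc (2 + x) <= 7 / 2.
      by apply: (le_trans (le_normcD _ _)); rewrite normc_nat; lra.
    rewrite (_ : 49 / 4 = (7 / 2) ^+ 2); last by field.
    by rewrite lerXn2r ?nnegrE ?normc_ge0.
  have h3 : 1 / 2 <= complex.Re (2 + x).
    have := normc_Re x; rewrite Re_add ler_norml => /andP[hx _].
    by rewrite -(rmorph_nat (real_complex R))/=; lra.
  move: h2 h3; move: (2 + x) => y h2 h3.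
  have e4 : 0 <= s ^+ 2 * s ^+ 2 by rewrite mulr_ge0 ?sqr_ge0.
  have -> : normc (1 - S ^+ 2 * y) ^+ 2 = 1 - 2 * s ^+ 2 * complex.Re y +
     s ^+ 2 * s ^+ 2 * normc y ^+ 2.
    by rewrite -rmorphXn !normc_sqr Re_sub Im_sub; clear; case: y => a b /=; ring.
  have := ler_wpM2l e4 h2; have := ler_wpM2l (ltW s20) h3; lra.
have b4 : s ^+ 2 * s ^+ 2 <= s ^+ 2 * (1 / 100) by rewrite ler_pM2l.
have -> : (1 - s ^+ 2 / 4) ^+ 2 = 1 - s ^+ 2 / 2 + s ^+ 2 * s ^+ 2 / 16 by field.
have : 0 <= s ^+ 2 * s ^+ 2 by rewrite mulr_ge0 ?sqr_ge0.
by move: b2 b3 b4; set N := normc _ ^+ 2; set M := normc _ ^+ 2; lra.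
Qed.
End Witness.

Section Step.
Local Open Scope sesquilinear_scope.
Variable R : realType.
Local Notation C := R[i].
Local Notation V := 'rV[R[i]^o]_3.
Local Notation en := (@euclidean_norm R 3).
Implicit Types (z w q : V) (T : V -> V).

(** Sending the closed ball into the open one keeps all finite compositions defined up to the
    boundary, and puts the limit map into the open ball. *)
Definition nice T := [/\ forall z, en z <= 1 -> en (T z) < 1,
  forall z w, en z <= 1 -> en w <= 1 -> T z = T w -> z = w,
  forall z, en z <= 1 -> differentiable T z,
  forall z, en z <= 1 -> locally_invertible T z &
  exists2 L, 0 <= L & forall z w, en z <= 1 -> en w <= 1 ->
    en (T z - T w) <= L * en (z - w)].

(* An analytic disc near [q], the image under [T] of the loop [g] on an annulus,
   along which the linear function [l] continues to a function with a pole. *)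
Definition disc_witness T q (del kap : R) (D g : R[i]^o -> V) (l : V -> R[i]^o)
    (p : R[i]^o -> R[i]^o) := [/\
  forall x : R[i]^o, normc x <= 3 / 2 ->
    [/\ en (D x) < 1, en (D x - q) <= del & differentiable D x],
  forall x, 1 <= normc x <= 3 / 2 ->
    [/\ en (g x) <= 1 - kap, T (g x) = D x & x * l (g x) = p x],
  forall z w, normc (l z - l w) <= en (z - w),
  forall z, differentiable l z &
  (forall x, differentiable p x) /\ p 0 != 0].

Lemma step_exists q (del tau : R) : en q = 1 -> 0 < del -> 0 < tau -> tau <= 1 ->
  exists T, [/\ nice T, forall z, en z <= 1 -> en (T z - z) <= del,
    forall w, en w <= 1 - tau -> exists2 z, en z <= 1 & T z = w &
    exists kap D g l p, 0 < kap /\ disc_witness T q del kap D g l p].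
Proof.
move=> q1 del0 tau0 tau1.
have [U /[dup] UU /unitarymxP UV qE] := unitary_of_unit_vector q1.
pose U' := U^t*; have UU' : U' \is unitarymx by rewrite trmxC_unitary.
have VU : U' *m U = 1%:M by apply: mulmx1C.
pose A : R := 6 * (9 / 2) ^+ 3.
have Abig : 6 * (9 / 2) ^+ 3 <= A by [].
have A1 : 1 <= A := witness_A1 Abig.
have A0 : 0 < A by exact: lt_le_trans A1.
(* The displacement of [T] is at most [6 A s + 30 A s] and the disc lies within [17 s + 30 A s] of
   [q]: both are below [50 A s]. The last bound is what the covering property requires. *)
pose s := Num.min (1 / 10) (Num.min (del / (50 * A)) (tau * tau / (240 * A))).
have s0 : 0 < s by rewrite !lt_min !divr_gt0 ?mulr_gt0.
have s1 : s <= 1 / 10 by rewrite /s !ge_min lexx.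
have sdel : 50 * (A * s) <= del.
  have : s <= del / (50 * A) by rewrite /s !ge_min lexx orbT.
  by rewrite ler_pdivlMr ?mulr_gt0//; lra.
have stau : 240 * (A * s) <= tau * tau.
  have : s <= tau * tau / (240 * A) by rewrite /s !ge_min lexx !orbT.
  by rewrite ler_pdivlMr ?mulr_gt0//; lra.
clearbody s A.
have sA : s <= A * s by rewrite ler_peMl// ltW.
(* The contraction must beat the radii [1 + 6 A s] of the image of the ball and [1 + 17 s] of the
   disc. *)
pose a : R := (1 + 30 * (A * s))^-1.
have As0 : 0 < A * s by rewrite mulr_gt0.
have a0 : 0 < a by rewrite invr_gt0; lra.
have aE : a * (1 + 30 * (A * s)) = 1 by rewrite /a mulVf// gt_eqF//; lra.
have a1 : a <= 1 by rewrite /a invf_le1; lra.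
have a2 : 1 - a <= 30 * (A * s).
  have : a * (30 * (A * s)) <= 30 * (A * s) by rewrite ler_piMl//; lra.
  by lra.
have aV : a^-1 = 1 + 30 * (A * s) by rewrite /a invrK.
clearbody a.
have na : normc (a%:C%C : C) = a by rewrite normcR ger0_norm ?ltW.
have aN : a%:C%C != 0 :> C.
  by rewrite (_ : 0 = 0%:C%C)// (inj_eq (@complexI R)) gt_eqF.
have lt1 (r : R) : r <= 1 + 20 * (A * s) -> a * r < 1.
  move=> r1; rewrite -aE ltr_pM2l//; lra.
pose T z := rot U (a%:C%C *: model A s (rot U' z)).
have e' z : en (rot U' z) = en z by exact: en_rot.
have e z : en (rot U z) = en z by exact: en_rot.
have UK z : rot U' (rot U z) = z by exact: rotK.
have U'K z : rot U (rot U' z) = z by exact: rotK.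
have shrink z w : en (a%:C%C *: z - w) <= en (z - w) + 30 * (A * s) * en w.
  have -> : a%:C%C *: z - w = a%:C%C *: (z - w) + (a - 1)%:C%C *: w.
    by rewrite rmorphB rmorph1 scalerBr scalerBl scale1r addrA subrK.
  apply: (le_trans (enD _ _)); rewrite !enZ na normcR distrC ger0_norm ?subr_ge0//.
  by rewrite lerD// ?ler_wpM2r ?en_ge0// ler_piMl ?en_ge0.
exists T; split.
- split.
  + move=> z z1; rewrite /T e enZ na; apply: lt1.
    have m := model_close A1 s0 (_ : en (rot U' z) <= 1).
    rewrite -[model A s _](subrK (rot U' z)); apply: (le_trans (enD _ _)).
    by have := m; rewrite e' => /(_ z1); lra.
  + move=> z w z1 w1 /(congr1 (rot U')); rewrite !UK => /(scalerI aN).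
    by move=> /(model_inj A1 s0); rewrite !e' => /(_ z1 w1) /(congr1 (rot U)); rewrite !U'K.
  + move=> z z1; apply: (@differentiable_comp _ _ _ _
      (fun z => a%:C%C *: model A s (rot U' z)) (rot U)); last exact: differentiable_rot.
    apply: (@differentiable_comp _ _ _ _ (fun z => model A s (rot U' z)) (fun w => a%:C%C *: w));
      last exact: differentiable_scale.
    apply: (@differentiable_comp _ _ _ _ (rot U') (model A s)); first exact: differentiable_rot.
    by apply: model_differentiable => //; rewrite e'.
  + move=> z z1; apply: (@locally_invertible_comp _ (rot U)
      (fun z => a%:C%C *: model A s (rot U' z))); first exact: rot_locally_invertible UV VU.
    apply: (@locally_invertible_comp _ (fun w => a%:C%C *: w) (fun z => model A s (rot U' z))).
      exact: scale_locally_invertible.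
    apply: (@locally_invertible_comp _ (model A s) (rot U'));
      last exact: rot_locally_invertible VU UV.
    by apply: (model_locally_invertible A1) => //; rewrite e'.
  + have [L L0 LP] := model_lipschitz A s0; exists L => // z w z1 w1.
    rewrite /T -rotB e -scalerBr enZ na.
    have := LP (rot U' z) (rot U' w); rewrite -rotB !e' => /(_ z1 w1) h.
    by apply: le_trans h; rewrite ler_piMl ?en_ge0.
- move=> z z1; rewrite -[X in T z - X]U'K /T -rotB e.
  have m := model_close A1 s0 (_ : en (rot U' z) <= 1).
  apply: (le_trans (shrink _ _)); rewrite e'.
  have := m; rewrite e' => /(_ z1).
  have : 30 * (A * s) * en z <= 30 * (A * s) * 1 by rewrite ler_wpM2l//; lra.
  by lra.
(* [t] keeps distance [tau / 2] to the sphere, so [model_d] has modulus at least [tau / 2] and [c]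
   and [m] are at most [8 A s / tau], hence at most [tau / 30]. The preimage given by [model_covers]
   is then within [tau / 2] of [t]. *)
- move=> w w1; pose t := a^-1%:C%C *: rot U' w.
  have at' : a%:C%C *: t = rot U' w.
    by rewrite /t scalerA -rmorphM mulfV ?gt_eqF// rmorph1 scale1r.
  have tt : tau * tau <= tau by rewrite ler_piMl// ltW.
  have t1 : en t <= 1 - tau / 2.
    rewrite /t enZ normcR ger0_norm ?invr_ge0 ?(ltW a0)// e' aV.
    apply: (@le_trans _ _ ((1 + 30 * (A * s)) * (1 - tau))).
      by rewrite ler_wpM2l//; lra.
    have : 0 <= 30 * (A * s) * tau by rewrite !mulr_ge0 ?ltW.
    by lra.
  have x1 : normc (t 0 i0) <= 1 - tau / 2 by apply: le_trans t1; exact: coord_le_en.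
  have s2 : 0 <= s ^+ 2 by exact: sqr_ge0.
  have dq : tau / 2 <= normc (model_d s (t 0 i0)).
    rewrite /model_d; apply: le_trans (normc_sub_ge _ _); rewrite normcN normcR.
    by rewrite ger0_norm ?addr_ge0//; lra.
  have ss : s ^+ 2 <= s / 10.
    by rewrite expr2 ler_pM2l//; lra.
  have sd : s ^+ 2 <= normc (model_d s (t 0 i0)) by lra.
  have d0 : 0 < normc (model_d s (t 0 i0)) by apply: lt_le_trans dq; rewrite divr_gt0.
  have id : (normc (model_d s (t 0 i0)))^-1 <= 2 / tau.
    by rewrite (_ : 2 / tau = (tau / 2)^-1) ?lef_pV2 ?posrE ?divr_gt0// invfM invrK mulrC.
  pose f := 8 * (A * s) / tau.
  have f0 : 0 <= f by rewrite divr_ge0 ?mulr_ge0 ?ltW.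
  have f1 : f <= tau / 30.
    by rewrite /f ler_pdivrMr//; lra.
  have cf : normc (model_c s (t 0 i0)) <= f.
    rewrite normc_cc// invfM mulrA; apply: (@le_trans _ _ (s / 3 * (2 / tau))).
      by rewrite ler_wpM2l// divr_ge0// ltW.
    rewrite /f (_ : s / 3 * (2 / tau) = 2 / 3 * s / tau); last first.
      by field; rewrite gt_eqF.
    by rewrite ler_pM2r ?invr_gt0//; lra.
  have mf : normc (model_m A s (t 0 i0)) <= f.
    apply: (le_trans (normc_mm A1 s0 sd)).
    apply: (@le_trans _ _ (4 * A * s ^+ 2 * (2 / tau))).
      by rewrite ler_wpM2l// !mulr_ge0 ?ltW.
    rewrite /f (_ : 4 * A * s ^+ 2 * (2 / tau) = 8 * (A * s * s) / tau); last first.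
      by field; rewrite gt_eqF.
    rewrite ler_pM2r ?invr_gt0//.
    have : A * s * s <= A * s * 1 by rewrite ler_pM2l//; lra.
    by lra.
  have [||z zt zc] := @model_covers _ A s t f _ _ cf mf; [lra|lra|].
  exists (rot U z).
    rewrite e -[z](subrK t); apply: (le_trans (enD _ _)); lra.
  by rewrite /T UK zt at' U'K.
- have cst (b : V) x : differentiable (fun _ : R[i]^o => b) x by exact: differentiable_cst.
  exists (s ^+ 2 / 4), (fun x => rot U (a%:C%C *: disc s x)),
    (fun x => rot U (loop A s x)), (fun z => rot U' z 0 i1 : R[i]^o),
    (fun x => 3 * s%:C%C * ((3 + x) * ((3 + x) * (3 + x))) / A%:C%C).
  split; first by rewrite divr_gt0// exprn_gt0.
  split.
  + move=> x x3; have dc := disc_close s0 s1 x3.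
    have e1 : en (vec3 1 0 0 : V) = 1 by rewrite -q1 -qE e.
    split.
    * rewrite e enZ na; apply: lt1.
      rewrite -[disc s x](subrK (vec3 1 0 0)); apply: (le_trans (enD _ _)).
      by rewrite e1; lra.
    * rewrite -qE -rotB e; apply: (le_trans (shrink _ _)).
      by rewrite e1 mulr1; lra.
    * apply: (@differentiable_comp _ _ _ _
        (fun x : R[i]^o => a%:C%C *: disc s x) (rot U)); last exact: differentiable_rot.
      apply: (@differentiable_comp _ _ _ _ (disc s : R[i]^o -> V)
        (fun w => a%:C%C *: w)); last exact: differentiable_scale.
      have did : differentiable (fun x : R[i]^o => x) x by [].
      apply: differentiable_vec3; repeat first [exact: did|exact: differentiable_const|
        apply: differentiable_addr|apply: differentiable_oppr|apply: differentiable_mulr].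
  + move=> x /[dup] /andP[x1 x3] x13.
    have x0 : x != 0 by apply/eqP => E; move: x1; rewrite E normc0; lra.
    split.
    * by rewrite e; exact: loop_inside.
    * by rewrite /T UK (model_loop _ s0).
    * rewrite UK vec3E !exprS expr0 mulr1; field.
      by rewrite x0 Aneq0.
  + move=> z w; have := coord_le_en (rot U' z - rot U' w) i1.
    by rewrite -rotB e' rotB !mxE.
  + by move=> z; exact: (@differentiable_rowP _ (rot U') z i1 (differentiable_rot _ _)).
  + split.
      move=> x; have did : differentiable (fun x : R[i]^o => x) x by [].
      by repeat first [exact: did|exact: differentiable_const|
        apply: differentiable_addr|apply: differentiable_oppr|apply: differentiable_mulr].
    have n0 n : (n.+1)%:R != 0 :> C by rewrite pnatr_eq0.
    rewrite addr0; do ?[exact: (n0 2%N)|exact: Sneq0|exact: Aneq0|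
      apply: mulf_neq0|apply: invr_neq0].
Qed.
End Step.

(** * Infinite compositions *)

Section Limits.
Variable R : realType.
Local Notation V := 'rV[R[i]^o]_3.
Local Notation en := (@euclidean_norm R 3).

Lemma en_limit_le (u : nat -> V) (e : nat -> R) (c w : V) (r : R) :
  (forall d, 0 < d -> exists N, forall n, (N <= n)%N -> e n <= d) ->
  (forall n, en (c - u n) <= e n) -> (exists N, forall n, (N <= n)%N -> en (u n - w) <= r) ->
  en (c - w) <= r.
Proof.
move=> e0 ce [N uN]; apply/ler_addgt0Pr => d /e0[N' eN'].
have := uN _ (leq_maxl N N'); have := eN' _ (leq_maxr N N').
set n := maxn N N' => h1 h2; apply: (le_trans (en_tri (u n) _ _)).
by rewrite addrC lerD// (le_trans (ce n)).
Qed.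

Lemma en_complete (u : nat -> V) (e : nat -> R) :
  (forall d, 0 < d -> exists N, forall n, (N <= n)%N -> e n <= d) ->
  (forall n m, (n <= m)%N -> en (u m - u n) <= e n) ->
  exists c, forall n, en (c - u n) <= e n.
Proof.
move=> e0 ue.
have /choice[f fP] : forall i : 'I_3, exists c : R[i], forall d, 0 < d ->
    exists N, forall k, (N <= k)%N -> normc (u k 0 i - c) <= d.
  move=> i; apply: complex_cauchy => d /e0[N eN]; exists N => k Nk.
  apply: le_trans (eN N (leqnn N)); apply: le_trans (ue _ _ Nk).
  by have := coord_le_en (u k - u N) i; rewrite !mxE.
exists (\row_i f i) => n; apply/ler_addgt0Pr => d d0.
have d3 : 0 < d / 3 by rewrite divr_gt0.
have [N0 h0] := fP i0 _ d3; have [N1 h1] := fP i1 _ d3; have [N2 h2] := fP i2 _ d3.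
pose k := maxn n (maxn N0 (maxn N1 N2)).
have [nk k0 k1 k2] : [/\ (n <= k)%N, (N0 <= k)%N, (N1 <= k)%N & (N2 <= k)%N].
  by rewrite /k !leq_max !leqnn !orbT.
apply: (le_trans (en_tri (u k) _ _)); rewrite addrC lerD ?ue//.
rewrite enB; apply: (le_trans (en_le_sum _)).
have -> : d = d / 3 + d / 3 + d / 3 by field.
by rewrite !lerD// !mxE; [exact: h0|exact: h1|exact: h2].
Qed.
End Limits.

Section Composition.
Variable R : realType.
Local Notation V := 'rV[R[i]^o]_3.
Local Notation en := (@euclidean_norm R 3).
Implicit Types (z w x : V).

(* [Lam k] is a Lipschitz constant of all compositions [T j \o ... \o T k.-1], and
   [tau k] is the perturbation that the steps before [k] tolerate. *)
Definition nice_sequence (T : nat -> V -> V) (tau Lam : nat -> R)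
    (q : nat -> V) := forall k,
  [/\ [/\ 0 < tau k, tau k <= 1, tau k.+1 <= tau k / 2, 1 <= Lam k &
        Lam k <= Lam k.+1],
    nice (T k) /\ (forall z w, en z <= 1 -> en w <= 1 ->
       Lam k * en (T k z - T k w) <= Lam k.+1 * en (z - w)),
    forall z, en z <= 1 -> en (T k z - z) <= tau k / (2 * Lam k),
    forall w, en w <= 1 - tau k -> exists2 z, en z <= 1 & T k z = w &
    exists D g l p, disc_witness (T k) (q k) (tau k) (2 * tau k.+1) D g l p /\
      12 * tau k.+1 <= normc (p 0)].

(** The recursion carries the pair of [tau k] and [Lam k]: these determine [T k], and only then are
    the next tolerance and Lipschitz constant chosen. *)
Lemma nice_sequence_exists (q : nat -> V) (e : R) : (forall k, en (q k) = 1) ->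
  0 < e -> e <= 1 -> exists T tau Lam, nice_sequence T tau Lam q /\ tau 0%N = e.
Proof.
move=> q1 e0 e1.
have step (kst : nat * (R * R)) : exists o : (V -> V) * (R * R),
    let: (k, (t, L)) := kst in let: (T, (t', L')) := o in
    0 < t -> t <= 1 -> 1 <= L -> [/\ [/\ 0 < t', t' <= t / 2, 1 <= L' & L <= L'],
      nice T /\ (forall z w, en z <= 1 -> en w <= 1 ->
        L * en (T z - T w) <= L' * en (z - w)),
    forall z, en z <= 1 -> en (T z - z) <= t / (2 * L),
    forall w, en w <= 1 - t -> exists2 z, en z <= 1 & T z = w &
    exists D g l p, disc_witness T (q k) t (2 * t') D g l p /\
      12 * t' <= normc (p 0)].
  move: kst => [k [t L]].
  (* The choice function must be total, so inadmissible states get a dummy answer. *)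
  have [t0|nt0] := pselect (0 < t); last by exists (id, (0, 0)).
  have [t1|nt1] := pselect (t <= 1); last by exists (id, (0, 0)).
  have [L1|nL1] := pselect (1 <= L); last by exists (id, (0, 0)).
  have L0 : 0 < L by exact: lt_le_trans L1.
  have d0 : 0 < t / (2 * L) by rewrite divr_gt0// mulr_gt0.
  have [T [Tn Tc Tcov [kap [D [g [l [p [kap0 W]]]]]]]] := step_exists (q1 k) d0 t0 t1.
  have [_ _ _ _ [M M0 TM]] := Tn.
  have p0 : 0 < normc (p 0) by case: W => _ _ _ _ [_ ?]; exact: normc_gt0.
  (* The three entries give geometric decay, a loop in the part of the ball that the later maps
     cover, and an error small against the residue [p 0]. *)
  pose t' := Num.min (t / 2) (Num.min (kap / 2) (normc (p 0) / 12)).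
  have t'0 : 0 < t' by rewrite !lt_min !divr_gt0.
  have ht1 : t' <= t / 2 by rewrite /t' ge_min lexx.
  have ht2 : t' <= kap / 2 by rewrite /t' !ge_min lexx orbT.
  have ht3 : t' <= normc (p 0) / 12 by rewrite /t' !ge_min lexx !orbT.
  have LM : L <= L * (1 + M) by rewrite ler_peMr ?(ltW L0)// lerDl.
  exists (T, (t', L * (1 + M))) => _ _ _; split => //.
  - by split => //; exact: le_trans LM.
  - split => // z w z1 w1; rewrite -mulrA ler_pM2l//.
    apply: (le_trans (TM _ _ z1 w1)).
    by rewrite ler_wpM2r ?en_ge0// lerDr.
  - exists D, g, l, p; split; last by lra.
    case: W => W1 W2 W3 W4 W5; split => //.
      move=> x x3; have [W6 W7 W8] := W1 x x3; split => //.
      apply: (le_trans W7); rewrite ler_pdivrMr ?mulr_gt0//.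
      have : t * 1 <= t * L by rewrite ler_pM2l.
      by have := ltW t0; lra.
    move=> x x3; have [W6 W7 W8] := W2 x x3; split => //.
    by apply: (le_trans W6); lra.
have [nx nxP] := choice step.
pose st := fix st n : R * R := if n is m.+1 then (nx (m, st m)).2 else (e, 1).
pose T n := (nx (n, st n)).1.
have stP n : [/\ 0 < (st n).1, (st n).1 <= 1 & 1 <= (st n).2].
  elim: n => [|n [h1 h2 h3]]; first by split.
  have := nxP (n, st n) => /=; move: h1 h2 h3; case: (st n) => t L /=.
  case: (nx _) => T' [t' L'] /= h1 h2 h3 /(_ h1 h2 h3)[[h4 h5 h6 _] _ _ _ _].
  by split => //; lra.
exists T, (fun n => (st n).1), (fun n => (st n).2); split => // k.
have [h1 h2 h3] := stP k.
have := nxP (k, st k); rewrite /T /=; move: h1 h2 h3; case: (st k) => t L /=.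
case: (nx _) => T' [t' L'] /= h1 h2 h3 /(_ h1 h2 h3)[[h4 h5 h6 h7] h8 h9 h10 h11].
by split.
Qed.

Variables (T : nat -> V -> V) (tau Lam : nat -> R) (q : nat -> V).
Hypothesis H : nice_sequence T tau Lam q.

Let tau0 k : 0 < tau k. Proof. by have [[]] := H k. Qed.
Let tauS k : tau k.+1 <= tau k / 2. Proof. by have [[]] := H k. Qed.
Let Lam1 k : 1 <= Lam k. Proof. by have [[]] := H k. Qed.
Let LamS k : Lam k <= Lam k.+1. Proof. by have [[]] := H k. Qed.
Let Lam0 k : 0 < Lam k. Proof. exact: lt_le_trans (Lam1 k). Qed.
Let Tnice k : nice (T k). Proof. by have [_ []] := H k. Qed.

Lemma Lam_mono n m : (n <= m)%N -> Lam n <= Lam m.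
Proof.
elim: m => [|m IH]; first by rewrite leqn0 => /eqP->.
rewrite leq_eqVlt => /predU1P[->//|]; rewrite ltnS => /IH h.
exact: le_trans h (LamS m).
Qed.

Lemma tau_geo n : tau n <= tau 0%N / 2 ^+ n.
Proof.
elim: n => [|n IH]; first by rewrite expr0 divr1.
apply: (le_trans (tauS n)); rewrite exprSr invfM mulrA.
by rewrite ler_pM2r ?invr_gt0.
Qed.

Lemma tau_cvg0 d : 0 < d -> exists N, forall n, (N <= n)%N -> tau n <= d.
Proof.
move=> d0; have := archi_boundP (ltW (divr_gt0 (tau0 0) d0)).
set N := Num.bound _ => hN; exists N => n Nn.
apply: (le_trans (tau_geo n)); rewrite ler_pdivrMr ?exprn_gt0// mulrC -ler_pdivrMr//.
apply: (le_trans (ltW hN)); rewrite -natrX ler_nat.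
by apply: (leq_trans Nn); exact/ltnW/ltn_expl.
Qed.

Lemma tau_shift j d : 0 < d -> exists N, forall n, (N <= n)%N -> tau (j + n) <= d.
Proof.
move=> /tau_cvg0[N NP]; exists N => n Nn; apply: NP.
by apply: (leq_trans Nn); rewrite leq_addl.
Qed.

(** [T j \o ... \o T (j + n - 1)], with the newest map innermost. The start index makes tails
    available. *)
Fixpoint comp j n : V -> V := if n is m.+1 then comp j m \o T (j + m) else id.

Lemma T_ball k z : en z <= 1 -> en (T k z) <= 1.
Proof. by move=> z1; have [h _ _ _ _] := Tnice k; exact/ltW/h. Qed.

Lemma comp_ball j n z : en z <= 1 -> en (comp j n z) <= 1.
Proof. by elim: n z => //= n IH z z1; apply: IH; exact: T_ball. Qed.

Lemma comp_lip j n z w : en z <= 1 -> en w <= 1 ->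
  en (comp j n z - comp j n w) <= Lam (j + n) * en (z - w).
Proof.
elim: n z w => [|n IH] z w z1 w1 /=; first by rewrite addn0 ler_peMl ?en_ge0.
apply: (le_trans (IH _ _ (T_ball _ z1) (T_ball _ w1))); rewrite addnS.
by have [_ [_ h] _ _ _] := H (j + n); exact: h.
Qed.

Lemma comp_add j n m z : comp j (n + m) z = comp j n (comp (j + n) m z).
Proof.
elim: m z => [|m IH] z; first by rewrite addn0.
by rewrite addnS /= IH addnA.
Qed.

(** Makes the errors telescope: each step costs at most [tau k / 2], so everything from step [k] on
    costs at most [tau k]. *)
Lemma half_gap k : tau k / 2 <= tau k - tau k.+1.
Proof. by have := tauS k; lra. Qed.

Lemma comp_step j n z : en z <= 1 ->
  en (comp j n.+1 z - comp j n z) <= tau (j + n) - tau (j + n.+1).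
Proof.
move=> z1; rewrite addnS; apply: le_trans (half_gap _).
apply: (le_trans (comp_lip j n (T_ball (j + n) z1) z1)).
have [_ _ h _ _] := H (j + n).
apply: (le_trans (ler_wpM2l (ltW (Lam0 _)) (h z z1))).
rewrite le_eqVlt; apply/orP; left; apply/eqP; field.
by rewrite gt_eqF.
Qed.

Lemma comp_cauchy j n m z : en z <= 1 -> (n <= m)%N ->
  en (comp j m z - comp j n z) <= tau (j + n).
Proof.
move=> z1 nm; apply: (@le_trans _ _ (tau (j + n) - tau (j + m))); last first.
  by rewrite lerBlDr lerDl ltW.
elim: m nm => [|m IH]; first by rewrite leqn0 => /eqP->; rewrite !subrr en0.
rewrite leq_eqVlt => /predU1P[->|]; first by rewrite !subrr en0.
rewrite ltnS => /IH h; apply: (le_trans (en_tri (comp j m z) _ _)).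
by have := comp_step j m z1; lra.
Qed.

Lemma comp_limit_exists j z : exists c, en z <= 1 ->
  forall n, en (c - comp j n z) <= tau (j + n).
Proof.
have [z1|nz1] := pselect (en z <= 1); last by exists 0.
have [c cP] := @en_complete R (fun n => comp j n z) (fun n => tau (j + n))
  (@tau_shift j) (fun n m nm => comp_cauchy j z1 nm).
by exists c.
Qed.

Definition lcomp j z : V := projT1 (cid (comp_limit_exists j z)).

Lemma lcomp_close j n z : en z <= 1 -> en (lcomp j z - comp j n z) <= tau (j + n).
Proof. by move=> z1; rewrite /lcomp; case: cid => /= c; exact. Qed.

Lemma lcomp_id j z : en z <= 1 -> en (lcomp j z - z) <= tau j.
Proof. by move=> /(lcomp_close j 0); rewrite addn0. Qed.

Lemma lcomp_ball_le j z : en z <= 1 -> en (lcomp j z) <= 1.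
Proof.
move=> z1; rewrite -[lcomp j z]subr0.
apply: (@en_limit_le _ (fun n => comp j n z) (fun n => tau (j + n))).
- exact: tau_shift.
- by move=> n; exact: lcomp_close.
- by exists 0%N => n _; rewrite subr0 comp_ball.
Qed.

(** The Lipschitz bound on [comp j n] lets the limit pass through it. Questions about [lcomp j] thus
    reduce to a finite composition and a tail close to the identity. *)
Lemma lcomp_comp j n z : en z <= 1 -> lcomp j z = comp j n (lcomp (j + n) z).
Proof.
move=> z1; apply/eqP; rewrite -subr_eq0; apply/eqP/en_eq0/eqP.
rewrite eq_le en_ge0 andbT; apply/ler_addgt0Pr => d d0; rewrite add0r.
apply: (@en_limit_le _ (fun m => comp j m z) (fun n => tau (j + n))).
- exact: tau_shift.
- by move=> m; exact: lcomp_close.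
- have [N NP] := tau_shift (j + n) (divr_gt0 d0 (Lam0 (j + n))).
  exists (n + N)%N => m nm; have -> : m = (n + (m - n))%N.
    by rewrite subnKC// (leq_trans _ nm)// leq_addr.
  rewrite comp_add.
  apply: (le_trans (comp_lip j n (comp_ball _ _ z1) (lcomp_ball_le (j + n) z1))).
  rewrite mulrC -ler_pdivlMr// enB.
  apply: (le_trans (lcomp_close (j + n) (m - n) z1)); apply: NP.
  by rewrite leq_subRL// (leq_trans _ nm)// leq_addr.
Qed.

Lemma lcomp_ball j z : en z <= 1 -> en (lcomp j z) < 1.
Proof.
move=> z1; rewrite (lcomp_comp j 1 z1) /= addn0.
by have [h _ _ _ _] := Tnice j; exact/h/lcomp_ball_le.
Qed.

Lemma comp_inj j n z w : en z <= 1 -> en w <= 1 ->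
  comp j n z = comp j n w -> z = w.
Proof.
elim: n z w => // n IH z w z1 w1 /= /(IH _ _ (T_ball _ z1) (T_ball _ w1)).
by have [_ h _ _ _] := Tnice (j + n); exact: h.
Qed.

(** Uniform limits need not preserve injectivity. Here injectivity of the finite compositions
    carries the equality over to all tails [lcomp (j + N)], which tend to the identity. *)
Lemma lcomp_inj j z w : en z <= 1 -> en w <= 1 -> lcomp j z = lcomp j w -> z = w.
Proof.
move=> z1 w1 zw; apply/eqP; rewrite -subr_eq0; apply/eqP/en_eq0/eqP.
rewrite eq_le en_ge0 andbT; apply/ler_addgt0Pr => d d0; rewrite add0r.
have [N NP] := tau_shift j (divr_gt0 d0 (ltr0n _ 2)); have tN := NP N (leqnn N).
have E : lcomp (j + N) z = lcomp (j + N) w.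
  apply: (comp_inj (j := j) (n := N)); try exact: lcomp_ball_le.
  by rewrite -!lcomp_comp.
apply: (le_trans (en_tri (lcomp (j + N) z) _ _)); rewrite {2}E enB (splitr d).
by rewrite lerD//; apply: le_trans tN; exact: lcomp_id.
Qed.

(** The point is pulled back through one map after the other. The displacements, weighted by [Lam],
    telescope, so the preimages converge fast enough for [comp j N] of their limit to tend to
    [w]. *)
Lemma lcomp_covers j w : en w <= 1 - 2 * tau j ->
  exists2 x, en x < 1 & lcomp j x = w.
Proof.
move=> w1.
have /choice[S SP] : forall kw : nat * V, exists x, en kw.2 <= 1 - tau kw.1 ->
    en x <= 1 /\ T kw.1 x = kw.2.
  move=> [k v] /=; have [h|nh] := pselect (en v <= 1 - tau k); last by exists 0.
  by have [_ _ _ /(_ _ h)[z z1 zv] _] := H k; exists z.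
pose x := fix x n : V := if n is m.+1 then S ((j + m)%N, x m) else w.
(* The hypothesis on [w] is the case [n = 0]. A pullback adds at most [tau (j + n) / 2] to the norm,
   which the decrease of [tau] compensates. *)
have xP n : en (x n) <= 1 - tau j - tau (j + n) /\ comp j n (x n) = w.
  elim: n => [|n [IH1 IH2]]; first by rewrite addn0; split => //=; lra.
  have [|h1 h2] := SP ((j + n)%N, x n).
    by rewrite /=; have := tau0 j; lra.
  rewrite /= in h1 h2; split => /=; last by rewrite h2.
  have [_ _ h _ _] := H (j + n).
  have c := h _ h1; rewrite h2 enB in c.
  have L1 : tau (j + n) / (2 * Lam (j + n)) <= tau (j + n) / 2.
    rewrite ler_wpM2l ?(ltW (tau0 _))// lef_pV2 ?posrE ?mulr_gt0//.
    by rewrite ler_peMr.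
  have hg := half_gap (j + n); rewrite addnS.
  rewrite -[S _](subrK (x n)); apply: (le_trans (enD _ _)); lra.
have xb n : en (x n) <= 1.
  by have [h _] := xP n; have := tau0 j; have := tau0 (j + n); lra.
have xstep n : Lam (j + n) * en (x n.+1 - x n) <= tau (j + n) - tau (j + n.+1).
  rewrite addnS; apply: le_trans (half_gap _).
  have [|h1 h2] := SP ((j + n)%N, x n).
    by rewrite /=; have [h _] := xP n; have := tau0 j; lra.
  rewrite /= in h1 h2; have [_ _ h _ _] := H (j + n).
  have c := h _ h1; rewrite h2 enB in c.
  apply: (le_trans (ler_wpM2l (ltW (Lam0 _)) c)).
  rewrite le_eqVlt; apply/orP; left; apply/eqP; field.
  by rewrite gt_eqF.
have xc n m : (n <= m)%N -> Lam (j + n) * en (x m - x n) <= tau (j + n) - tau (j + m).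
  elim: m => [|m IH]; first by rewrite leqn0 => /eqP->; rewrite !subrr en0 mulr0.
  rewrite leq_eqVlt => /predU1P[->|]; first by rewrite !subrr en0 mulr0.
  rewrite ltnS => nm; have h := IH nm.
  have h' : Lam (j + n) * en (x m.+1 - x m) <= tau (j + m) - tau (j + m.+1).
    apply: le_trans (xstep m); rewrite ler_wpM2r ?en_ge0//.
    by apply: Lam_mono; rewrite leq_add2l.
  have := ler_wpM2l (ltW (Lam0 (j + n))) (en_tri (x m) (x m.+1) (x n)).
  by rewrite [X in _ <= X]mulrDr; lra.
have [y yP] : exists y, forall n, en (y - x n) <= tau (j + n) / Lam (j + n).
  apply: en_complete.
    move=> d /(tau_shift j)[N NP]; exists N => n Nn; apply: le_trans (NP n Nn).
    by rewrite ler_pdivrMr// ler_peMr// ltW.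
  move=> n m nm; rewrite ler_pdivlMr// mulrC; apply: (le_trans (xc n m nm)).
  by rewrite lerBlDr lerDl ltW.
have y1 : en y <= 1 - tau j.
  apply/ler_addgt0Pr => d d0; have [N NP] := tau_shift j d0.
  have [h _] := xP N; have := yP N; have tN := tau0 (j + N).
  have : tau (j + N) / Lam (j + N) <= tau (j + N).
    by rewrite ler_pdivrMr// ler_peMr// ltW.
  have := enD (y - x N) (x N); rewrite subrK; lra.
have y1' : en y <= 1 by have := tau0 j; lra.
exists y; first by have := tau0 j; lra.
apply/eqP; rewrite -subr_eq0; apply/eqP/en_eq0/eqP.
rewrite eq_le en_ge0 andbT; apply/ler_addgt0Pr => d d0; rewrite add0r.
have [N NP] := tau_shift j (divr_gt0 d0 (ltr0n _ 2)); have tN := NP N (leqnn N).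
apply: (le_trans (en_tri (comp j N y) _ _)); rewrite (splitr d) lerD//.
  by apply: le_trans tN; exact: lcomp_close.
have [_ <-] := xP N; apply: le_trans tN.
apply: (le_trans (comp_lip j N y1' (xb N))).
by rewrite mulrC -ler_pdivlMr.
Qed.

Lemma comp_differentiable j n z : en z <= 1 -> differentiable (comp j n) z.
Proof.
elim: n z => [|n IH] z z1 //=; have [_ _ h _ _] := Tnice (j + n).
apply: (@differentiable_comp _ _ _ _ (T (j + n)) (comp j n)); first exact: h.
by apply: IH; exact: T_ball.
Qed.

Lemma comp_locally_invertible j n z : en z <= 1 -> locally_invertible (comp j n) z.
Proof.
elim: n z => [|n IH] z z1 /=.
  by exists id; split => //; apply/nbhs_en; exists 1.
have [_ _ _ h _] := Tnice (j + n).
apply: (@locally_invertible_comp _ (comp j n) (T (j + n))); last exact: h.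
by apply: IH; exact: T_ball.
Qed.
End Composition.

(** * Maximality of the image *)

Section Density.
Variable R : realType.
Local Notation V := 'rV[R[i]^o]_3.
Local Notation en := (@euclidean_norm R 3).

Lemma injective_unbounded (f : nat -> nat) : injective f ->
  forall n, exists m, (n <= f m)%N.
Proof.
move=> fI n; apply: contrapT => nE.
have lt m : (f m < n)%N by rewrite ltnNge; apply/negP => h; apply: nE; exists m.
have := @leq_card 'I_n.+1 'I_n (fun m => Ordinal (lt m)).
rewrite !card_ord ltnn => /(_ _)/negP; apply => // a b [/fI ab].
exact: val_inj.
Qed.

Lemma dense_sphere_sequence : exists q : nat -> V, (forall k, en (q k) = 1) /\
  forall z, en z = 1 -> forall e, 0 < e -> forall n, exists2 k, (n <= k)%N &
    en (q k - z) < e.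
Proof.
(* The extra factor [nat] repeats every rational vector at infinitely many indices: approximations
   are needed at late indices, where [tau] is small. *)
pose D : countType := (nat * (rat * rat * (rat * rat) * (rat * rat)))%type.
pose v (d : D) : V := let: (_, (a, a', (b, b'), (c, c'))) := d in
  vec3 (ratr a +i* ratr a')%C (ratr b +i* ratr b')%C (ratr c +i* ratr c')%C.
pose nrm (w : V) : V := if en w == 0 then vec3 1 0 0 else ((en w)^-1)%:C%C *: w.
pose q k : V := if unpickle k is Some d then nrm (v d) else vec3 1 0 0.
exists q; split.
  move=> k; rewrite /q; case: unpickle => [d|]; last exact: en_e1.
  rewrite /nrm.
  case: eqP => [_|/eqP h]; first exact: en_e1.
  rewrite enZ normcR ger0_norm ?invr_ge0 ?en_ge0//.
  by rewrite mulVf.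
move=> z z1 e e0 n.
pose d := Num.min (e / 16) (1 / 16).
have d0 : 0 < d by rewrite lt_min !divr_gt0.
have de : d <= e / 16 by rewrite ge_min lexx.
have d1 : d <= 1 / 16 by rewrite ge_min lexx orbT.
have approx (x : R) : exists r : rat, `|ratr r - x| <= d.
  have [r] := @rat_in_itvoo R (x - d) (x + d) ltac:(lra).
  rewrite in_itv/= => /andP[h1 h2]; exists r; rewrite ler_norml.
  by apply/andP; split; lra.
have capprox (x : R[i]) : exists r : rat * rat,
    normc ((ratr r.1 +i* ratr r.2)%C - x) <= 2 * d.
  have [a aP] := approx (complex.Re x); have [b bP] := approx (complex.Im x).
  exists (a, b); apply: (le_trans (normc_le _)); rewrite Re_sub Im_sub/=; lra.
have [[a a'] ha] := capprox (z 0 i0); have [[b b'] hb] := capprox (z 0 i1).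
have [[c c'] hc] := capprox (z 0 i2); rewrite /= in ha hb hc.
pose dd m : D := (m, (a, a', (b, b'), (c, c'))).
have [m nm] := @injective_unbounded (fun m => pickle (dd m))
  (fun m m' => fun E => congr1 fst (pcan_inj pickleK E)) n.
exists (pickle (dd m)) => //; rewrite /q pickleK.
set w := v (dd m); have wz : en (w - z) <= 6 * d.
  apply: (le_trans (en_le_sum _)); rewrite /w /v/=.
  rewrite ![(_ - z) 0 _]mxE ![(- z) 0 _]mxE !vec3E; lra.
have w1 : `|en w - 1| <= 6 * d.
  have h1 := enD (w - z) z; have h2 := enD (z - w) w.
  rewrite !subrK z1 in h1 h2; rewrite [en (z - w)]enB in h2.
  by rewrite ler_norml; apply/andP; split; lra.
have w0 : en w != 0.
  by apply/eqP => E; move: w1; rewrite E ler_norml => /andP[]; lra.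
rewrite /nrm (negPf w0); apply: (le_lt_trans (en_tri w _ _)).
have -> : ((en w)^-1)%:C%C *: w - w = ((en w)^-1 * (1 - en w))%:C%C *: w.
  by rewrite mulrBr mulVf// mulr1 rmorphB rmorph1 scalerBl scale1r.
rewrite enZ normcR normrM (ger0_norm (_ : 0 <= (en w)^-1)) ?invr_ge0 ?en_ge0//.
by rewrite mulrAC mulVf// mul1r distrC; lra.
Qed.
End Density.

Section Main.
Variable R : realType.
Local Notation V := 'rV[R[i]^o]_3.
Local Notation en := (@euclidean_norm R 3).
Variables (T : nat -> V -> V) (tau Lam : nat -> R) (q : nat -> V).
Hypothesis H : nice_sequence T tau Lam q.
Implicit Types (z w x y : V).
Let phi := lcomp H 0.
Let tau0 k : 0 < tau k. Proof. by have [[]] := H k. Qed.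
Let Lam1 k : 1 <= Lam k. Proof. by have [[]] := H k. Qed.
Let U : set V := phi @` unit_ball R 3.

Let phiE n z : en z <= 1 -> phi z = comp T 0 n (lcomp H n z).
Proof. exact: (lcomp_comp H 0 n). Qed.

Lemma phi_close n z : en z <= 1 -> en (phi z - comp T 0 n z) <= tau n.
Proof. exact: (lcomp_close H 0 n). Qed.

Lemma phi_uniformly_continuous e : 0 < e -> exists2 d, 0 < d &
  forall z w, en z <= 1 -> en w <= 1 -> en (w - z) < d -> en (phi w - phi z) < e.
Proof.
move=> e0; have e3 : 0 < e / 3 by rewrite divr_gt0.
have [N NP] := tau_cvg0 H e3; have tN := NP N (leqnn N).
have L0 : 0 < Lam N by exact: lt_le_trans (Lam1 N).
exists (e / 3 / Lam N); first by rewrite divr_gt0.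
move=> z w z1 w1; rewrite ltr_pdivlMr// => zw.
have h1 := phi_close N w1; have h2 := phi_close N z1.
have h3 := comp_lip H 0 N w1 z1; rewrite add0n in h3.
have := en_tri (comp T 0 N w) (phi w) (phi z).
have := en_tri (comp T 0 N z) (comp T 0 N w) (phi z).
by rewrite [en (comp T 0 N z - phi z)]enB; lra.
Qed.

Lemma phi_continuous : {within cball (R := R), continuous phi}.
Proof.
apply: within_continuous => z z1 e /phi_uniformly_continuous[d d0 dP].
by exists d => // w w1; exact: dP.
Qed.

Lemma ball_nv z : en z < 1 -> exists2 r, 0 < r &
  forall y, nv (y - z) < r -> en y < 1.
Proof.
move=> z1; exists ((1 - en z) / 2); first by rewrite divr_gt0// subr_gt0.
move=> y; rewrite ltr_pdivlMr// mulrC => yz; have := en_le_nv (y - z).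
by have := enD (y - z) z; rewrite subrK; lra.
Qed.

Lemma phi_holomorphic z : en z < 1 -> differentiable phi z.
Proof.
move=> z1; have [r r0 rP] := ball_nv z1; apply: differentiable_row => i.
apply: (@uniform_limit_differentiable _ _ (fun n y => comp T 0 n y 0 i) _ z r r0).
  move=> k y /rP/ltW y1; apply: differentiable_rowP.
  exact: (comp_differentiable H).
move=> e /(tau_cvg0 H)[N NP]; exists N => k y Nk /rP/ltW y1.
apply: le_trans (NP k Nk); apply: le_trans (phi_close k y1).
by rewrite enB; have := coord_le_en (comp T 0 k y - phi y) i; rewrite !mxE.
Qed.

(** For large [N] the point [lcomp H N x] lies in the ball of radius [1 - 2 * tau N], which
    [lcomp H N] covers; the local inverses of the finite composition then give a neighbourhood of
    [phi x]. *)
Lemma phi_open x : en x < 1 -> nbhs (phi x) U.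
Proof.
move=> x1; have x0 : 0 < 1 - en x by rewrite subr_gt0.
have [N NP] := tau_cvg0 H (divr_gt0 x0 (ltr0n _ 4)); have tN := NP N (leqnn N).
have lx := lcomp_id H N (ltW x1).
have h : en (lcomp H N x) < 1 - 2 * tau N.
  by have := enD (lcomp H N x - x) x; rewrite subrK; lra.
rewrite (phiE N (ltW x1)).
have /(locally_invertible_open (comp_locally_invertible H 0 N (lcomp_ball_le H N (ltW x1)))) :
    nbhs (lcomp H N x) [set w | en w < 1 - 2 * tau N].
  apply/nbhs_en; exists (1 - 2 * tau N - en (lcomp H N x)); first by rewrite subr_gt0.
  move=> w wx /=; have := enD (w - lcomp H N x) (lcomp H N x); rewrite subrK; lra.
apply: filterS => _ [w /ltW w1 <-]; have [y y1 <-] := lcomp_covers H w1.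
by exists y => //; rewrite -phiE// ltW.
Qed.

Lemma phi_inj z w : en z <= 1 -> en w <= 1 -> phi z = phi w -> z = w.
Proof. exact: lcomp_inj. Qed.

(** On a ball inside [U], the inverse of [comp T 0 n] sends [phi y] to [lcomp H n y], which is
    within [tau n] of [y]. So [l \o phi'] is a uniform limit of differentiable functions. *)
Lemma inverse_holomorphic (l : V -> R[i]^o) (phi' : V -> V) :
  (forall z w, normc (l z - l w) <= en (z - w)) ->
  (forall z, differentiable l z) -> (forall x, en x < 1 -> phi' (phi x) = x) ->
  holomorphic_on U (l \o phi').
Proof.
move=> lL ld phiK _ [x x1 <-]; have [r r0 rP] := (nbhs_nv _ _).1 (phi_open x1).
(* [F (n, w)] is the unique preimage of [w] in the closed ball, and 0 if there is none. Uniqueness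
   identifies it near [phi y] with the local inverse [S], whose values stay in the ball. *)
have /choice[F FP] : forall nw : nat * V, exists y, forall y', en y' <= 1 ->
    comp T 0 nw.1 y' = nw.2 -> y = y'.
  move=> [n w] /=; have [[y [y1 yw]]|ny] := pselect (exists y, en y <= 1 /\ comp T 0 n y = w).
    by exists y => y' y'1 y'w; apply: (comp_inj H (j := 0) (n := n)) => //; rewrite yw y'w.
  by exists 0 => y' y'1 y'w; case: ny; exists y'.
have FE n y : en y <= 1 -> F (n, phi y) = lcomp H n y.
  by move=> y1; apply: FP => /=; [exact: lcomp_ball_le|rewrite -phiE].
apply: (@uniform_limit_differentiable _ _ (fun n w => l (F (n, w))) _ _ r r0).
  move=> n w /rP[y y1 <-]; have y1' := ltW y1.
  apply: (@differentiable_comp _ _ _ _ (fun w => F (n, w)) l) => //.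
  have [S [s d nS]] := comp_locally_invertible H 0 n (lcomp_ball_le H n y1').
  rewrite -(phiE n y1') in s d nS; apply: (near_differentiable _ d).
  have : \forall w \near phi y, en (S w) < 1.
    have [r' r'0 r'P] := ball_nv (lcomp_ball H n y1').
    have Sc := differentiable_continuous d.
    apply: (Sc [set w | en w < 1]); rewrite s; apply/nbhs_nv.
    by exists r'.
  by apply: filterS2 nS => w' e1 /ltW e2; exact: FP.
move=> e /(tau_cvg0 H)[N NP]; exists N => n w Nn /rP[y y1 <-] /=.
rewrite phiK// (FE _ _ (ltW y1)); apply: (le_trans (lL _ _)).
by apply: le_trans (NP n Nn); exact/lcomp_id/ltW.
Qed.

(** A disc witness near [z] at a late index gives a disc in [Omega] whose outer annulus lies in [U].
    An approximant [G] of [l \o phi'] on the annulus would, by [center_bound], force [normc (p 0)]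
    to be at most [6 * t], against [12 * t <= normc (p 0)]. *)
Lemma not_runge_through_boundary (Omega : set V) z : open Omega ->
  (forall e, 0 < e -> forall n, exists2 k, (n <= k)%N & en (q k - z) < e) ->
  en z = 1 -> Omega (phi z) -> U `<=` Omega -> ~ runge_in U Omega.
Proof.
move=> Oo qz z1 Oz UO rU.
have [r r0 rP] := (nbhs_en _ _).1 (open_nbhs_nbhs (conj Oo Oz)).
have [d d0 dP] := phi_uniformly_continuous (divr_gt0 r0 (ltr0n _ 2)).
(* [d / 2] bounds the distance of the disc to [q k], and [r / 2] the error from replacing [phi] by
   the finite composition [F]. *)
have m0 : 0 < Num.min (d / 2) (r / 2) by rewrite lt_min !divr_gt0.
have [N NP] := tau_cvg0 H m0; have [k Nk qk] := qz _ (divr_gt0 d0 (ltr0n _ 2)) N.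
have [tk1 tk2] : tau k <= d / 2 /\ tau k <= r / 2.
  by have := NP k Nk; rewrite le_min => /andP.
have [_ _ _ _ [D [g [l [p [[W1 W2 W3 W4 [W5 p0]] tp]]]]]] := H k.
set t := tau k.+1 in W2 tp; have t0 : 0 < t by exact: tau0.
pose F := comp T 0 k.
have FO (x : R[i]^o) : normc x <= 3 / 2 -> Omega (F (D x)).
  move=> x3; have [Dx1 Dxq _] := W1 x x3; have Dx := ltW Dx1.
  apply: rP; apply: (le_lt_trans (en_tri (phi (D x)) _ _)).
  have : en (phi (D x) - phi z) < r / 2.
    apply: dP => //; first by rewrite z1.
    by apply: (le_lt_trans (en_tri (q k) _ _)); lra.
  by have := phi_close k Dx; rewrite enB -/F; lra.
have Fd (x : R[i]^o) : normc x <= 3 / 2 -> differentiable (F \o D) x.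
  move=> x3; have [Dx1 _ Dd] := W1 x x3.
  by apply: differentiable_comp Dd _; apply: (comp_differentiable H); exact: ltW.
(* The loop is covered by the tail [lcomp H k.+1], so [F (D x)] lies exactly in [U]; only the value
   of [l] there is perturbed. *)
have hit (x : R[i]^o) : 1 <= normc x <= 3 / 2 -> exists y,
    [/\ en y < 1, phi y = F (D x) & normc (l y - l (g x)) <= t].
  move=> x13; have [gx Tg _] := W2 x x13.
  have [y y1 yg] := lcomp_covers H gx; exists y; split => //.
    by rewrite (phiE k.+1 (ltW y1)) yg /= add0n Tg.
  by apply: (le_trans (W3 _ _)); rewrite -yg enB; exact/lcomp_id/ltW.
have /choice[phi' phi'P] : forall w, exists x, forall y, en y < 1 -> phi y = w -> x = y.
  move=> w; have [[y [y1 yw]]|ny] := pselect (exists y, en y < 1 /\ phi y = w).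
    exists y => y' y'1 y'w; apply: phi_inj; [exact: ltW|exact: ltW|].
    by rewrite yw y'w.
  by exists 0 => y' y'1 y'w; case: ny; exists y'.
have phiK x : en x < 1 -> phi' (phi x) = x by move=> x1; exact: phi'P.
have fh := inverse_holomorphic W3 W4 phiK.
pose A : set R[i]^o := [set x | 1 <= normc x <= 3 / 2].
pose K := (F \o D) @` A.
have KK : compact K.
  apply: continuous_compact; last exact: compact_annulus.
  apply: continuous_in_subspaceT => x; rewrite inE => /andP[_ x3].
  exact: differentiable_continuous (Fd x x3).
have KU : K `<=` U.
  by move=> _ [x x13 <-]; have [y [y1 yF _]] := hit x x13; exists y.
have [G Gh GK] := rU _ fh K KK KU t t0.
have GF (x : R[i]^o) : 1 <= normc x <= 3 / 2 -> normc (G (F (D x)) - l (g x)) <= 2 * t.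
  move=> x13; have [y [y1 yF yg]] := hit x x13.
  have := GK (F (D x)) (ex_intro2 _ _ x x13 erefl).
  rewrite /= -{1}yF phiK// => h.
  have -> : G (F (D x)) - l (g x) = - (l y - G (F (D x))) + (l y - l (g x)).
    by rewrite opprB addrA subrK.
  by apply: (le_trans (le_normcD _ _)); rewrite normcN; lra.
(* The factor [x] clears the pole: on the annulus this is [x] times the approximation error, at most
   [3 / 2 * (2 * t)], while its value at 0 is [- p 0]. *)
pose h (x : R[i]^o) : R[i]^o := x * G (F (D x)) - p x.
have hd (x : R[i]^o) : normc x <= 3 / 2 -> differentiable h x.
  move=> x3; apply: differentiableB; last exact: W5.
  apply: differentiableM => //; apply: (@differentiable_comp _ _ _ _ (F \o D) G).
    exact: Fd.
  by apply: Gh; exact: FO.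
have : normc (- p 0) <= 2 * (3 / 2 * (2 * t)).
  apply: (@center_bound _ h (- p 0) 1) => //.
  - by move=> x _; rewrite mulr1; exact: hd.
  - move=> e e0; have h0 : differentiable h 0 by apply: hd; rewrite normc0; lra.
    have [s s0 sP] := differentiable_eps h0 e0; exists s => // x _ xs.
    have := sP x; rewrite subr0 => /(_ xs) /ltW.
    by rewrite {2}/h mul0r sub0r.
  - move=> x; rewrite mulr1 => x13; have [_ _ xp] := W2 x x13.
    rewrite /h -xp -mulrBr normcM; have /andP[_ x3] := x13.
    by rewrite ler_pM ?normc_ge0// GF.
by rewrite normcN; lra.
Qed.

Lemma phi_image_maximal (Omega : set V) :
  (forall z, en z = 1 -> forall e, 0 < e -> forall n,
     exists2 k, (n <= k)%N & en (q k - z) < e) ->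
  is_domain Omega -> U `<=` Omega -> runge_in U Omega -> U = Omega.
Proof.
move=> qd [Oo Oc] UO rU; apply: Oc.
- by exists (phi 0), 0 => //; rewrite /unit_ball/= en0.
- exists U; last by apply/seteqP; split => [w Uw|w []//]; split => //; exact: UO.
  by rewrite openE => _ [x x1 <-]; exact: phi_open.
(* Relative closedness: this compact set exceeds [U] only by images of the unit sphere, which
   [Omega] avoids. *)
- exists (phi @` cball (R := R)).
    apply: compact_closed; first exact: norm_hausdorff.
    by apply: continuous_compact; [exact: phi_continuous|exact: compact_cball].
  apply/seteqP; split => [w Uw|w [Ow [x /= x1 xw]]].
    split; first exact: UO.
    by case: Uw => x x1 xw; exists x => //; exact: ltW.
  move: x1; rewrite /cball/= le_eqVlt => /predU1P[x1|x1]; last by exists x.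
  exfalso; apply: (not_runge_through_boundary Oo (qd x x1) x1) => //.
  by rewrite xw.
Qed.
End Main.

Theorem theorem1p1 (R : realType) (eps : R) (eps_gt0 : 0 < eps) :
  exists phi : 'rV[R[i]^o]_3 -> 'rV[R[i]^o]_3,
    [/\ {within closure (unit_ball R 3), continuous phi},
        set_inj (closure (unit_ball R 3)) phi,
        holomorphic_on (unit_ball R 3) phi,
        (sup_norm (closure (unit_ball R 3)) (fun z => phi z - z)%R < eps%:E)%E
      & forall Omega : set 'rV[R[i]^o]_3,
          is_domain Omega ->
          phi @` unit_ball R 3 `<=` Omega ->
          runge_in (phi @` unit_ball R 3) Omega ->
          phi @` unit_ball R 3 = Omega].
Proof.
have [q [q1 qd]] := dense_sphere_sequence R.
(* Half of [eps] leaves room for the strict inequality on the supremum; the bound 1 is required of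
   [tau]. *)
pose e := Num.min (eps / 2) 1.
have e0 : 0 < e by rewrite lt_min divr_gt0// ltr01.
have ee : e <= eps / 2 by rewrite ge_min lexx.
have e1 : e <= 1 by rewrite ge_min lexx orbT.
have [T [tau [Lam [H tE]]]] := nice_sequence_exists q1 e0 e1.
exists (lcomp H 0); split.
- exact: (continuous_subspaceW (@closure_ball R) (phi_continuous (H := H))).
- move=> z w /set_mem/closure_ball z1 /set_mem/closure_ball w1; exact: lcomp_inj.
- move=> z z1; exact: (phi_holomorphic H z1).
- apply: (@le_lt_trans _ _ e%:E); last by rewrite lte_fin; lra.
  apply: ge_ereal_sup => _ [z /closure_ball z1 <-]; rewrite lee_fin -tE.
  exact: lcomp_id.
- by move=> Omega Od UO rU; apply: phi_image_maximal.
Qed.
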